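(* Suppose that $\partial A \in C^{1,1}$ or $A$ is convex. Let $k \in \mathbb{N}$. Then as $n \to \infty$, $$\mathbb{E}[\tilde N_{n,k}] \sim \tfrac12 (\ln n)^2; \qquad \tilde N_{n,k} \sim \tfrac12 (\ln n)^2 \quad \text{almost surely},$$ and $$\tilde\nu_{n,k}^{1/\sqrt{n}} \to \exp(\sqrt{2}) \quad \text{almost surely}.$$
   Context: Setting: $d \in \mathbb{N}$; $A \subset \mathbb{R}^d$ is compact with non-empty interior and $\overline{A^o} = A$ (interior $D^o$, closure $\overline{D}$, $\partial D = \overline{D}\setminus D^o$). $X_1, X_2, \ldots$ are independent identically distributed random vectors in $\mathbb{R}^d$ with probability density function $f$ with support $A$; $f$ is continuous on $A$ and $f_0 := \inf_{x \in A} f(x) > 0$. For $d \ge 2$, $\partial A \in C^{1,1}$ means: for each $x \in \partial A$ there exist a neighbourhood $U$ of $x$ and a real-valued function $\phi$, defined on an open set in $\mathbb{R}^{d-1}$ and Lipschitz-continuously differentiable, such that $\partial A \cap U$, after a rotation, is the graph of $\phi$. For $d = 1$, $\partial A \in C^{1,1}$ means that $A$ is a finite union of intervals. Notation: $B(x,r) = \{y \in \mathbb{R}^d : \|y-x\| \le r\}$. $\mathcal{X}_n = \{X_1,\ldots,X_n\}$, and $\mathcal{X}_n(D)$ is the number of points of $\mathcal{X}_n$ in $D$. $A^{(r)} := \{x \in A : B(x,r) \subset A\}$. For $n \ge k$, $$\tilde R_{n,k} := \inf\{ r>0 : \mathcal{X}_n(B(x,r)) \ge k \ \ \forall x \in A^{(r)}\}$$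 (the maximal $k$-spacing is $\theta \tilde R_{n,k}^d$, where $\theta$ is the volume of the unit ball in $\mathbb{R}^d$). It is non-increasing in $n$. The number of records is, for $n > k$, $$\tilde N_{n,k} := 1 + \sum_{i=k+1}^n \mathbf{1}_{\{\tilde R_{i,k} < \tilde R_{i-1,k}\}},$$ and the record times are $\tilde\nu_{1,k} := k$ and, for each successive $m \ge 1$, $\tilde\nu_{m+1,k} := \inf\{n > \tilde\nu_{m,k} : \tilde R_{n,k} < \tilde R_{n-1,k}\}$. $g(n) \sim h(n)$ means $g(n)/h(n) \to 1$ as $n \to \infty$. *)

(* Defs.v *)
From HB Require Import structures.
From mathcomp Require Import all_boot all_order all_algebra finmap.
From mathcomp Require Import all_classical all_reals all_analysis.
From mathcomp Require Import measurable_realfun.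
Import Order.TTheory GRing.Theory Num.Theory numFieldNormedType.Exports.

Set Implicit Arguments.
Unset Strict Implicit.
Unset Printing Implicit Defensive.

Local Open Scope classical_set_scope.
Local Open Scope ring_scope.

(* Row vectors with their Borel sigma-algebra; convertible to ['rV[R]_n]. *)
Notation borel_rV R n := (g_sigma_algebraType (@open 'rV[R]_n)).

Section lebesgue_measure_rV.
Context {R : realType}.

Definition cons_rV n (p : R * 'rV[R]_n) : 'rV[R]_n.+1 :=
  @row_mx R 1 1 n p.1%:M p.2.

Lemma cons_rV0 n (p : R * 'rV[R]_n) : cons_rV p ord0 ord0 = p.1.
Proof.
by rewrite /cons_rV mxE; case: splitP => //= j _; rewrite (ord1 j) mxE eqxx.
Qed.

Lemma cons_rVS n (p : R * 'rV[R]_n) (i : 'I_n) :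
  cons_rV p ord0 (lift ord0 i) = p.2 ord0 i.
Proof.
rewrite /cons_rV mxE; case: splitP => [j|j] /=; first by case: j => -[].
by move=> [ij]; congr (p.2 _ _); apply/val_inj.
Qed.

Lemma ball_rVS n (v w : 'rV[R]_n.+1) (e : R) : 0 < e ->
  ball v e w <-> ball (v ord0 ord0) e (w ord0 ord0) /\
    ball (\row_i v ord0 (lift ord0 i)) e (\row_i w ord0 (lift ord0 i)).
Proof.
move=> e0; split.
  move=> [_ vw]; split; first exact: vw.
  by split=> // i j; rewrite !mxE; exact: vw.
move=> [vw0 [_ vwS]]; split=> // i j; rewrite (ord1 i).
have [k ->|->] := unliftP ord0 j; last exact: vw0.
by have := vwS ord0 k; rewrite !mxE.
Qed.

Definition ratball n (q : 'rV[rat]_n * nat) : set 'rV[R]_n :=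
  ball (map_mx ratr q.1 : 'rV[R]_n) q.2.+1%:R^-1.

Lemma open_rV_bigcup n (O : set 'rV[R]_n) : open O ->
  O = \bigcup_(q : 'rV[rat]_n * nat)
        (if pselect (ratball q `<=` O) then ratball q else set0).
Proof.
move=> oO; apply/seteqP; split=> x; last first.
  by move=> [q _]; case: pselect => // qO /qO.
move=> Ox.
have /nbhs_ballP[e /= e0 xeO] : nbhs x O by exact: open_nbhs_nbhs.
have [m me] : exists m : nat, (m.+1%:R^-1 : R) < e / 2.
  have e20 : 0 < e / 2 by rewrite divr_gt0.
  have [m _ /(_ m (leqnn m)) /=] := near_infty_natSinv_lt (PosNum e20).
  by exists m.
have mgt0 : (0 : R) < m.+1%:R^-1 by rewrite invr_gt0.
have /choice[q qP] : forall i, exists q : rat, `|ratr q - x ord0 i| < m.+1%:R^-1.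
  move=> i.
  have [|q /[!in_itv] /andP[q1 q2]] := @rat_in_itvoo R (x ord0 i) (x ord0 i + m.+1%:R^-1).
    by rewrite ltrDl.
  exists q; rewrite ger0_norm ?subr_ge0 ?ltW//.
  by rewrite ltrBlDl.
have qx : ball (map_mx ratr (\row_i q i) : 'rV[R]_n) m.+1%:R^-1 x.
  by split=> // i j; rewrite !mxE (ord1 i); exact: qP.
exists (\row_i q i, m) => //=; case: pselect => // -[]; apply: subset_trans xeO.
move=> y qy; apply: (@le_ball _ _ x (m.+1%:R^-1 + m.+1%:R^-1)).
  by rewrite (splitr e) lerD// ltW.
by apply: ball_triangle qy; exact: ball_sym.
Qed.

Lemma measurable_ball_rV n (v : 'rV[R]_n) (e : R) :
  measurable (ball v e : set (borel_rV R n)).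
Proof. by apply: sub_sigma_algebra; exact: ball_open. Qed.

Lemma measurable_cons_rV n :
  measurable_fun [set: measurableTypeR R * borel_rV R n]
    (@cons_rV n : _ -> borel_rV R n.+1).
Proof.
apply: (@measurability _ _ _ (borel_rV R n.+1) _ _ open) => // _ [U oU <-].
rewrite setTI.
rewrite (open_rV_bigcup oU) preimage_bigcup.
apply: countable_bigcupT_measurable => [|[q m]]; first exact: countableP.
case: ifPn => _; last by rewrite preimage_set0; exact: measurable0.
rewrite [X in measurable X](_ : _ =
    ball (ratr (q ord0 ord0) : R) m.+1%:R^-1 `*`
    ball (\row_i ratr (q ord0 (lift ord0 i)) : 'rV[R]_n) m.+1%:R^-1).
  apply: measurableX; last exact: measurable_ball_rV.
  by rewrite ball_itv; exact: measurable_itv.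
have m0 : (0 : R) < m.+1%:R^-1 by rewrite invr_gt0.
have rowS (p : R * 'rV[R]_n) : \row_i cons_rV p ord0 (lift ord0 i) = p.2.
  by apply/rowP => i; rewrite mxE cons_rVS.
have rowr : \row_i (map_mx ratr q : 'rV[R]_n.+1) ord0 (lift ord0 i) =
    \row_i ratr (q ord0 (lift ord0 i)) :> 'rV[R]_n.
  by apply/rowP => i; rewrite !mxE.
apply/seteqP; split=> p.
  by move=> /(ball_rVS _ _ m0); rewrite cons_rV0 rowS rowr mxE.
by move=> ?; apply/(ball_rVS _ _ m0); rewrite cons_rV0 rowS rowr mxE.
Qed.

Definition uncons_rV n (v : 'rV[R]_n.+1) : R * 'rV[R]_n :=
  (v ord0 ord0, \row_i v ord0 (lift ord0 i)).

Lemma cons_rVK n : cancel (@cons_rV n) (@uncons_rV n).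
Proof.
move=> [x v]; rewrite /uncons_rV cons_rV0; congr pair.
by apply/rowP => i; rewrite mxE cons_rVS.
Qed.

Lemma measurable_uncons_rV n :
  measurable_fun [set: borel_rV R n.+1]
    (@uncons_rV n : _ -> measurableTypeR R * borel_rV R n).
Proof.
apply/measurable_fun_pairP; split.
  apply: (@measurability _ _ (borel_rV R n.+1) (measurableTypeR R) _ _ _
    (RGenOInfty.measurableE R)).
  move=> _ [_ [a ->] <-]; rewrite setTI; apply: sub_sigma_algebra.
  apply: (@open_comp 'rV[R]_n.+1 R) => [v _|]; first exact: coord_continuous.
  exact: interval_open.
apply: (@measurability _ _ _ (borel_rV R n) _ _ open) => // _ [U oU <-].
rewrite setTI; apply: sub_sigma_algebra.
rewrite openE => v Uv; apply/nbhs_ballP.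
have /nbhs_ballP[e /= e0 vU] : nbhs (uncons_rV v).2 U by exact: open_nbhs_nbhs.
by exists e => //= w /(ball_rVS _ _ e0)[_]; exact: vU.
Qed.

Section step.
Context n (mu : {sigma_finite_measure set (borel_rV R n) -> \bar R}).

Definition cons_measure : set (borel_rV R n.+1) -> \bar R :=
  pushforward (@lebesgue_measure R \x mu)%E
    (@cons_rV n : measurableTypeR R * borel_rV R n -> borel_rV R n.+1).

Let cons_measure0 : cons_measure set0 = 0%E.
Proof. by rewrite /cons_measure /pushforward preimage_set0 measure0. Qed.

Let cons_measure_ge0 A : (0 <= cons_measure A)%E.
Proof. exact: (measure_ge0 (@lebesgue_measure R \x mu)%E). Qed.

Let cons_measure_additive : semi_sigma_additive cons_measure.
Proof.
have mcons B : measurable B -> measurable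
    ((@cons_rV n : measurableTypeR R * borel_rV R n -> borel_rV R n.+1) @^-1` B).
  by move=> mB; rewrite -[X in measurable X]setTI; exact: measurable_cons_rV.
move=> F mF tF mUF; rewrite /cons_measure /pushforward preimage_bigcup.
apply: (@measure_semi_sigma_additive _ _ _ (@lebesgue_measure R \x mu)%E).
- by move=> i; exact: mcons.
- apply/trivIsetP => /= i j _ _ ij; rewrite -preimage_setI.
  by move/trivIsetP : tF => /(_ _ _ _ _ ij) ->//; rewrite preimage_set0.
- by rewrite -preimage_bigcup; exact: mcons.
Qed.

HB.instance Definition _ := isMeasure.Build _ _ _ cons_measure
  cons_measure0 cons_measure_ge0 cons_measure_additive.

Let cons_measure_sigma_finite : sigma_finite setT cons_measure.
Proof.
have /sigma_finiteP[F [TF ndF Foo]] := sigma_finiteT (@lebesgue_measure R).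
have /sigma_finiteP[G [TG ndG Goo]] := sigma_finiteT mu.
have TFG : setT = \bigcup_i (F i `*` G i).
  rewrite -setXTT TF TG predeqE => -[x y]; split.
    move=> [/= [i _ Fix] [k _ Gky]]; exists (maxn i k) => //; split.
    - by move: x Fix; exact/subsetPset/ndF/leq_maxl.
    - by move: y Gky; exact/subsetPset/ndG/leq_maxr.
  by move=> [i _ []/= ? ?]; split; exists i.
exists (fun i => (@uncons_rV n) @^-1` (F i `*` G i)).
  by rewrite -preimage_bigcup -TFG preimage_setT.
move=> i; have [mFi Fioo] := Foo i; have [mGi Gioo] := Goo i; split.
  rewrite -[X in measurable X]setTI; apply: measurable_uncons_rV => //.
  exact: measurableX.
rewrite /cons_measure /pushforward -comp_preimage.
rewrite (_ : _ \o _ = id); last by apply/funext => p; exact: cons_rVK.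
by rewrite preimage_id product_measure1E// lte_mul_pinfty// ge0_fin_numE.
Qed.

HB.instance Definition _ := Measure_isSigmaFinite.Build _ _ _ cons_measure
  cons_measure_sigma_finite.

End step.

(* n-fold product of the one-dimensional Lebesgue measure, transported from
   R * R^n to R^(1 + n); R^0 carries the unit mass. *)
Fixpoint lebesgue_measure_rV n :
    {sigma_finite_measure set (borel_rV R n) -> \bar R} :=
  match n with
  | 0 => @dirac _ (borel_rV R 0) 0 R
  | n'.+1 => cons_measure (lebesgue_measure_rV n')
  end.

End lebesgue_measure_rV.

Section geometry.
Context {R : realType}.

(* The norm of the library on ['rV[R]_n] is the sup norm. *)
Definition l2norm n (v : 'rV[R]_n) : R := Num.sqrt (\sum_i v ord0 i ^+ 2).

Definition cball n (x : 'rV[R]_n) (r : R) : set 'rV[R]_n :=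
  [set y | l2norm (y - x) <= r].

Definition boundary n (D : set 'rV[R]_n) : set 'rV[R]_n := closure D `\` D°.

Definition rotation n (Q : 'M[R]_n) : Prop :=
  Q *m Q^T = 1%:M /\ \det Q = 1.

Definition base_rV n (y : 'rV[R]_n.+1) : 'rV[R]_n :=
  \row_i y ord0 (lift ord_max i).

Definition graph_on n (V : set 'rV[R]_n) (phi : 'rV[R]_n -> R) :
    set 'rV[R]_n.+1 :=
  [set y | V (base_rV y) /\ y ord0 ord_max = phi (base_rV y)].

(* The values of [phi] outside the open set [V] are irrelevant. *)
Definition C11_on n (V : set 'rV[R]_n) (phi : 'rV[R]_n -> R) : Prop :=
  (forall z, V z -> differentiable phi z) /\
  exists L : R, forall z z' h, V z -> V z' ->
    `|'d phi z h - 'd phi z' h| <= L * l2norm (z - z') * l2norm h.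

(* The ambient space is R^(d+1), so that [d] is the dimension of the domain of
   the graph functions. For d = 0, the line, the condition is by convention
   that [A] is a finite union of intervals. *)
Definition C11_boundary d (A : set 'rV[R]_d.+1) : Prop :=
  if d == 0%N then
    exists s : seq (interval R),
      A = [set x | exists2 I, I \in s & x ord0 ord0 \in I]
  else
    forall x, boundary A x ->
      exists (U : set 'rV[R]_d.+1) (Q : 'M[R]_d.+1)
             (V : set 'rV[R]_d) (phi : 'rV[R]_d -> R),
        [/\ nbhs x U, rotation Q, open V, C11_on V phi &
            (fun y => y *m Q) @` (boundary A `&` U) = graph_on V phi].

End geometry.

Section random_vectors.
Context disp (T : measurableType disp) (R : realType) (P : probability T R).
Context (d : nat).

Definition mutually_independent (X : nat -> {RV P >-> borel_rV R d}) : Prop :=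
  forall (J : {fset nat}) (B : nat -> set (borel_rV R d)),
    (forall j, measurable (B j)) ->
    P (\bigcap_(j in [set` J]) (X j @^-1` B j)) =
    (\prod_(j <- J) P (X j @^-1` B j))%E.

Definition has_density (X : {RV P >-> borel_rV R d}) (f : 'rV[R]_d -> R) : Prop :=
  [/\ measurable_fun [set: borel_rV R d] f, forall x, 0 <= f x &
      forall B : set (borel_rV R d), measurable B ->
        distribution P X B = (\int[lebesgue_measure_rV d]_(x in B) (f x)%:E)%E].

End random_vectors.

(* The sequence is indexed from 0: the n-th sample is {x 0, ..., x n.-1}. *)
Section records.
Context {R : realType} (d : nat) (A : set 'rV[R]_d) (x : nat -> 'rV[R]_d).
Context (k : nat).

(* The sample is a set: repeated points are counted once. *)
Definition npoints (n : nat) (D : set 'rV[R]_d) : nat :=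
  size [seq y <- undup (mkseq x n) | y \in D].

Definition inner_set (r : R) : set 'rV[R]_d :=
  [set y | A y /\ cball y r `<=` A].

(* For bounded [A] and [0 < d] the set is nonempty, because [inner_set r] is
   empty for large [r]; so [inf] is a true infimum. *)
Definition spacing_radius (n : nat) : R :=
  inf [set r | 0 < r /\
    forall y, inner_set r y -> (k <= npoints n (cball y r))%N].

Definition is_record (n : nat) : bool :=
  spacing_radius n < spacing_radius n.-1.

Definition num_records (n : nat) : nat :=
  (1 + \sum_(k.+1 <= i < n.+1) is_record i)%N.

(* [record_time m] is the time of the m-th record for [1 <= m], with value +oo
   if there is no such record; [record_time 0] is a dummy value. *)
Fixpoint record_time (m : nat) : \bar R :=
  match m with
  | 0 => 0%E
  | m'.+1 =>
      if m' == 0%N then k%:R%:E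
      else ereal_inf [set n%:R%:E | n in
             [set n : nat | (record_time m' < n%:R%:E)%E /\ is_record n]]
  end.

End records.

(* Main.v *)
(* Write R_n for the spacing radius and p_n for the conditional probability, given
   the first n points, that the next point is a record. A hole is a centre c with
   B(c, R_n) in A whose open ball holds fewer than k points; a new point can lower
   the radius only if it falls into the open ball of every hole. Almost surely no
   two holes tie away from the boundary of A, and then the hole is unique and its
   open ball holds exactly k - 1 points, so that every point of that ball produces
   a record and p_n is the mass of the ball.

   Covering A, the part of A where f is not nearly minimal, and the points whose
   distance to the boundary is comparable with r, by O(r^-(d+1)), O(r^-(d+1)) and
   O(r^-d) balls (only the last count uses the shape of A) shows that along
   n = 1, 2^q, 3^q, ... there are almost surely no holes that are too large, lie
   where f is large or lie next to the boundary; a second moment argument near a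
   minimum of f shows that R_n is not too small either. With f0 = inf f and V the
   volume of the unit ball this gives n f0 V R_n^(d+1) ~ ln n, so p_n ~ ln n / n,
   almost surely and in mean.

   Summation gives E N_n ~ (ln n)^2 / 2. The difference between N_n and the sum of
   the p_l is a martingale with variance at most the sum of the E p_l, which is
   negligible along n = 2^j, and monotonicity of N_n fills the gaps. Inverting
   N at the record times yields the last claim. *)
Require Import Defs.
From HB Require Import structures.
From mathcomp Require Import all_boot all_order all_algebra finmap.
From mathcomp Require Import all_classical all_reals all_analysis.
From mathcomp Require Import measurable_realfun ring lra.
Import Order.TTheory GRing.Theory Num.Theory numFieldNormedType.Exports.
Set Implicit Arguments.
Unset Strict Implicit.
Unset Printing Implicit Defensive.
Local Open Scope classical_set_scope.
Local Open Scope ring_scope.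

(** * Euclidean norm *)

(** What shapes the proof is the constraint that balls stay inside [A]. A largest hole touching the
    boundary cannot be moved freely, so the sample points on its sphere need not determine it and
    ties cannot be ruled out; holes next to the boundary must be excluded first. There a ball inside
    [A] still has mass at least [f0 V r^(d+1)], so at volume [(1 - 2e) ln n / n] it is sparse with
    probability about [n^-(1-2e)], whereas the boundary layer needs only about [n^(d/(d+1))] balls:
    for small [e] the product tends to 0. A hole with room around it is the smallest ball enclosing
    the points on its sphere, so a tie equates two smallest enclosing radii. Dilating one point
    about another makes one radius grow and leaves the other fixed; the tying positions thus form a
    set disjoint from its dilates, which is null. The tail bounds are small negative powers of [n],
    not summable over all [n]; along [j^q] with [q] large they are, and consecutive ratios still
    tend to 1, so that monotonicity of the radius costs only a factor close to 1. For [N_n] the much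
    sparser [2^j] will do, because [(ln n)^2] varies slowly. *)

Section euclidean.
Context {R : realType} {n : nat}.
Implicit Types (u v w x y z : 'rV[R]_n) (a r : R).

Definition dot u v : R := \sum_i u ord0 i * v ord0 i.

Lemma dotC u v : dot u v = dot v u.
Proof. by apply: eq_bigr => i _; rewrite mulrC. Qed.

Lemma dotDl u v w : dot (u + v) w = dot u w + dot v w.
Proof. by rewrite -big_split/=; apply: eq_bigr => i _; rewrite mxE mulrDl. Qed.

Lemma dotZl a u v : dot (a *: u) v = a * dot u v.
Proof. by rewrite mulr_sumr; apply: eq_bigr => i _; rewrite mxE mulrA. Qed.

Lemma dotNl u v : dot (- u) v = - dot u v.
Proof. by rewrite -scaleN1r dotZl mulN1r. Qed.

Lemma dotDr u v w : dot w (u + v) = dot w u + dot w v.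
Proof. by rewrite dotC dotDl !(dotC w). Qed.

Lemma dotZr a u v : dot v (a *: u) = a * dot v u.
Proof. by rewrite dotC dotZl dotC. Qed.

Lemma dotNr u v : dot v (- u) = - dot v u.
Proof. by rewrite dotC dotNl dotC. Qed.

Definition dotE := (dotDl, dotDr, dotNl, dotNr, dotZl, dotZr).

Lemma dotxx_ge0 u : 0 <= dot u u.
Proof. by apply: sumr_ge0 => i _; rewrite -expr2 sqr_ge0. Qed.

Lemma l2norm_ge0 u : 0 <= l2norm u.
Proof. exact: sqrtr_ge0. Qed.

Lemma sqr_l2norm u : l2norm u ^+ 2 = dot u u.
Proof.
rewrite /l2norm sqr_sqrtr; last by apply: sumr_ge0 => i _; rewrite sqr_ge0.
by apply: eq_bigr => i _; rewrite expr2.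
Qed.

Lemma l2norm_sqrt u : l2norm u = Num.sqrt (dot u u).
Proof. by rewrite -sqr_l2norm sqrtr_sqr ger0_norm// l2norm_ge0. Qed.

Lemma l2norm_le_sqr u r : 0 <= r -> (l2norm u <= r) = (dot u u <= r ^+ 2).
Proof.
by move=> r0; rewrite -sqr_l2norm ler_pXn2r// nnegrE// l2norm_ge0.
Qed.

Lemma l2norm_lt_sqr u r : 0 <= r -> (l2norm u < r) = (dot u u < r ^+ 2).
Proof.
by move=> r0; rewrite -sqr_l2norm ltr_pXn2r// nnegrE// l2norm_ge0.
Qed.

Lemma coord_le_l2norm u i : `|u ord0 i| <= l2norm u.
Proof.
rewrite -ler_sqr ?nnegrE// ?l2norm_ge0// sqr_l2norm real_normK ?num_real//.
rewrite /dot (bigD1 i)//= -expr2 lerDl.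
by apply: sumr_ge0 => j _; rewrite -expr2 sqr_ge0.
Qed.

Lemma l2norm_eq0 u : l2norm u = 0 -> u = 0.
Proof.
move=> u0; apply/rowP => i; rewrite mxE; apply/eqP.
by rewrite -normr_le0 -u0 coord_le_l2norm.
Qed.

Lemma l2norm0 : l2norm (0 : 'rV[R]_n) = 0.
Proof.
by rewrite l2norm_sqrt /dot big1 ?sqrtr0// => i _; rewrite mxE mul0r.
Qed.

Lemma l2normZ a u : l2norm (a *: u) = `|a| * l2norm u.
Proof.
by rewrite !l2norm_sqrt !dotE mulrA -expr2 sqrtrM ?sqr_ge0// sqrtr_sqr.
Qed.

Lemma l2normN u : l2norm (- u) = l2norm u.
Proof. by rewrite -scaleN1r l2normZ normrN1 mul1r. Qed.

Lemma l2normC u v : l2norm (u - v) = l2norm (v - u).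
Proof. by rewrite -l2normN opprB. Qed.

Lemma dot_le_l2norm u v : dot u v <= l2norm u * l2norm v.
Proof.
have [/l2norm_eq0 ->|u0] := eqVneq (l2norm u) 0.
  by rewrite l2norm0 mul0r /dot big1// => i _; rewrite mxE mul0r.
have [/l2norm_eq0 ->|v0] := eqVneq (l2norm v) 0.
  by rewrite l2norm0 mulr0 /dot big1// => i _; rewrite mxE mulr0.
have up : 0 < l2norm u by rewrite lt_def u0 l2norm_ge0.
have vp : 0 < l2norm v by rewrite lt_def v0 l2norm_ge0.
have := dotxx_ge0 (l2norm v *: u - l2norm u *: v).
rewrite !dotE -!sqr_l2norm (dotC v u) => H.
have {}H : 0 <= 2 * (l2norm u * l2norm v) * (l2norm u * l2norm v - dot u v).
  by apply: le_trans H _; rewrite le_eqVlt; apply/orP; left; apply/eqP; ring.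
by rewrite -subr_ge0; move: H; rewrite pmulr_rge0// !mulr_gt0.
Qed.

Lemma ler_l2normD u v : l2norm (u + v) <= l2norm u + l2norm v.
Proof.
rewrite l2norm_le_sqr ?addr_ge0 ?l2norm_ge0// !dotE (dotC v u) sqrrD.
rewrite !sqr_l2norm; have := dot_le_l2norm u v; lra.
Qed.

Lemma l2norm_triangle x y z : l2norm (x - z) <= l2norm (x - y) + l2norm (y - z).
Proof. by rewrite -[x - z](subrKA y); exact: ler_l2normD. Qed.

Lemma l2norm_le_sum u : l2norm u <= \sum_i `|u ord0 i|.
Proof.
rewrite l2norm_le_sqr ?sumr_ge0// expr2 mulr_suml; apply: ler_sum => i _.
rewrite -expr2 -real_normK ?num_real// expr2 ler_wpM2l//.
by rewrite (bigD1 i)//= lerDl sumr_ge0.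
Qed.

Lemma coord_le_mxnorm u i : `|u ord0 i| <= `|u|.
Proof.
rewrite /Num.norm/= mx_normrE; exact: (le_bigmax _ _ (ord0, i)).
Qed.

Lemma mxnorm_le_l2norm u : `|u| <= l2norm u.
Proof.
rewrite /Num.norm/= mx_normrE; apply/bigmax_leP; split; first exact: l2norm_ge0.
by move=> [i j] _ /=; rewrite (ord1 i) coord_le_l2norm.
Qed.

Lemma l2norm_le_mxnorm u : l2norm u <= n%:R * `|u|.
Proof.
apply: le_trans (l2norm_le_sum u) _; rewrite mulr_natl.
have -> : `|u| *+ n = \sum_(i < n) `|u| by rewrite sumr_const card_ord.
apply: ler_sum => i _.
exact: coord_le_mxnorm.
Qed.

Definition oball x r : set 'rV[R]_n := [set y | l2norm (y - x) < r].

Lemma oball_cball x r : oball x r `<=` cball x r.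
Proof. by move=> y /ltW. Qed.

Lemma le_cball x r s : r <= s -> cball x r `<=` cball x s.
Proof. by move=> rs y /le_trans; exact. Qed.

Lemma cball_oball x r s : r < s -> cball x r `<=` oball x s.
Proof. by move=> rs y /le_lt_trans; exact. Qed.

Lemma cball_sub x y r s : l2norm (y - x) + r <= s -> cball y r `<=` cball x s.
Proof.
move=> h z yz; apply: le_trans (l2norm_triangle z y x) _.
by apply: le_trans h; rewrite addrC lerD2l.
Qed.

Lemma cball_sub_oball x y r s : l2norm (y - x) + r < s -> cball y r `<=` oball x s.
Proof.
move=> h z yz; apply: le_lt_trans (l2norm_triangle z y x) _.
by apply: le_lt_trans h; rewrite addrC lerD2l.
Qed.

Lemma ball_sub_cball x r : ball x r `<=` cball x (n%:R * r).
Proof.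
move=> y; rewrite -ball_normE /ball_/= => xy; rewrite /cball/= l2normC.
by apply: le_trans (l2norm_le_mxnorm _) _; rewrite ler_wpM2l// ltW.
Qed.

Lemma oball_sub_ball x r : oball x r `<=` ball x r.
Proof.
move=> y; rewrite -ball_normE /ball_/= /oball/= l2normC.
exact/le_lt_trans/mxnorm_le_l2norm.
Qed.

Lemma nbhs_oball x r : 0 < r -> nbhs x (oball x r).
Proof.
move=> r0; apply/nbhs_ballP; exists (r / (2 * n.+1%:R)) => /=.
  by rewrite divr_gt0// mulr_gt0.
move=> y /ball_sub_cball; rewrite /cball/oball/= => /le_lt_trans; apply.
rewrite invfM !mulrA ltr_pdivrMr// mulrC mulrA.
have : (n%:R : R) < n.+1%:R by rewrite ltr_nat.
have := ler0n R n; nra.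
Qed.

Lemma nbhs_cballP x (U : set 'rV[R]_n) :
  nbhs x U <-> exists2 r, 0 < r & cball x r `<=` U.
Proof.
split=> [/nbhs_ballP[e /= e0 eU]|[r r0 rU]].
  exists (e / 2); first by rewrite divr_gt0.
  apply: subset_trans eU; apply: subset_trans (@oball_sub_ball x e).
  by apply: cball_oball; rewrite ltr_pdivrMr// mulr_natr mulr2n ltrDl.
apply: filterS rU _; apply: filterS (@oball_cball x r) _; exact: nbhs_oball.
Qed.

Lemma open_oball x r : open (oball x r).
Proof.
rewrite openE => y xy; apply/nbhs_cballP; exists ((r - l2norm (y - x)) / 2).
  by rewrite divr_gt0// subr_gt0.
apply: cball_sub_oball; move: xy; rewrite /oball/=; lra.
Qed.

Lemma closed_cball x r : closed (cball x r).
Proof.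
rewrite -[cball x r]setCK; apply: open_closedC; rewrite openE => y /negP.
rewrite -ltNge => xy; apply/nbhs_cballP; exists ((l2norm (y - x) - r) / 2).
  by rewrite divr_gt0// subr_gt0.
move=> z zy; apply/negP; rewrite -ltNge.
have := l2norm_triangle y z x; rewrite (l2normC y z).
move: zy; rewrite /cball/=; move: xy; set a := l2norm _; set b := l2norm _.
set c := l2norm _; lra.
Qed.

Lemma compact_cball x r : compact (cball x r).
Proof.
apply: bounded_closed_compact (@closed_cball x r).
exists (r + `|x|); split; first exact: num_real.
move=> M rM y xy; apply: le_trans (ltW rM).
have -> : y = (y - x) + x by rewrite subrK.
apply: le_trans (ler_normD _ _) _; rewrite lerD2r.
by apply: le_trans xy; exact: mxnorm_le_l2norm.
Qed.

Lemma l2norm_segment x y z a : 0 <= a -> a <= 1 ->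
  l2norm (x + a *: (y - x) - z) <= (1 - a) * l2norm (x - z) + a * l2norm (y - z).
Proof.
move=> a0 a1; have -> : x + a *: (y - x) - z = (1 - a) *: (x - z) + a *: (y - z).
  by apply/rowP => i; rewrite !mxE; ring.
apply: le_trans (ler_l2normD _ _) _.
by rewrite !l2normZ !ger0_norm ?subr_ge0.
Qed.

Lemma l2norm_segment_lt x y z a r : 0 < a -> a < 1 -> x != y ->
  l2norm (x - z) <= r -> l2norm (y - z) <= r ->
  l2norm (x + a *: (y - x) - z) < r.
Proof.
move=> a0 a1 xy xz yz; have r0 := le_trans (l2norm_ge0 _) xz.
move: xz yz; rewrite l2norm_lt_sqr// !l2norm_le_sqr//.
have -> : x + a *: (y - x) - z = (1 - a) *: (x - z) + a *: (y - z).
  by apply/rowP => i; rewrite !mxE; ring.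
move=> xz yz.
have xy0 : 0 < dot (x - y) (x - y).
  rewrite -sqr_l2norm exprn_gt0// lt_def l2norm_ge0 andbT.
  by apply: contra xy => /eqP/l2norm_eq0/eqP; rewrite subr_eq0.
have e : x - y = (x - z) - (y - z) by rewrite opprB addrA subrK.
move: xz yz xy0; rewrite e; move: (x - z) (y - z) => u v.
rewrite !dotE (dotC v u) => uu vv uv.
(* [|(1 - a) u + a v|^2 = (1 - a) |u|^2 + a |v|^2 - a (1 - a) |u - v|^2], and the last term is
   nonzero. *)
have : 0 < a * (1 - a) by rewrite mulr_gt0// subr_gt0.
nra.
Qed.

End euclidean.

(** * Lebesgue measure of balls *)

Section lebesgue_rV.
Context {R : realType}.
Local Notation leb := (@lebesgue_measure_rV R).

Lemma measurable_open_rV n (U : set 'rV[R]_n) :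
  open U -> measurable (U : set (borel_rV R n)).
Proof. exact: sub_sigma_algebra. Qed.

Lemma measurable_closed_rV n (U : set 'rV[R]_n) :
  closed U -> measurable (U : set (borel_rV R n)).
Proof.
by move=> /closed_openC/measurable_open_rV/measurableC; rewrite setCK.
Qed.

Lemma continuous_measurable_rV n m (f : 'rV[R]_n -> 'rV[R]_m) :
  continuous f -> measurable_fun setT (f : borel_rV R n -> borel_rV R m).
Proof.
move=> cf; apply: (@measurability _ _ _ (borel_rV R m) _ _ open) => // _ [U oU <-].
by rewrite setTI; apply: measurable_open_rV; apply: open_comp => // x _; exact: cf.
Qed.

Lemma lipschitz_continuous_rV n m (f : 'rV[R]_n -> 'rV[R]_m) (K : R) :
  (forall x y, l2norm (f x - f y) <= K * l2norm (x - y)) -> continuous f.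
Proof.
move=> fK x U /nbhs_cballP[e e0 eU]; apply/nbhs_cballP.
have K1 : 0 < `|K| + 1 by rewrite ltr_wpDl.
exists (e / (`|K| + 1)); first by rewrite divr_gt0.
move=> y; rewrite /cball/= ler_pdivlMr// => xy; apply: eU; rewrite /cball/=.
apply: le_trans (fK _ _) _; apply: le_trans xy; rewrite mulrC ler_wpM2l ?l2norm_ge0//.
by rewrite (le_trans (ler_norm _))// lerDl.
Qed.

Definition affmap n (a : R) (b v : 'rV[R]_n) : 'rV[R]_n := a *: v + b.

Lemma affmap_continuous n (a : R) (b : 'rV[R]_n) : continuous (affmap a b).
Proof.
apply: (@lipschitz_continuous_rV _ _ _ `|a|) => x y.
by rewrite /affmap opprD addrACA subrr addr0 -scalerBr l2normZ.
Qed.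

Lemma measurable_affmap n (a : R) (b : 'rV[R]_n) :
  measurable_fun setT (affmap a b : borel_rV R n -> borel_rV R n).
Proof. by apply: continuous_measurable_rV; exact: affmap_continuous. Qed.

Section pushm.
Context d d' (T1 : measurableType d) (T2 : measurableType d')
  (m : {measure set T1 -> \bar R}) (f : T1 -> T2) (mf : measurable_fun setT f).

(** The measurability proof is an argument so that the measure structure attaches to the term
    [pushm mf]; uniqueness theorems for measures then apply to image measures. *)
Definition pushm of measurable_fun setT f : set T2 -> \bar R := pushforward m f.

Let pushm0 : pushm mf set0 = 0%E.
Proof. by rewrite /pushm /pushforward preimage_set0 measure0. Qed.

Let pushm_ge0 A : (0 <= pushm mf A)%E.
Proof. exact: (measure_ge0 m). Qed.

Let pushm_sigma_additive : semi_sigma_additive (pushm mf).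
Proof.
move=> F mF tF mUF; rewrite /pushm /pushforward preimage_bigcup.
apply: measure_semi_sigma_additive.
- by move=> n; rewrite -[X in measurable X]setTI; exact: mf.
- apply/trivIsetP => /= i j _ _ ij; rewrite -preimage_setI.
  by move/trivIsetP : tF => /(_ _ _ _ _ ij) ->//; rewrite preimage_set0.
- by rewrite -preimage_bigcup -[X in measurable X]setTI; exact: mf.
Qed.

HB.instance Definition _ := isMeasure.Build _ _ _
  (pushm mf) pushm0 pushm_ge0 pushm_sigma_additive.

End pushm.

Lemma lebesgue_measure_affine (a b : R) (B : set (measurableTypeR R)) : 0 < a ->
  measurable B ->
  lebesgue_measure ((fun x => a * x + b) @^-1` B) =
  (a^-1%:E * lebesgue_measure B)%E.
Proof.
move=> a0 mB.
have mf : measurable_fun (setT : set (measurableTypeR R))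
    (fun x => a * x + b : measurableTypeR R).
  by apply: measurable_funD => //; exact: measurable_funM.
have a0' : 0 <= a := ltW a0.
pose m' := mscale (NngNum a0') (pushm (@lebesgue_measure R) mf).
have mE (X : set R) : m' X =
    (a%:E * lebesgue_measure ((fun x => a * x + b)%R @^-1` X))%E by [].
have -> : lebesgue_measure B = m' B.
  apply: lebesgue_measure_unique => // X [[x y]/= _ <-].
  rewrite -[RHS]/(a%:E * lebesgue_measure ((fun t => a * t + b)%R @^-1` _))%E.
  have -> : (fun t => a * t + b) @^-1` `]x, y] = `](x - b) / a, (y - b) / a]%classic.
    apply/seteqP; split=> t /=; rewrite !in_itv/= ltr_pdivrMr// ler_pdivlMr// => /andP[]; lra.
  rewrite !lebesgue_measure_itv/= !lte_fin ltr_pM2r ?invr_gt0// ltrD2r.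
  case: ifPn => _; last by rewrite mule0.
  by rewrite -!EFinB -EFinM; congr EFin; field; rewrite gt_eqF.
by rewrite mE muleA -EFinM mulVf ?gt_eqF// mul1e.
Qed.

Lemma rV0_all (u v : 'rV[R]_0) : u = v.
Proof. by apply/rowP => -[]. Qed.

Lemma affmapE n a (b v : 'rV[R]_n) i : affmap a b v ord0 i = a * v ord0 i + b ord0 i.
Proof. by rewrite !mxE. Qed.

Lemma affmap_cons n (a : R) (b : 'rV[R]_n.+1) (x : R) (v : 'rV[R]_n) :
  affmap a b (cons_rV (x, v)) =
  cons_rV (a * x + b ord0 ord0, affmap a (\row_i b ord0 (lift ord0 i)) v).
Proof.
apply/rowP => i; rewrite affmapE.
by have [k ->|->] := unliftP ord0 i; rewrite ?cons_rV0 ?cons_rVS//= affmapE mxE.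
Qed.

(** By induction on the dimension: [affmap] acts separately on the head and the tail of [cons_rV],
    and a measure that agrees with the product measure on rectangles is equal to it. *)
Lemma lebesgue_measure_rV_affine n (a : R) (b : 'rV[R]_n) (B : set (borel_rV R n)) :
  0 < a -> measurable B ->
  leb n (affmap a b @^-1` B) = ((a^-1 ^+ n)%:E * leb n B)%E.
Proof.
move=> a0; elim: n b B => [|n IH] b B mB.
  rewrite expr0 mul1e; congr (leb 0 _); apply/seteqP.
  by split=> v /=; rewrite (rV0_all (affmap _ _ _) v).
have mpre : measurable (affmap a b @^-1` B : set (borel_rV R n.+1)).
  by rewrite -[X in measurable X]setTI; exact: measurable_affmap.
pose b' := \row_i b ord0 (lift ord0 i).
pose g (p : measurableTypeR R * borel_rV R n) :=
  (a * p.1 + b ord0 ord0 : measurableTypeR R, affmap a b' p.2 : borel_rV R n).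
have mg1 : measurable_fun (setT : set (measurableTypeR R))
    (fun t => a * t + b ord0 ord0 : measurableTypeR R).
  by apply: measurable_funD => //; exact: measurable_funM.
have mg : measurable_fun setT g.
  apply/measurable_fun_pairP; split.
    apply: (measurableT_comp mg1); exact: measurable_fst.
  apply: (measurableT_comp (@measurable_affmap n a b')).
  exact: measurable_snd.
have an0 : 0 <= a ^+ n.+1 by rewrite exprn_ge0// ltW.
pose m' := mscale (NngNum an0) (pushm (@lebesgue_measure R \x leb n)%E mg).
have mE X : m' X = ((a ^+ n.+1)%:E * (@lebesgue_measure R \x leb n)%E (g @^-1` X))%E by [].
have H X : measurable X -> (@lebesgue_measure R \x leb n)%E X = m' X.
  apply: product_measure_unique => C D mC mD.
  rewrite -[LHS]/((a ^+ n.+1)%:E * (@lebesgue_measure R \x leb n)%E (g @^-1` (C `*` D)))%E.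
  rewrite (_ : _ @^-1` _ = ((fun x => a * x + b ord0 ord0) @^-1` C) `*`
      (affmap a b' @^-1` D))//.
  rewrite product_measure1E; last 2 first.
  - by rewrite -[X in measurable X]setTI; exact: mg1.
  - by rewrite -[X in measurable X]setTI; exact: measurable_affmap.
  rewrite IH//.
  rewrite [X in (_ * (X * _))%E](_ : _ = (a^-1%:E * lebesgue_measure C)%E); last first.
    exact: lebesgue_measure_affine.
  have E (l m : \bar R) : ((a ^+ n.+1)%:E * ((a^-1)%:E * l * ((a^-1 ^+ n)%:E * m)))%E = (l * m)%E.
    rewrite (muleACA (a^-1)%:E) -EFinM (muleA (a ^+ n.+1)%:E) -EFinM -exprS exprVn.
    by rewrite divff ?mul1e// expf_neq0// gt_eqF.
  exact: E.
rewrite -[LHS]/((@lebesgue_measure R \x leb n)%E (@cons_rV R n @^-1` (affmap a b @^-1` B))).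
rewrite -[in RHS]/((@lebesgue_measure R \x leb n)%E (@cons_rV R n @^-1` B)).
rewrite (_ : _ @^-1` _ = g @^-1` (@cons_rV R n @^-1` B)); last first.
  by apply/seteqP; split=> -[x v] /=; rewrite affmap_cons.
have mY : measurable ((@cons_rV R n : measurableTypeR R * borel_rV R n -> borel_rV R n.+1) @^-1` B).
  by rewrite -[X in measurable X]setTI; exact: measurable_cons_rV.
have E : leb n.+1 B = m' (@cons_rV R n @^-1` B) := H _ mY.
rewrite E mE muleA -EFinM exprVn mulVf ?mul1e// expf_neq0// gt_eqF//.
Qed.

(** These balls are cubes of side [2 * e]. Sandwiching the Euclidean unit ball between two of them
    shows that its volume is finite and positive. *)
Lemma lebesgue_measure_rV_ball n (v : 'rV[R]_n) (e : R) : 0 < e ->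
  leb n (ball v e) = ((2 * e) ^+ n)%:E.
Proof.
move=> e0; elim: n v => [|n IH] v.
  rewrite expr0 /= diracE mem_set//=.
  by rewrite (rV0_all 0 v); exact: ballxx.
rewrite -[LHS]/((@lebesgue_measure R \x leb n)%E (@cons_rV R n @^-1` (ball v e))).
rewrite (_ : _ @^-1` _ = (ball (v ord0 ord0) e `*`
   ball (\row_i v ord0 (lift ord0 i)) e)); last first.
  have rowS (p : R * 'rV[R]_n) : \row_i cons_rV p ord0 (lift ord0 i) = p.2.
    by apply/rowP => i; rewrite mxE cons_rVS.
  apply/seteqP; split=> p.
    by move=> /(ball_rVS _ _ e0); rewrite cons_rV0 rowS.
  by move=> ?; apply/(ball_rVS _ _ e0); rewrite cons_rV0 rowS.
rewrite product_measure1E; last 2 first.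
- by rewrite ball_itv; exact: measurable_itv.
- exact: measurable_ball_rV.
rewrite [X in (X * _)%E](_ : _ = (e *+ 2)%:E); last exact/lebesgue_measure_ball/ltW.
rewrite IH exprS EFinM; congr (_%:E * _)%E; by rewrite mulr_natl.
Qed.

Lemma measurable_cball n (x : 'rV[R]_n) r : measurable (cball x r : set (borel_rV R n)).
Proof. by apply: measurable_closed_rV; exact: closed_cball. Qed.

Lemma measurable_oball n (x : 'rV[R]_n) r : measurable (oball x r : set (borel_rV R n)).
Proof. by apply: measurable_open_rV; exact: open_oball. Qed.

Definition ballvol n : R := fine (leb n (cball 0 1)).

Lemma lebesgue_cball1_fin n : leb n (cball 0 1) \is a fin_num.
Proof.
rewrite ge0_fin_numE//; apply: (@le_lt_trans _ _ (leb n (ball 0 2))).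
  apply: le_measure; rewrite ?inE.
  - exact: measurable_cball.
  - exact: measurable_ball_rV.
  by apply: subset_trans (@oball_sub_ball _ _ _ _); apply: cball_oball; rewrite ltr1n.
by rewrite lebesgue_measure_rV_ball// ltry.
Qed.

Lemma ballvol_gt0 n : 0 < ballvol n.
Proof.
rewrite fine_gt0// -ge0_fin_numE// lebesgue_cball1_fin andbT.
have e0 : 0 < n.+1%:R^-1 :> R by rewrite invr_gt0.
apply: (@lt_le_trans _ _ (leb n (ball 0 n.+1%:R^-1))).
  by rewrite lebesgue_measure_rV_ball// lte_fin exprn_gt0// mulr_gt0.
apply: le_measure; rewrite ?inE.
- exact: measurable_ball_rV.
- exact: measurable_cball.
apply: subset_trans (@ball_sub_cball _ _ _ _) _; apply: le_cball.
by rewrite ler_pdivrMr// mul1r ler_nat.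
Qed.

Lemma lebesgue_measure_rV_cball n (x : 'rV[R]_n) (r : R) : 0 < r ->
  leb n (cball x r) = (ballvol n * r ^+ n)%:E.
Proof.
move=> r0; have r0' : 0 < r^-1 by rewrite invr_gt0.
rewrite (_ : cball x r = affmap r^-1 (- (r^-1 *: x)) @^-1` cball 0 1).
  rewrite lebesgue_measure_rV_affine ?invrK//; last exact: measurable_cball.
  by rewrite EFinM fineK ?lebesgue_cball1_fin// muleC.
apply/seteqP; split=> y; rewrite /cball/affmap/= subr0 -scalerBr l2normZ gtr0_norm//;
  by rewrite mulrC ler_pdivrMr// mul1r.
Qed.

Lemma lebesgue_measure_rV_oball_le n (x : 'rV[R]_n) (r : R) : 0 < r ->
  (leb n (oball x r) <= (ballvol n * r ^+ n)%:E)%E.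
Proof.
move=> r0; rewrite -(lebesgue_measure_rV_cball x r0); apply: le_measure; rewrite ?inE.
- exact: measurable_oball.
- exact: measurable_cball.
exact: oball_cball.
Qed.

Lemma lebesgue_measure_rV1 n (x : 'rV[R]_n.+1) : leb n.+1 [set x] = 0%E.
Proof.
apply/eqP; rewrite eq_le measure_ge0 andbT; apply/lee_addgt0Pr => e e0; rewrite add0e.
have v0 := ballvol_gt0 n.+1.
pose r := Num.min 1 (e / ballvol n.+1).
have r0 : 0 < r by rewrite lt_min ltr01 divr_gt0.
apply: (@le_trans _ _ (leb n.+1 (cball x r))).
  apply: le_measure; rewrite ?inE.
  - rewrite (_ : [set x] = cball x 0); first exact: measurable_cball.
    apply/seteqP; split=> y; rewrite /cball/=; first by move=> ->; rewrite subrr l2norm0.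
    move=> yx; apply/eqP; rewrite -subr_eq0; apply/eqP/l2norm_eq0.
    by apply/eqP; rewrite eq_le yx l2norm_ge0.
  - exact: measurable_cball.
  by move=> y ->; rewrite /cball/= subrr l2norm0 ltW.
rewrite lebesgue_measure_rV_cball// lee_fin mulrC -ler_pdivlMr//.
apply: (@le_trans _ _ r); last by rewrite ge_min lexx orbT.
rewrite exprS ler_piMr ?(ltW r0)// exprn_ile1 ?(ltW r0)//.
by rewrite ge_min lexx.
Qed.

End lebesgue_rV.

(** * Packing *)

Section packing.
Context {R : realType}.
Local Notation leb := (@lebesgue_measure_rV R).

Lemma sum_measure_le d (T : measurableType d) (m : {measure set T -> \bar R})
    (F : nat -> set T) (B : set T) (N : nat) :
  (forall i, measurable (F i)) -> trivIset setT F -> measurable B ->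
  (forall i, F i `<=` B) -> (\sum_(i < N) m (F i) <= m B)%E.
Proof.
move=> mF tF mB FB; rewrite -measure_bigsetU//.
apply: le_measure; rewrite ?inE//; first exact: bigsetU_measurable.
by rewrite -bigcup_mkord => x [i _ /FB].
Qed.

(** A separated family is kept as a list, so that its cardinality is its [size]: for [0 <= r] the
    strict inequality excludes repetitions. *)
Definition dispersed n (r : R) (s : seq 'rV[R]_n) : bool :=
  pairwise (fun x y => r < l2norm (x - y)) s.

Lemma dispersed_nth n r (s : seq 'rV[R]_n) i j :
  dispersed r s -> (i < size s)%N -> (j < size s)%N -> i != j ->
  r < l2norm (nth 0 s i - nth 0 s j).
Proof.
move=> /(pairwiseP 0) sP si sj; rewrite neq_ltn => /orP[ij|ji].
  exact: sP.
by rewrite l2normC; exact: sP.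
Qed.

Lemma packing_bound n (r v : R) (s : seq 'rV[R]_n) (B : set (borel_rV R n)) :
  0 < r -> dispersed (2 * r) s -> measurable B -> (leb n B <= v%:E)%E ->
  (forall x, x \in s -> cball x r `<=` B) ->
  (size s)%:R * (ballvol n * r ^+ n) <= v.
Proof.
move=> r0 ss mB Bv sB.
pose F i : set (borel_rV R n) := if (i < size s)%N then cball (nth 0 s i) r else set0.
have mF i : measurable (F i).
  by rewrite /F; case: ifPn => _; [exact: measurable_cball|exact: measurable0].
have := @sum_measure_le _ _ (leb n) F B (size s) mF _ mB.
rewrite (eq_bigr (fun=> (ballvol n * r ^+ n)%:E)); last first.
  by move=> i _; rewrite /F ltn_ord; exact: lebesgue_measure_rV_cball.
rewrite sumEFin sumr_const card_ord => H; rewrite mulr_natl.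
rewrite -lee_fin; apply: le_trans Bv; apply: H.
  apply/trivIsetP => i j _ _ ij; rewrite /F.
  case: ltnP => si; last by rewrite set0I.
  case: ltnP => sj; last by rewrite setI0.
  rewrite -subset0 => y [/= yi yj]; have := dispersed_nth ss si sj ij.
  apply/negP; rewrite -leNgt; apply: le_trans (l2norm_triangle _ y _) _.
  by rewrite mulr_natl mulr2n lerD// l2normC.
move=> i; rewrite /F; case: ltnP => si; last exact: sub0set.
by apply: sB; exact: mem_nth.
Qed.

Lemma packing_cball n (r rho : R) (x : 'rV[R]_n) (s : seq 'rV[R]_n) :
  0 < r -> 0 <= rho -> dispersed r s -> (forall y, y \in s -> cball x rho y) ->
  (size s)%:R <= ((2 * rho + r) / r) ^+ n.
Proof.
move=> r0 rho0 ss sx; have r20 : 0 < r / 2 by rewrite divr_gt0.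
have R0 : 0 < rho + r / 2 by rewrite ltr_wpDl.
have := @packing_bound n (r / 2) (ballvol n * (rho + r / 2) ^+ n) s
  (cball x (rho + r / 2)) r20 _ (measurable_cball _ _) _ _.
rewrite lebesgue_measure_rV_cball// lexx => H.
have {H} : (size s)%:R * (ballvol n * (r / 2) ^+ n) <= ballvol n * (rho + r / 2) ^+ n.
  apply: H => //; first by rewrite mulrC divfK ?pnatr_eq0.
  by move=> y /sx xy; apply: cball_sub; rewrite lerD2r.
rewrite mulrCA ler_pM2l ?ballvol_gt0// -ler_pdivlMr ?exprn_gt0// -expr_div_n.
rewrite (_ : (rho + r / 2) / (r / 2) = (2 * rho + r) / r)//.
by field; rewrite gt_eqF.
Qed.

(* A dispersed list of maximal length is a net. *)
Lemma maximal_dispersed n (r : R) (S : set 'rV[R]_n) (m : nat) : 0 <= r ->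
  (forall s, dispersed r s -> (forall x, x \in s -> S x) -> (size s <= m)%N) ->
  exists s, [/\ dispersed r s, forall x, x \in s -> S x &
    forall x, S x -> exists2 z, z \in s & l2norm (x - z) <= r].
Proof.
move=> r0 Sm.
pose Q k := `[< exists s, [/\ dispersed r s, forall x, x \in s -> S x & size s = k] >].
have Q0 : exists k, Q k by exists 0%N; apply/asboolP; exists [::]; split.
have Qm k : Q k -> (k <= m)%N by move=> /asboolP[s [ss sS <-]]; exact: Sm.
have [k /asboolP[s [ss sS sk]] kmax] := ex_maxnP Q0 Qm.
exists s; split => // x Sx; apply: contrapT => xs.
have /kmax : Q k.+1.
  apply/asboolP; exists (x :: s); split => /=; last by rewrite sk.
    rewrite /dispersed/= [X in _ && X]ss andbT; apply/allP => z zs /=.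
    by rewrite ltNge; apply/negP => xz; apply: xs; exists z.
  by move=> y; rewrite inE => /orP[/eqP ->|/sS].
by rewrite ltnn.
Qed.

(** The dilates of a bounded piece of [E] by the ratios [1 + 1/(m+1)] are pairwise disjoint, have at
    least the measure of the piece, and lie in one bounded ball. Infinitely many of them fit only if
    the measure is 0. *)
Lemma dilation_null n (E : set (borel_rV R n)) (q : 'rV[R]_n) :
  measurable E ->
  (forall p l, E p -> 1 < l -> ~ E (q + l *: (p - q))) -> leb n E = 0%E.
Proof.
move=> mE Edil.
have key N : leb n (E `&` cball q N%:R) = 0%E.
  set EN := E `&` _.
  have mEN : measurable EN by apply: measurableI => //; exact: measurable_cball.
  pose lam (m : nat) : R := 1 + m.+1%:R^-1.
  have lam1 m : 1 < lam m by rewrite ltrDl invr_gt0.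
  have lam0 m : 0 < lam m := lt_trans ltr01 (lam1 m).
  pose h m : 'rV[R]_n -> 'rV[R]_n := affmap (lam m)^-1 (q - (lam m)^-1 *: q).
  have hE m p : h m p = q + (lam m)^-1 *: (p - q).
    by apply/rowP => i; rewrite affmapE !mxE; ring.
  pose F m : set (borel_rV R n) := h m @^-1` EN.
  have mF m : measurable (F m).
    by rewrite -[X in measurable X]setTI; exact: measurable_affmap.
  have FE m : (leb n EN <= leb n (F m))%E.
    rewrite /F lebesgue_measure_rV_affine ?invr_gt0// invrK.
    by rewrite lee_pemull// lee_fin exprn_ege1// ltW.
  have tF : trivIset setT F.
    suff H i j : (i < j)%N -> F i `&` F j = set0.
      apply/trivIsetP => i j _ _; rewrite neq_ltn => /orP[/H//|/H].
      by rewrite setIC.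
    move=> ij; rewrite -subset0 => y [/= [Ei _] [Ej _]].
    apply: (Edil (h i y) (lam i / lam j) Ei).
      rewrite ltr_pdivlMr// mul1r /lam ltrD2l ltf_pV2 ?posrE// ltr_nat ltnS//.
    move: Ej; rewrite !hE [q + (lam i)^-1 *: _ - q]addrC addKr scalerA.
    by rewrite mulrAC divff ?gt_eqF// mul1r.
  have FB m : F m `<=` cball q (2 * N%:R).
    move=> y [_]; rewrite hE /cball/= addrC addKr l2normZ gtr0_norm ?invr_gt0//.
    rewrite mulrC ler_pdivrMr// => H; apply: le_trans H _.
    rewrite mulrC ler_wpM2r// /lam; have : (m.+1%:R^-1 : R) <= 1 by rewrite invf_le1// ler1n.
    by move: (m.+1%:R^-1) => t; lra.
  (* For [N = 0] the piece could only be the centre [q], which is its own dilate and so is not in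
     [E]. *)
  have [N0|N0] := eqVneq N 0%N.
    rewrite (_ : EN = set0) ?measure0// -subset0 => y [Ey].
    rewrite /cball/= N0 => yq.
    have {}yq : y = q.
      by apply/eqP; rewrite -subr_eq0; apply/eqP/l2norm_eq0/eqP; rewrite eq_le yq l2norm_ge0.
    have := Edil y 2 Ey; rewrite yq subrr scaler0 addr0 -yq => H.
    by apply: H => //; rewrite ltr1n.
  have N20 : 0 < 2 * N%:R :> R by rewrite mulr_gt0// ltr0n lt0n.
  have fB : (leb n (cball q (2 * N%:R)) < +oo)%E by rewrite lebesgue_measure_rV_cball// ltry.
  have bnd K : (K%:R%:E * leb n EN <= leb n (cball q (2 * N%:R)))%E.
    apply: le_trans (@sum_measure_le _ _ (leb n) F _ K mF tF (measurable_cball _ _) FB).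
    have -> : (K%:R%:E * leb n EN)%E = \sum_(i < K) leb n EN by rewrite mule_natl sumr_const card_ord.
    by apply: lee_sum => i _; exact: FE.
  have vfin : leb n (cball q (2 * N%:R)) \is a fin_num by rewrite ge0_fin_numE.
  have ENfin : leb n EN \is a fin_num.
    rewrite ge0_fin_numE//; apply: le_lt_trans fB.
    by apply: le_trans (bnd 1%N); rewrite mul1e.
  apply/eqP; rewrite eq_le measure_ge0 andbT leNgt; apply/negP => EN0.
  have e0 : 0 < fine (leb n EN) by rewrite -lte_fin fineK.
  set v := fine (leb n (cball q (2 * N%:R))).
  have := bnd (Num.trunc (v / fine (leb n EN))).+1.
  rewrite -(fineK ENfin) -(fineK vfin) -EFinM lee_fin leNgt => /negP; apply.
  by rewrite -ltr_pdivrMr// truncnS_gt.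
rewrite (_ : E = \bigcup_N (E `&` cball q N%:R)).
  apply/eqP; rewrite eq_le measure_ge0 andbT.
  apply: le_trans (measure_sigma_subadditive _ _ _ (@subset_refl _ _)) _ => //.
  - by move=> N; apply: measurableI => //; exact: measurable_cball.
  - by apply: bigcup_measurable => N _; apply: measurableI => //; exact: measurable_cball.
  by rewrite eseries0// => N _ _; exact: key.
apply/seteqP; split=> [y Ey|y [N _ []//]].
exists (Num.trunc (l2norm (y - q))).+1 => //; split => //.
by rewrite /cball/= ltW// truncnS_gt.
Qed.

End packing.

(** * Cluster points in the Euclidean norm, and gaps above a threshold *)

Section compactness.
Context {R : realType} {n : nat}.

Lemma compact_subseq (K : set 'rV[R]_n) (u : nat -> 'rV[R]_n) :
  compact K -> (forall m, K (u m)) ->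
  exists2 y, K y & forall e N, 0 < e -> exists2 m, (N <= m)%N & l2norm (u m - y) <= e.
Proof.
move=> Kc Ku; have [|y [Ky cy]] := Kc (u @ \oo) _; first by exists 0%N => // m _ /=; exact: Ku.
exists y => // e N e0.
have : nbhs y (cball y e) by apply/nbhs_cballP; exists e.
have : (u @ \oo) [set u m | m in [set m | (N <= m)%N]].
  by exists N => // m /= Nm; exists m.
by move=> /cy H /H[_ [[m Nm <-] ym]]; exists m.
Qed.

(** Applied to the distances of a finite sample from a centre: the points outside a sphere, or
    inside it, stay clear of it by a uniform margin. *)
Lemma finite_gap (g : nat -> R) (N : nat) (a : R) :
  exists2 e, 0 < e & forall i, (i < N)%N -> a < g i -> a + e < g i.
Proof.
elim: N => [|N [e e0 eN]]; first by exists 1.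
have [gN|gN] := leP (g N) a.
  exists e => // i; rewrite ltnS leq_eqVlt => /orP[/eqP ->|/eN//].
  by rewrite ltNge gN.
exists (Num.min e ((g N - a) / 2)); first by rewrite lt_min e0 divr_gt0// subr_gt0.
have h1 : Num.min e ((g N - a) / 2) <= e by rewrite ge_min lexx.
have h2 : Num.min e ((g N - a) / 2) <= (g N - a) / 2 by rewrite ge_min lexx orbT.
move=> i; rewrite ltnS leq_eqVlt => /orP[/eqP ->|/eN H /H]; first lra.
by apply: le_lt_trans; rewrite lerD2l.
Qed.

End compactness.

(** * Spacing radius and holes *)

Section npoints.
Context {R : realType} {d : nat}.
Implicit Types (x : nat -> 'rV[R]_d) (D : set 'rV[R]_d).

Lemma npointsS x n D : npoints x n.+1 D =
  (npoints x n D + ((x n \notin mkseq x n) && (x n \in D)))%N.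
Proof.
rewrite /npoints mkseqS undup_rcons filter_rcons.
case: (boolP (x n \in mkseq x n)) => xn /=.
  (* Appending a repeated point only moves its copy to the end of the list, so the count is
     unchanged up to permutation. *)
  have /perm_to_rem : x n \in undup (mkseq x n) by rewrite mem_undup.
  rewrite rem_filter ?undup_uniq// => /(perm_filter (fun y => y \in D))/perm_size /= ->.
  by rewrite addn0; case: ifPn => _; rewrite ?size_rcons.
have -> : [seq y <- undup (mkseq x n) | y != x n] = undup (mkseq x n).
  by apply/all_filterP/allP => y; rewrite mem_undup; apply: contraTneq => ->.
by case: ifPn => _; rewrite ?size_rcons ?addn1 ?addn0.
Qed.

Lemma le_npoints x n D E : D `<=` E -> (npoints x n D <= npoints x n E)%N.
Proof.
move=> DE; elim: n => [//|n IH]; rewrite !npointsS leq_add//.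
case: (_ \notin _) => //=; case: (boolP (x n \in D)) => // /[!inE] /DE xE.
by rewrite mem_set.
Qed.

Lemma npoints_homo x m n D : (m <= n)%N -> (npoints x m D <= npoints x n D)%N.
Proof.
elim: n => [|n IH]; first by rewrite leqn0 => /eqP ->.
rewrite leq_eqVlt ltnS => /orP[/eqP -> //|/IH H]; rewrite npointsS.
by apply: leq_trans H _; rewrite leq_addr.
Qed.

Lemma eq_npoints x x' n D : (forall i, (i < n)%N -> x i = x' i) ->
  npoints x n D = npoints x' n D.
Proof.
move=> xx; rewrite /npoints (_ : mkseq x n = mkseq x' n)//.
by apply/eq_in_map => i; rewrite mem_iota add0n => /xx.
Qed.

Lemma le_npoints_in x n D E : (forall i, (i < n)%N -> D (x i) -> E (x i)) ->
  (npoints x n D <= npoints x n E)%N.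
Proof.
elim: n => [//|n IH] DE; rewrite !npointsS leq_add//.
  by apply: IH => i /ltnW; exact: DE.
case: (_ \notin _) => //=; case: (boolP (x n \in D)) => // /[!inE] /DE xE.
by rewrite mem_set//; apply: xE.
Qed.

Lemma npointsU1 x n D y : (npoints x n (D `|` [set y]) <= (npoints x n D).+1)%N.
Proof.
suff : (npoints x n (D `|` [set y]) <= npoints x n D + (y \in mkseq x n))%N.
  move=> /leq_trans; apply; apply: leq_trans (leq_add (leqnn _) (leq_b1 _)) _.
  by rewrite addn1.
elim: n => [//|n IH]; rewrite !npointsS mkseqS mem_rcons inE.
have [yE|yxn] := eqVneq y (x n); last first.
  rewrite /= addnAC leq_add//; case: (_ \notin _) => //=.
  case: (boolP (x n \in _)) => // /[!inE] -[xD|/= yx]; first by rewrite mem_set.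
  by rewrite yx eqxx in yxn.
rewrite {}yE in IH *; rewrite /=; case: (boolP (x n \in mkseq x n)) => /= xn.
  by rewrite !addn0 (leq_trans IH)// leq_add2l leq_b1.
apply: leq_add; last exact: leq_b1.
apply: (@leq_trans (npoints x n D)); last exact: leq_addr.
apply: le_npoints_in => i ni [//|/= xi]; exfalso; move/negP: xn; apply.
by apply/mapP; exists i; rewrite ?mem_iota.
Qed.

(** Isolates the dependence on one point: the sample of size [n] is untouched, and [y] stands for
    the point to come. *)
Definition upd x n (y : 'rV[R]_d) : nat -> 'rV[R]_d := fun i => if i == n then y else x i.

Lemma upd_eq x n y : upd x n y n = y. Proof. by rewrite /upd eqxx. Qed.

Lemma upd_neq x n y i : i != n -> upd x n y i = x i.
Proof. by rewrite /upd => /negbTE ->. Qed.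

Lemma npoints_upd x n y D : npoints (upd x n y) n D = npoints x n D.
Proof. by apply: eq_npoints => i ni; rewrite upd_neq// ltn_eqF. Qed.

Lemma npoints_updS x n y D : npoints (upd x n y) n.+1 D =
  (npoints x n D + ((y \notin mkseq x n) && (y \in D)))%N.
Proof.
rewrite npointsS npoints_upd upd_eq (_ : mkseq (upd x n y) n = mkseq x n)//.
by apply/eq_in_map => i; rewrite mem_iota add0n => ni; rewrite upd_neq// ltn_eqF.
Qed.

End npoints.

Section spacing.
Context {R : realType} {d : nat} (A : set 'rV[R]_d.+1) (k : nat).
Context (A_compact : compact A) (A_interior : A° !=set0).
Implicit Types (x : nat -> 'rV[R]_d.+1).
Local Notation rad x n := (spacing_radius A x k n).

Definition spacing_set x n : set R := [set r | 0 < r /\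
  forall y, inner_set A r y -> (k <= npoints x n (cball y r))%N].

Let e0 : 'rV[R]_d.+1 := delta_mx 0 0.

Lemma l2norm_e0 : l2norm e0 = 1.
Proof.
rewrite /l2norm (bigD1 ord0)//= big1 ?addr0 => [|i i0]; rewrite /e0 !mxE ?eqxx.
  by rewrite expr1n sqrtr1.
by rewrite (negbTE i0) expr0n.
Qed.

Lemma compact_sub_cball (K : set 'rV[R]_d.+1) : compact K ->
  exists2 D, 0 < D & K `<=` cball 0 D.
Proof.
move=> /compact_bounded[M [_ HM]]; exists (d.+1%:R * (`|M| + 1)).
  by rewrite mulr_gt0// ltr_wpDl.
move=> y Ky; rewrite /cball/= subr0; apply: le_trans (l2norm_le_mxnorm _) _.
by rewrite ler_wpM2l//; apply: HM => //; rewrite ltr_pwDr// ler_norm.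
Qed.

Lemma inner_set_large : exists2 r, 0 < r & inner_set A r = set0.
Proof.
have [D D0 AD] := compact_sub_cball A_compact; exists (3 * D); first by rewrite mulr_gt0.
rewrite -subset0 => y [Ay yA].
have : A (y + (3 * D) *: e0).
  by apply: yA; rewrite /cball/= addrC addKr l2normZ l2norm_e0 mulr1 gtr0_norm// mulr_gt0.
move=> /AD; have /AD := Ay; rewrite /cball/= !subr0 => yD.
have := ler_l2normD (y + (3 * D) *: e0) (- y).
rewrite l2normN (addrC y) addrK l2normZ l2norm_e0 mulr1 gtr0_norm ?mulr_gt0//.
lra.
Qed.

Lemma spacing_set_up x n r s : spacing_set x n r -> r <= s -> spacing_set x n s.
Proof.
move=> [r0 H] rs; split; first exact: lt_le_trans rs.
move=> y [Ay yA]; apply: leq_trans (H y _) (le_npoints _ _ _).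
  by split => //; apply: subset_trans yA; exact: le_cball.
exact: le_cball.
Qed.

Lemma has_inf_spacing x n : has_inf (spacing_set x n).
Proof.
split; last by exists 0 => r [/ltW].
have [r r0 rA] := inner_set_large; exists r; split => // y.
by rewrite rA.
Qed.

Lemma spacing_radius_lt x n r : rad x n < r -> spacing_set x n r.
Proof.
move=> /(inf_lt (has_inf_spacing x n).1)[s sG /ltW sr].
exact: spacing_set_up sr.
Qed.

Lemma spacing_radius_le x n r : spacing_set x n r -> rad x n <= r.
Proof. by move=> rG; apply: ge_inf => //; have [] := has_inf_spacing x n. Qed.

Lemma spacing_radius_ge0 x n : 0 <= rad x n.
Proof. by apply: lb_le_inf; [exact: (has_inf_spacing x n).1|move=> r [/ltW]]. Qed.

Lemma hole_le x n y r : 0 <= r -> cball y r `<=` A -> (npoints x n (cball y r) < k)%N ->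
  r <= rad x n.
Proof.
move=> r0 yA yk; rewrite leNgt; apply/negP => /spacing_radius_lt[_ /(_ y)].
rewrite leqNgt yk => H; suff : false by []. 
by apply: H; split => //; apply: yA; rewrite /cball/= subrr l2norm0.
Qed.

Lemma open_hole_le x n y r : 0 < r -> cball y r `<=` A -> (npoints x n (oball y r) < k)%N ->
  r <= rad x n.
Proof.
move=> r0 yA yk; apply/ler_addgt0Pr => e e0'.
have [er|re] := leP r e; first by apply: le_trans er _; rewrite lerDr spacing_radius_ge0.
rewrite -lerBlDr; apply: (@hole_le _ _ y); first by rewrite subr_ge0 ltW.
  by apply: subset_trans yA; apply: le_cball; rewrite gerBl ltW.
apply: leq_ltn_trans yk; apply: le_npoints; apply: cball_oball.
by rewrite gtrBl.
Qed.

Lemma spacing_radius_homo x m n : (m <= n)%N -> rad x n <= rad x m.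
Proof.
move=> mn; apply/ler_addgt0Pr => e e0'.
have /spacing_radius_lt[r0 H] : rad x m < rad x m + e by rewrite ltrDl.
apply: spacing_radius_le; split=> // y /H /leq_trans; apply.
exact: npoints_homo.
Qed.

Lemma eq_spacing_radius x x' n : (forall i, (i < n)%N -> x i = x' i) -> rad x n = rad x' n.
Proof.
move=> xx; congr inf; apply/funext => r; apply/propext.
by split=> -[r0 H]; split=> // y /H; rewrite (eq_npoints (x' := x')).
Qed.

(** The ball is open because at the exact radius the closed ball may already hold [k] points. *)
Definition holes x n : set 'rV[R]_d.+1 :=
  [set c | cball c (rad x n) `<=` A /\ (npoints x n (oball c (rad x n)) < k)%N].

(** Below the infimum every radius has a violating centre. A cluster point [c] of such centres is a
    hole: the closed ball stays in [A] because [A] is closed, and the finitely many points strictly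
    inside stay inside when the centre and the radius change a little. *)
Lemma holes_nonempty x n : 0 < rad x n -> exists c, holes x n c.
Proof.
set r := rad x n => r0.
have H (m : nat) : exists c, cball c (r * (1 - m.+2%:R^-1)) `<=` A /\
    (npoints x n (cball c (r * (1 - m.+2%:R^-1))) < k)%N.
  have m1 : (m.+2%:R^-1 : R) < 1 by rewrite invf_lt1// ltr1n.
  have rm0 : 0 < r * (1 - m.+2%:R^-1) by rewrite mulr_gt0// subr_gt0.
  apply: contrapT => Hn.
  have : spacing_set x n (r * (1 - m.+2%:R^-1)).
    split=> // y [Ay yA]; rewrite leqNgt; apply/negP => yk; apply: Hn.
    by exists y.
  move=> /spacing_radius_le; rewrite leNgt -/r -[ltRHS]mulr1 ltr_pM2l//.
  by rewrite gtrBl invr_gt0 ltr0n.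
have [u uP] := choice H.
have uA m : A (u m).
  apply: (uP m).1; rewrite /cball/= subrr l2norm0 mulr_ge0 ?(ltW r0)//.
  by rewrite subr_ge0 invf_le1// ler1n.
have [c Ac cu] := compact_subseq A_compact uA.
have near_c e : 0 < e -> exists c', [/\ cball c' (r - e) `<=` A,
    (npoints x n (cball c' (r - e)) < k)%N & l2norm (c' - c) <= e].
  move=> e0'; have [m Nm um] := cu e (Num.trunc (r / e)) e0'.
  exists (u m); have le : r - e <= r * (1 - m.+2%:R^-1).
    rewrite mulrBr mulr1 lerD2l lerN2 ler_pdivrMr//.
    rewrite mulrC -ler_pdivrMr//; apply: le_trans (ltW (truncnS_gt _)) _.
    by rewrite ler_nat; apply: leq_trans (leqnSn _).
  have [h1 h2] := uP m; split => //.
    by apply: subset_trans h1; exact: le_cball.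
  by apply: leq_ltn_trans h2; apply: le_npoints; exact: le_cball.
exists c; split.
  have oA : oball c r `<=` A.
    move=> y; rewrite /oball/= => yc.
    have [c' [c'A _ c'c]] := near_c ((r - l2norm (y - c)) / 2) ltac:(by rewrite divr_gt0// subr_gt0).
    apply: c'A; rewrite /cball/=; apply: le_trans (l2norm_triangle _ c _) _.
    rewrite (l2normC c); move: c'c; set a := l2norm _; set b := l2norm _; lra.
  have Acl : closed A by apply: compact_closed => //; exact: norm_hausdorff.
  move=> y; rewrite /cball/= => yc; apply: Acl => U /nbhs_cballP[e e0' eU].
  (* [y] may lie on the sphere, so it is pulled towards [c]: with [0 < t <= 1/2] the new point is in
     the open ball, and [t * r <= e] keeps it near [y]. *)
  pose t := Num.min (1 / 2) (e / r).
  have t0 : 0 < t by rewrite lt_min divr_gt0// divr_gt0.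
  have t1 : t <= 1 / 2 by rewrite ge_min lexx.
  have te : t <= e / r by rewrite ge_min lexx orbT.
  exists (y + t *: (c - y)); split.
    apply: oA; rewrite /oball/= (_ : _ - c = (1 - t) *: (y - c)); last first.
      by apply/rowP => i; rewrite !mxE; ring.
    rewrite l2normZ ger0_norm ?subr_ge0; last lra.
    apply: (@le_lt_trans _ _ ((1 - t) * r)).
      by rewrite ler_wpM2l// subr_ge0; lra.
    by rewrite gtr_pMl// gtrBl.
  apply: eU; rewrite /cball/= (addrC y) addrK l2normZ gtr0_norm// l2normC.
  apply: (@le_trans _ _ (t * r)); first by rewrite ler_wpM2l// ltW.
  by rewrite -ler_pdivlMr.
(* The signs are reversed to get the gap below: a point with distance to [c] less than [r] has
   distance less than [r - e]. *)
have [e e0' He] := finite_gap (fun i => - l2norm (x i - c)) n (- r).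
have [c' [_ c'k c'c]] := near_c (e / 2) ltac:(by rewrite divr_gt0).
apply: leq_ltn_trans c'k; apply: le_npoints_in => i /He {}He; rewrite /oball/cball/= => xc.
apply: le_trans (l2norm_triangle _ c _) _; rewrite (l2normC c).
have := He ltac:(by rewrite ltrN2).
move: c'c; rewrite -/r; set a := l2norm (x i - c); set b := l2norm _; lra.
Qed.

Lemma record_in_holes x n y c : 0 < rad x n -> holes x n c ->
  rad (upd x n y) n.+1 < rad x n -> oball c (rad x n) y.
Proof.
move=> r0 [cA ck]; apply: contraPP => yc; apply/negP; rewrite -leNgt.
apply: (@open_hole_le _ _ c) => //; rewrite npoints_updS.
by rewrite [y \in _]memNset// andbF addn0.
Qed.

(** If the radius did not drop, a hole of the enlarged sample would also be a hole of the old one,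
    hence would be [c]; but the ball at [c] now holds [k] points. *)
Lemma record_of_unique_hole x n y c : (0 < k)%N -> 0 < rad x n ->
  (forall c', holes x n c' -> c' = c) ->
  npoints x n (oball c (rad x n)) = k.-1 -> oball c (rad x n) y ->
  y \notin mkseq x n -> rad (upd x n y) n.+1 < rad x n.
Proof.
move=> k0 r0 cuniq ck cy yx.
have ux : rad (upd x n y) n = rad x n.
  by apply: eq_spacing_radius => i ni; rewrite upd_neq// ltn_eqF.
have := spacing_radius_homo (upd x n y) (leqnSn n).
rewrite ux le_eqVlt => /orP[/eqP E|//]; exfalso.
have /holes_nonempty[c'] : 0 < rad (upd x n y) n.+1 by rewrite E.
rewrite /holes/= E npoints_updS => -[c'A c'k].
have cc : c' = c by apply: cuniq; split=> //; apply: leq_ltn_trans c'k; rewrite leq_addr.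
move: c'k; rewrite cc ck yx mem_set//= addn1 prednK//; by rewrite ltnn.
Qed.

Lemma spacing_radius_gt0 x n : (0 < k)%N -> 0 < rad x n.
Proof.
move=> k0; have [c /nbhs_cballP[r r0 rA]] := A_interior.
have [z zx zc] : exists2 z, (forall i, (i < n)%N -> x i != z) & l2norm (z - c) <= r / 2.
  (* The points [z j] are distinct and interior; among [n + 1] of them one is missed by the sample,
     and a small ball about it holds no sample point. *)
  pose z (j : nat) := c + (r / 2 / j.+1%:R) *: e0.
  have zc j : l2norm (z j - c) <= r / 2.
    rewrite /z addrC addKr l2normZ l2norm_e0 mulr1 gtr0_norm ?divr_gt0//.
    by rewrite -[leRHS]mulr1 ler_wpM2l ?divr_ge0 ?(ltW r0)// invf_le1// ler1n.
  have zinj : injective z.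
    move=> i j /addrI /(congr1 (fun v => l2norm v)).
    rewrite !l2normZ l2norm_e0 !mulr1 !gtr0_norm ?divr_gt0//.
    have r2 : r / 2 != 0 by rewrite mulf_neq0 ?gt_eqF// invr_gt0.
    by move=> /(mulfI r2)/invr_inj/eqP; rewrite eqr_nat eqSS => /eqP.
  have [j _ jx] : exists2 j, j \in iota 0 n.+1 & z j \notin mkseq x n.
    apply: contrapT => H.
    have : {subset [seq z j | j <- iota 0 n.+1] <= mkseq x n}.
      move=> _ /mapP[j jn ->]; apply: contrapT => /negP jx; apply: H.
      by exists j.
    move=> /uniq_leq_size; rewrite map_inj_uniq ?iota_uniq// size_map size_iota size_mkseq ltnn.
    by move=> /(_ isT).
  exists (z j) => // i ni; apply: contra jx => /eqP <-; apply/mapP; exists i => //.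
  by rewrite mem_iota.
have [e e0' He] := finite_gap (fun i => l2norm (x i - z)) n 0.
pose s := Num.min e (r / 2).
have s0 : 0 < s by rewrite lt_min e0' divr_gt0.
apply: (lt_le_trans s0); apply: (@hole_le _ _ z); first exact: ltW.
  apply: subset_trans rA; apply: cball_sub.
  have : s <= r / 2 by rewrite ge_min lexx orbT.
  lra.
suff -> : npoints x n (cball z s) = 0%N by [].
apply/eqP; rewrite -leqn0 -(_ : npoints x n set0 = 0%N); last first.
  by rewrite /npoints; elim: (undup _) => //= y l IHl; rewrite in_set0.
apply: le_npoints_in => i ni; rewrite /cball/= leNgt => /negP; apply.
apply: (@le_lt_trans _ _ e); first by rewrite ge_min lexx.
rewrite -[ltLHS]add0r; apply: He => //; rewrite lt_def l2norm_ge0 andbT.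
apply/eqP => /l2norm_eq0/eqP; rewrite subr_eq0; apply/negP; exact: zx.
Qed.

End spacing.

(** * Uniqueness of the largest hole *)

Section enclosing.
Context {R : realType} {d : nat}.
Implicit Types (x : nat -> 'rV[R]_d) (I J : seq nat) (c y : 'rV[R]_d) (r : R).

Definition enclosed x I r y : Prop := forall i, i \in I -> l2norm (x i - y) <= r.

(** The radius of the smallest ball enclosing the points indexed by [I]. It is meaningful for
    nonempty [I] only, whence the recurring member [i0]. *)
Definition encl x I : R := inf [set r | exists y, enclosed x I r y].

Lemma has_inf_encl x I i0 : i0 \in I -> has_inf [set r | exists y, enclosed x I r y].
Proof.
move=> i0I; split; last first.
  by exists 0 => r [y /(_ _ i0I)]; apply: le_trans; exact: l2norm_ge0.
exists (\sum_(i <- I) l2norm (x i)); exists 0 => i iI; rewrite subr0.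
rewrite (big_rem i)//= lerDl; apply: sumr_ge0 => j _; exact: l2norm_ge0.
Qed.

Lemma encl_le x I i0 r y : i0 \in I -> enclosed x I r y -> encl x I <= r.
Proof.
move=> i0I ye; apply: ge_inf; last by exists y.
by have [] := has_inf_encl x i0I.
Qed.

Lemma encl_lt x I i0 r : i0 \in I -> encl x I < r -> exists y, enclosed x I r y.
Proof.
move=> i0I /(inf_lt (has_inf_encl x i0I).1)[s [y ye] /ltW sr].
by exists y => i /ye /le_trans; exact.
Qed.

Lemma encl_attained x I i0 : i0 \in I -> exists y, enclosed x I (encl x I) y.
Proof.
move=> i0I.
have /choice[u uP] : forall m : nat, exists y, enclosed x I (encl x I + m.+1%:R^-1) y.
  by move=> m; apply: (encl_lt i0I); rewrite ltrDl invr_gt0.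
have uK m : cball (x i0) (encl x I + 1) (u m).
  rewrite /cball/= l2normC; apply: le_trans (uP m _ i0I) _.
  by rewrite lerD2l invf_le1// ler1n.
have [y _ yu] := compact_subseq (@compact_cball _ _ (x i0) (encl x I + 1)) uK.
exists y => i iI; apply/ler_addgt0Pr => e e0.
have e20 : 0 < e / 2 by rewrite divr_gt0.
have [m Nm um] := yu (e / 2) (Num.trunc (e / 2)^-1) e20.
apply: le_trans (l2norm_triangle _ (u m) _) _; rewrite [e]splitr addrA.
apply: lerD => //; apply: le_trans (uP m _ iI) _; rewrite lerD2l.
rewrite invf_ple ?posrE//; apply: le_trans (ltW (truncnS_gt _)) _.
by rewrite ler_nat ltnS.
Qed.

(** Says that [cball c r] is the smallest ball enclosing its points: a smaller enclosing ball would
    also be one of radius [r], hence centred at [c], where the points are at distance exactly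
    [r]. *)
Definition critical x c r J : Prop :=
  (forall j, j \in J -> l2norm (x j - c) = r) /\
  (forall y, enclosed x J r y -> y = c).

Lemma encl_critical x c r J j0 : j0 \in J -> critical x c r J -> encl x J = r.
Proof.
move=> j0J [cr cu]; apply/eqP; rewrite eq_le; apply/andP; split.
  by apply: (encl_le (y := c) j0J) => i /cr ->.
rewrite leNgt; apply/negP => lt.
have [y ye] := encl_attained x j0J.
have yc : y = c by apply: cu => i /ye /le_trans; apply; exact: ltW.
by have := ye _ j0J; rewrite yc cr// leNgt lt.
Qed.

(** Countably many ratios keep [tie] measurable, and they suffice since they come arbitrarily close
    to 1. *)
Definition stretch x (i i0 : nat) (m : nat) : nat -> 'rV[R]_d :=
  upd x i (x i0 + (1 + m.+1%:R^-1) *: (x i - x i0)).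

(* Two holes away from the boundary, or one such hole with a superfluous point on
   its sphere, force a tie. When [x i] is dilated about [x i0] a tie can occur for
   one ratio only, so ties have probability zero. *)
Definition tie x I J (i i0 : nat) : Prop :=
  encl x (i :: I) = encl x J /\
  forall m, encl x J < encl (stretch x i i0 m) (i :: I).

Definition generic x : Prop :=
  (forall i j, i != j -> x i != x j) /\
  (forall I J i i0, i0 \in I -> i \notin I -> i \notin J -> ~ tie x I J i i0).

(** If the stretched points fitted in a ball of radius [r] about [y], so would the original ones, as
    [x i] lies on the segment from [x i0] to its stretched image. Criticality forces [y = c], and
    strict convexity then puts [x i] off the sphere. *)
Lemma tie_of_critical x I J i i0 j0 c c' r : i0 \in I -> j0 \in J ->
  i \notin I -> x i != x i0 -> critical x c r (i :: I) -> critical x c' r J ->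
  tie x I J i i0.
Proof.
move=> i0I j0J iI xi cI cJ.
have iiI : i \in i :: I by rewrite mem_head.
have EI := encl_critical iiI cI; have EJ := encl_critical j0J cJ.
split=> [|m]; first by rewrite EI EJ.
rewrite EJ ltNge; apply/negP => le.
have [y ye] := encl_attained (stretch x i i0 m) iiI.
set p := x i0 + (1 + m.+1%:R^-1) *: (x i - x i0) in ye *.
have m0 : 0 < m.+1%:R^-1 :> R by rewrite invr_gt0.
set l := 1 + m.+1%:R^-1 in p ye *.
have l1 : 1 < l by rewrite ltrDl.
have l0 : 0 < l by apply: lt_trans l1.
have xE : x i = x i0 + l^-1 *: (p - x i0).
  by rewrite /p addrAC subrr add0r scalerA mulVf ?gt_eqF// scale1r addrC subrK.
have py : l2norm (p - y) <= r.
  by have := ye _ iiI; rewrite /stretch upd_eq => /le_trans; apply.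
have Iy j : j \in I -> l2norm (x j - y) <= r.
  move=> jI; have := ye j; rewrite inE jI orbT /stretch upd_neq; last first.
    by apply: contra iI => /eqP <-.
  by move=> /(_ isT) /le_trans; apply.
have yc : y = c.
  apply: cI.2 => j; rewrite inE => /orP[/eqP ->|/Iy//].
  rewrite xE; apply: le_trans (l2norm_segment _ _ _ _ _) _.
  - by rewrite invr_ge0 ltW.
  - by rewrite invf_le1// ltW.
  have := Iy _ i0I; move: py; set a := l2norm _; set b := l2norm _.
  have : 0 < l^-1 by rewrite invr_gt0.
  have : l^-1 < 1 by rewrite invf_lt1.
  nra.
have : l2norm (x i - c) < r.
  rewrite xE; apply: l2norm_segment_lt.
  - by rewrite invr_gt0.
  - by rewrite invf_lt1.
  - apply: contra xi => /eqP x0p; rewrite xE -x0p subrr scaler0 addr0//.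
  - by rewrite -yc; exact: Iy.
  - by rewrite -yc.
by rewrite cI.1// ltxx.
Qed.

End enclosing.

Section unique_hole.
Context {R : realType} {d : nat} (A : set 'rV[R]_d.+1) (k : nat).
Context (A_compact : compact A) (A_interior : A° !=set0) (k_gt0 : (0 < k)%N).
Implicit Types (x : nat -> 'rV[R]_d.+1).
Local Notation rad x n := (spacing_radius A x k n).

(* If [y != c] were within [R] of all [x_J], a small move of [c] away from [y]
   would expel [x_J] and give a larger hole. *)
Lemma hole_critical x n c eta (J : seq nat) : 0 < eta ->
  cball c (rad x n + eta) `<=` A ->
  (forall j, j \in J -> l2norm (x j - c) = rad x n) ->
  (npoints x n (cball c (rad x n) `\` [set x j | j in [set` J]]) < k)%N ->
  critical x c (rad x n) J.
Proof.
set r := rad x n => eta0 cA Jr Jk; split => // y ye.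
have r0 : 0 < r by exact: spacing_radius_gt0.
apply: contrapT => yc.
have yc0 : 0 < l2norm (y - c).
  rewrite lt_def l2norm_ge0 andbT; apply/eqP => /l2norm_eq0/eqP.
  by rewrite subr_eq0 => /eqP.
have [e e0 He] := finite_gap (fun i => l2norm (x i - c)) n r.
set L := l2norm (y - c) in yc0.
(* The centre moves by at most [eta / 2], so the ball stays in [A] with room to grow, and by at most
   [e / 2], so that points outside the old closed ball stay outside. *)
pose t := Num.min (e / 2) (eta / 2) / L.
have t0 : 0 < t by rewrite divr_gt0// lt_min !divr_gt0.
have tL1 : t * L <= e / 2 by rewrite /t divfK ?gt_eqF// ge_min lexx.
have tL2 : t * L <= eta / 2 by rewrite /t divfK ?gt_eqF// ge_min lexx orbT.
pose c' := c - t *: (y - c).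
have c'c : l2norm (c' - c) = t * L by rewrite /c' addrC addKr l2normN l2normZ gtr0_norm.
(* With [u = x j - c] and [v = y - c], the inequality [|u - v| <= |u|] gives
   [2 <u, v> >= |v|^2 > 0], so moving the centre by [- t v] increases the distance to [x j]. *)
have Jout j : j \in J -> r < l2norm (x j - c').
  move=> jJ; rewrite ltNge l2norm_le_sqr ?(ltW r0)//; apply/negP.
  have := ye j jJ; rewrite l2norm_le_sqr ?(ltW r0)//.
  have /(congr1 (fun z => z ^+ 2)) := Jr j jJ; rewrite sqr_l2norm.
  have : 0 < dot (y - c) (y - c) by rewrite -sqr_l2norm exprn_gt0.
  rewrite (_ : x j - y = (x j - c) - (y - c)); last by rewrite opprB addrA subrK.
  rewrite (_ : x j - c' = (x j - c) + t *: (y - c)); last by rewrite /c' opprB addrCA addrC.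
  move: (x j - c) (y - c) => u v; rewrite !dotE (dotC v u) => v0 ue.
  by nra.
(* The ball about [c'] can even be enlarged by [s] without catching a new point, which contradicts
   the maximality of the radius. *)
have [f f0 Hf] := finite_gap (fun i => l2norm (x i - c')) n r.
pose s := Num.min (f / 2) (eta / 2).
have s0 : 0 < s by rewrite lt_min !divr_gt0.
have : r + s <= r.
  apply: (@hole_le _ _ _ _ A_compact x n c'); first by rewrite addr_ge0 ?ltW.
    apply: subset_trans cA; apply: cball_sub; rewrite c'c.
    have : s <= eta / 2 by rewrite ge_min lexx orbT.
    lra.
  apply: leq_ltn_trans Jk; apply: le_npoints_in => i ni.
  rewrite /cball/= => xi.
  have xi' : l2norm (x i - c') <= r.
    rewrite leNgt; apply/negP => /(Hf i ni).
    have : s <= f / 2 by rewrite ge_min lexx.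
    by move: xi; set b := l2norm _; lra.
  split.
    rewrite leNgt; apply/negP => /(He i ni).
    have := l2norm_triangle (x i) c' c; rewrite c'c; move: xi'.
    set b := l2norm _; set b' := l2norm _; lra.
  by move=> [j jJ ji]; have := Jout j jJ; rewrite ji ltNge xi'.
by rewrite gerDl leNgt s0.
Qed.

Let sphere x n c : seq nat := [seq i <- iota 0 n | l2norm (x i - c) == rad x n].

Let sphereP x n c i : reflect ((i < n)%N /\ l2norm (x i - c) = rad x n) (i \in sphere x n c).
Proof.
rewrite /sphere mem_filter mem_iota add0n /= andbC.
by apply: (iffP andP) => -[-> /eqP]//.
Qed.

Lemma exists_rV_neq (c : 'rV[R]_d.+1) : exists y, y != c.
Proof.
exists (c + delta_mx 0 0); rewrite -subr_eq0 addrC addKr.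
by apply/eqP => /rowP/(_ ord0); rewrite !mxE !eqxx => /eqP; rewrite oner_eq0.
Qed.

Lemma hole_sphere_critical x n c eta : 0 < eta ->
  cball c (rad x n + eta) `<=` A -> holes A k x n c ->
  critical x c (rad x n) (sphere x n c).
Proof.
move=> eta0 cA [_ ck]; apply: (hole_critical eta0 cA); first by move=> j /sphereP[].
apply: leq_ltn_trans ck; apply: le_npoints_in => i ni [].
rewrite /cball/oball/= le_eqVlt => /orP[/eqP xi []|//].
by exists i => //=; apply/sphereP.
Qed.

Lemma sphere_nonempty x n c eta : 0 < eta ->
  cball c (rad x n + eta) `<=` A -> holes A k x n c -> exists i, i \in sphere x n c.
Proof.
move=> eta0 cA /(hole_sphere_critical eta0 cA)[_ H].
have [y yc] := exists_rV_neq c; apply: contrapT => nS.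
by move/eqP: yc; apply; apply: H => i iS; exfalso; apply: nS; exists i.
Qed.

Lemma critical_remove x c r (S : seq nat) i : 0 < r -> i \in S ->
  critical x c r S -> exists I, [/\ i \notin I, critical x c r (i :: I),
    {subset I <= S} /\ {subset S <= i :: I} & exists i0, i0 \in I].
Proof.
move=> r0 iS cS; pose I := [seq j <- S | j != i]; exists I.
have SI j : (j \in i :: I) = (j \in S).
  rewrite inE mem_filter; have [->|] := eqVneq j i => //.
have cI : critical x c r (i :: I).
  by split=> [j|y ye]; [rewrite SI; exact: cS.1|apply: cS.2 => j; rewrite -SI; exact: ye].
split=> //; first by rewrite mem_filter eqxx.
  by split=> j; [rewrite mem_filter => /andP[]|rewrite SI].
apply: contrapT => nI.
have xc : x i = c.
  apply: cI.2 => j; rewrite inE => /orP[/eqP ->|jI]; first by rewrite subrr l2norm0 ltW.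
  by exfalso; apply: nI; exists j.
by have := cI.1 i (mem_head _ _); rewrite xc subrr l2norm0 => rE; rewrite -rE ltxx in r0.
Qed.

(** If the sphere of [c] lies on the sphere of [c'], then [c'] encloses it and criticality gives
    [c' = c]. Otherwise some [i] lies on the first sphere only, and the two critical sets have equal
    enclosing radii: a tie. *)
Lemma hole_unique x n c c' eta : generic x -> 0 < eta ->
  cball c (rad x n + eta) `<=` A -> holes A k x n c ->
  cball c' (rad x n + eta) `<=` A -> holes A k x n c' -> c = c'.
Proof.
move=> [xinj gen] eta0 cA ch c'A ch'.
have r0 : 0 < rad x n by exact: spacing_radius_gt0.
have cS := hole_sphere_critical eta0 cA ch.
have cS' := hole_sphere_critical eta0 c'A ch'.
have [sub|/existsNP[i /not_implyP[iS /negP iS']]] :=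
    pselect (forall i, i \in sphere x n c -> i \in sphere x n c').
  by apply/esym; apply: cS.2 => i /sub /cS'.1 ->.
have [j0 j0S'] := sphere_nonempty eta0 c'A ch'.
have [I [iI cI _ [i0 i0I]]] := critical_remove r0 iS cS.
exfalso; apply: (gen I (sphere x n c') i i0) => //.
apply: (tie_of_critical i0I j0S' iI _ cI cS').
by apply: xinj; apply: contra iI => /eqP ->.
Qed.

(** With fewer than [k - 1] points inside, one point of the sphere could be spared: the remaining
    points of the sphere would still be critical, and comparing them with the full sphere gives a
    tie. *)
Lemma hole_count x n c eta : generic x -> 0 < eta ->
  cball c (rad x n + eta) `<=` A -> holes A k x n c ->
  npoints x n (oball c (rad x n)) = k.-1.
Proof.
move=> [xinj gen] eta0 cA ch.
have r0 : 0 < rad x n by exact: spacing_radius_gt0.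
apply/eqP; rewrite eqn_leq; have [_ ck] := ch.
rewrite -ltnS prednK// ck /= leqNgt; apply/negP => lt.
have [i iS] := sphere_nonempty eta0 cA ch.
have [I [iI cI [IS SI] [i0 i0I]]] := critical_remove r0 iS (hole_sphere_critical eta0 cA ch).
have cJ : critical x c (rad x n) I.
  apply: (hole_critical eta0 cA); first by move=> j /IS /sphereP[].
  apply: (@leq_ltn_trans (npoints x n (oball c (rad x n) `|` [set x i]))); last first.
    apply: leq_ltn_trans (npointsU1 _ _ _ _) _.
    by rewrite -ltn_predRL.
  apply: le_npoints_in => j nj [xj xjI].
  have [jr|jr] := eqVneq (l2norm (x j - c)) (rad x n); last first.
    by left; rewrite /oball/= lt_neqAle jr.
  right => /=; apply: contrapT => ji; apply: xjI; exists j => //=.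
  suff : j \in i :: I.
    rewrite inE => /orP[/eqP jiE|//]; exfalso; apply: ji; by rewrite jiE.
  by apply: SI; apply/sphereP.
apply: (gen I I i i0) => //; apply: (tie_of_critical i0I i0I iI _ cI cJ).
by apply: xinj; apply: contra iI => /eqP ->.
Qed.

End unique_hole.

(** * Convex sets *)

Section near_boundary.
Context {R : realType}.
Local Notation leb := (@lebesgue_measure_rV R).

Lemma dispersed_filter n (r : R) (s : seq 'rV[R]_n) (p : pred 'rV[R]_n) :
  dispersed r s -> dispersed r [seq x <- s | p x].
Proof. exact: pairwise_filter. Qed.

(** Transfers a count between scales: each point of the net [Z] has boundedly many points of [s]
    nearby, by the volume bound. *)
Lemma dispersed_net n (t rho : R) (Z s : seq 'rV[R]_n) :
  0 < t -> 0 <= rho -> dispersed t s ->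
  (forall x, x \in s -> exists2 z, z \in Z & l2norm (x - z) <= rho) ->
  (size s)%:R <= (size Z)%:R * ((2 * rho + t) / t) ^+ n.
Proof.
move=> t0 rho0; elim: Z s => [|z Z IH] s ss sZ.
  by case: s ss sZ => [_ _|x s _ /(_ x (mem_head _ _))[]//]; rewrite mul0r.
rewrite -(count_predC (fun x => l2norm (x - z) <= rho)) natrD -!size_filter.
rewrite /= -natr1 mulrDl mul1r addrC; apply: lerD.
  apply: IH; first exact: dispersed_filter.
  move=> x; rewrite mem_filter => /andP[/= xz /sZ[z']]; rewrite inE => /orP[/eqP ->|z'Z].
    by rewrite (negbTE xz).
  by exists z'.
apply: (packing_cball (x := z)) => //; first exact: dispersed_filter.
by move=> x; rewrite mem_filter => /andP[].
Qed.

Definition nearb n (A : set 'rV[R]_n) (r : R) : set 'rV[R]_n :=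
  [set x | cball x r `<=` A /\ ~ cball x (2 * r) `<=` A].

(** An upper Minkowski content bound for the boundary, in packing form. Both hypotheses on the shape
    of [A] enter through it. *)
Definition thin_boundary d (A : set 'rV[R]_d.+1) : Prop :=
  exists2 C : R, 0 <= C & forall r (s : seq 'rV[R]_d.+1), 0 < r -> r < 1 -> dispersed r s ->
    (forall x, x \in s -> nearb A r x) -> (size s)%:R <= C * r^-1 ^+ d.

Lemma bernoulli_le (t : R) n : t <= 1 -> 1 - n%:R * t <= (1 - t) ^+ n.
Proof.
move=> t1; have t10 : 0 <= 1 - t by rewrite subr_ge0.
elim: n => [|n IH]; first by rewrite mul0r subr0.
have [t0|t0] := leP 0 t; last first.
  rewrite exprS -natr1; move: IH; set a := _ ^+ n; have : 0 <= a by exact: exprn_ge0.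
  have := ler0n R n; nra.
rewrite exprS -natr1; move: IH; set a := _ ^+ n; have : 0 <= a by exact: exprn_ge0.
have := ler0n R n; nra.
Qed.

Lemma closed_compact_rV n (A : set 'rV[R]_n) : compact A -> closed A.
Proof. by apply: compact_closed; exact: norm_hausdorff. Qed.

Lemma measurable_compact_rV n (A : set 'rV[R]_n) : compact A ->
  measurable (A : set (borel_rV R n)).
Proof. by move=> Ac; apply: measurable_closed_rV; exact: closed_compact_rV. Qed.

Lemma lebesgue_compact_fin n (A : set 'rV[R]_n) : compact A -> (leb n A < +oo)%E.
Proof.
move=> Ac; have /compact_bounded[M [_ HM]] := Ac.
have M1 : 0 < `|M| + 1 by rewrite ltr_wpDl.
apply: (@le_lt_trans _ _ (leb n (cball 0 (n.+1%:R * (`|M| + 1))))).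
  apply: le_measure; rewrite ?inE.
  - exact: measurable_compact_rV.
  - exact: measurable_cball.
  move=> y Ay; rewrite /cball/= subr0; apply: le_trans (l2norm_le_mxnorm _) _.
  apply: ler_pM => //; first by rewrite ler_nat.
  by apply: HM => //; rewrite ltr_pwDr// ler_norm.
by rewrite lebesgue_measure_rV_cball ?mulr_gt0// ltry.
Qed.

Lemma convex_setP n (A : set 'rV[R]_n) : convex_set A ->
  forall x y t, A x -> A y -> 0 <= t -> t <= 1 -> A (t *: x + (1 - t) *: y).
Proof.
move=> cA x y t Ax Ay t0 t1.
have t01 : Itv.spec (Itv.num_sem (R := R)) (Itv.Real `[0%Z, 1%Z]) t.
  by rewrite /= /Itv.num_sem/= num_real in_itv/= t0 t1.
have := cA x y (Itv.mk t01); rewrite !inE => /(_ Ax Ay).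
by [].
Qed.

(* Shrinking [A] by the factor [1 - t] about the centre of an inscribed ball
   removes all points near the boundary. *)
Lemma convex_thin_boundary d (A : set 'rV[R]_d.+1) :
  compact A -> A° !=set0 -> convex_set A -> thin_boundary A.
Proof.
move=> Ac [c /nbhs_cballP[rho rho0 cA]] /convex_setP Aconv.
have mA : measurable (A : set (borel_rV R d.+1)) by exact: measurable_compact_rV.
have vfin : leb d.+1 A \is a fin_num by rewrite ge0_fin_numE// lebesgue_compact_fin.
pose v := fine (leb d.+1 A).
have v0 : 0 <= v by rewrite fine_ge0.
have th0 := ballvol_gt0 (R := R) d.+1.
(* The shell [A] minus its shrunken copy has volume at most [d.+1 * t * v] with [t = 3 r / rho]; it
   is packed by disjoint balls of radius [r / 2]. *)
exists (d.+1%:R * 3 * v * 2 ^+ d.+1 / (rho * ballvol d.+1)).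
  by rewrite divr_ge0 ?mulr_ge0// ?exprn_ge0// ltW.
move=> r s r0 r1 ss sA.
have r20 : 0 < r / 2 by rewrite divr_gt0.
suff H : (size s)%:R * (ballvol d.+1 * (r / 2) ^+ d.+1) <= d.+1%:R * (3 * r / rho) * v.
  rewrite -(ler_pM2r (_ : 0 < ballvol d.+1 * (r / 2) ^+ d.+1)); last by rewrite mulr_gt0// exprn_gt0.
  apply: le_trans H _; rewrite le_eqVlt; apply/orP; left; apply/eqP.
  rewrite expr_div_n (exprS r) exprVn.
  have a0 : 2 ^+ d.+1 != 0 :> R by rewrite expf_neq0// pnatr_eq0.
  have b0 : r ^+ d != 0 by rewrite expf_neq0// gt_eqF.
  move: (2 ^+ d.+1) (r ^+ d) a0 b0 => a b a0 b0; field.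
  by rewrite a0 b0 !gt_eqF.
have ss' : dispersed (2 * (r / 2)) s by rewrite mulrC divfK ?pnatr_eq0.
(* A point [y] within [r / 2] of a centre is within [3 r = t rho] of some [z] outside [A], so that
   [c + (z - y) / t] is still in the inscribed ball. *)
pose t := 3 * r / rho.
have t0 : 0 < t by rewrite divr_gt0// mulr_gt0.
have sub x y : x \in s -> cball x (r / 2) y -> A y.
  move=> /sA[xA _] xy; apply: xA; apply: le_cball xy.
  by rewrite ler_pdivrMr// mulr_natr mulr2n lerDl ltW.
(* For [t >= 1] the volume of [A] alone gives the bound. *)
have [t1|t1] := leP 1 t.
  have := @packing_bound _ _ (r / 2) v s A r20 ss' mA.
  rewrite -/t fineK// lexx => /(_ isT (fun x xs y => sub x y xs)) /le_trans; apply.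
  rewrite -[leLHS]mul1r ler_wpM2r// -[leLHS]mul1r ler_pM// ler1n//.
pose h := affmap (1 - t)^-1 (- ((1 - t)^-1 * t) *: c).
have t1' : 0 < 1 - t by rewrite subr_gt0.
have hE y : y = (1 - t) *: h y + t *: c.
  apply/rowP => i; rewrite !mxE /=; field; exact: lt0r_neq0.
pose At : set (borel_rV R d.+1) := h @^-1` A.
have mAt : measurable At by rewrite -[X in measurable X]setTI; exact: measurable_affmap.
have AtE : leb d.+1 At = ((1 - t) ^+ d.+1 * v)%:E.
  by rewrite lebesgue_measure_rV_affine ?invr_gt0// invrK EFinM fineK.
have AtA : At `<=` A.
  move=> y Ay; rewrite (hE y) (_ : t = 1 - (1 - t)); last by rewrite opprB addrC subrK.
  have cc : A c by apply: cA; rewrite /cball/= subrr l2norm0 ltW.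
  have := Aconv (h y) c (1 - t) Ay cc (ltW t1') ltac:(lra).
  by rewrite (_ : 1 - (1 - (1 - t)) = 1 - t) //; last ring.
have AAt : (leb d.+1 (A `\` At) <= (d.+1%:R * t * v)%:E)%E.
  rewrite measureD//; last exact: lebesgue_compact_fin.
  have -> : A `&` At = At by apply/seteqP; split=> [y []//|y Ay]; split=> //; exact: AtA.
  rewrite [leLHS](_ : _ = (v - (1 - t) ^+ d.+1 * v)%:E); last first.
    by rewrite EFinB; congr (_ - _)%E; [exact/esym/fineK|exact: AtE].
  rewrite lee_fin.
  have := bernoulli_le d.+1 (ltW t1); move: (_ ^+ _) => a; nra.
have mAAt : measurable (A `\` At : set (borel_rV R d.+1)) by exact: measurableD.
apply: (packing_bound r20 ss' mAAt AAt) => x xs y xy; split; first exact: sub xy.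
move=> Ay; have [_] := sA x xs; apply => z xz.
have hz : A (c + t^-1 *: (z - y)).
  apply: cA; rewrite /cball/= [c + _]addrC addrK l2normZ gtr0_norm ?invr_gt0//.
  rewrite mulrC ler_pdivrMr// /t mulrCA divff ?gt_eqF// mulr1.
  apply: le_trans (l2norm_triangle _ x _) _; move: xz xy; rewrite /cball/= (l2normC y).
  by set a := l2norm _; set b := l2norm _; lra.
(* If [y] were in the shrunken copy, [z] would be the convex combination of [h y] and
   [c + (z - y) / t] with weights [1 - t] and [t]. *)
have := Aconv (h y) _ (1 - t) Ay hz (ltW t1') ltac:(lra).
rewrite (_ : 1 - (1 - t) = t); last by ring.
by rewrite (scalerDr t c) scalerA divff ?gt_eqF// scale1r addrA -hE addrC subrK.
Qed.

(** The boundary point is the last point of the segment that belongs to [A]. *)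
Lemma boundary_segment n (A : set 'rV[R]_n) x y : closed A -> A x -> ~ A y ->
  exists2 z, boundary A z & l2norm (x - z) <= l2norm (x - y).
Proof.
move=> Ac Ax Ay; pose p (t : R) := x + t *: (y - x).
pose T := [set t : R | 0 <= t <= 1 /\ A (p t)].
have T0 : T 0 by split; rewrite ?lexx ?ler01// /p scale0r addr0.
have hT : has_sup T by split; [exists 0|exists 1 => t [/andP[]]].
have sup0 : 0 <= sup T by apply: ub_le_sup => //; case: hT.
have sup1 : sup T <= 1 by apply: ge_sup; [exists 0|move=> t [/andP[]]].
have pp t t' : l2norm (p t - p t') = `|t - t'| * l2norm (y - x).
  by rewrite /p opprD addrACA subrr add0r -scalerBl l2normZ.
have Ap : A (p (sup T)).
  apply: Ac => U /nbhs_cballP[e e0 eU].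
  have e1 : 0 < e / (l2norm (y - x) + 1) by rewrite divr_gt0// ltr_wpDl// l2norm_ge0.
  have [t Tt tlt] := sup_adherent e1 hT.
  exists (p t); split; first exact: Tt.2.
  apply: eU; rewrite /cball/= pp distrC ger0_norm; last first.
    by rewrite subr_ge0; apply: ub_le_sup => //; case: hT.
  apply: (@le_trans _ _ (e / (l2norm (y - x) + 1) * l2norm (y - x))).
    rewrite ler_wpM2r ?l2norm_ge0//; move: tlt; lra.
  rewrite mulrAC ler_pdivrMr ?ltr_wpDl ?l2norm_ge0// mulrDr mulr1 lerDl ltW//.
exists (p (sup T)); last first.
  rewrite {1}(_ : x = p 0); last by rewrite /p scale0r addr0.
  rewrite pp sub0r normrN ger0_norm// (l2normC y) -[leRHS]mul1r.
  by rewrite ler_wpM2r ?l2norm_ge0.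
split; first exact: subset_closure.
move=> /nbhs_cballP[e e0 eA].
have s1 : sup T < 1.
  rewrite lt_neqAle sup1 andbT; apply/eqP => s1; apply: Ay.
  by move: Ap; rewrite s1 /p scale1r addrC subrK.
pose t := Num.min 1 (sup T + e / (l2norm (y - x) + 1)).
have e1 : 0 < e / (l2norm (y - x) + 1) by rewrite divr_gt0// ltr_wpDl// l2norm_ge0.
have st : sup T < t by rewrite lt_min s1 ltrDl.
have : t <= sup T.
  apply: ub_le_sup; first by case: hT.
  split; first by rewrite ge_min lexx andbT ltW// (le_lt_trans sup0).
  apply: eA; rewrite /cball/= pp ger0_norm ?subr_ge0 ?(ltW st)//.
  apply: (@le_trans _ _ (e / (l2norm (y - x) + 1) * l2norm (y - x))).
    have : t <= sup T + e / (l2norm (y - x) + 1) by rewrite ge_min lexx orbT.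
    by move=> tle; rewrite ler_wpM2r ?l2norm_ge0// lerBlDl.
  rewrite mulrAC ler_pdivrMr ?ltr_wpDl ?l2norm_ge0// mulrDr mulr1 lerDl ltW//.
by rewrite leNgt st.
Qed.

Lemma thin_boundary_of_dispersed d (A : set 'rV[R]_d.+1) (C : R) :
  closed A -> 0 <= C -> 
  (forall r (s : seq 'rV[R]_d.+1), 0 < r -> r < 1 -> dispersed r s ->
    (forall x, x \in s -> boundary A x) -> (size s)%:R <= C * r^-1 ^+ d) ->
  thin_boundary A.
Proof.
move=> Ac C0 HC; exists (C * 7 ^+ d.+1); first by rewrite mulr_ge0// exprn_ge0.
move=> r s r0 r1 ss sA.
have Hm s' : dispersed r s' -> (forall x, x \in s' -> boundary A x) ->
    (size s' <= (Num.trunc (C * r^-1 ^+ d)).+1)%N.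
  move=> ss' sA'; rewrite ltnW// -(ltr_nat R) (le_lt_trans (HC r s' r0 r1 ss' sA'))//.
  exact: truncnS_gt.
have [Z [sZ ZA Znet]] := maximal_dispersed (ltW r0) Hm.
(* A point of [nearb A r] is within [2 r] of the boundary, hence within [3 r] of the net [Z]; each
   point of [Z] accounts for at most [7 ^ d.+1] points. *)
have := @dispersed_net _ r (3 * r) Z s r0 ltac:(by rewrite mulr_ge0// ltW) ss.
rewrite (_ : (2 * (3 * r) + r) / r = 7); last by field; rewrite gt_eqF.
move=> H; apply: le_trans (H _) _.
  move=> x /sA[xA /existsNP[y /not_implyP[xy yA]]].
  have Ax : A x by apply: xA; rewrite /cball/= subrr l2norm0 ltW.
  have [b bA xb] := boundary_segment Ac Ax yA.
  have [z zZ bz] := Znet b bA; exists z => //.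
  apply: le_trans (l2norm_triangle _ b _) _.
  have : l2norm (x - b) <= 2 * r by apply: le_trans xb _; rewrite l2normC.
  by move: bz; set a := l2norm _; set a' := l2norm _; lra.
by rewrite mulrAC ler_wpM2r ?exprn_ge0//; exact: HC.
Qed.

End near_boundary.

(** * Sets with a C11 boundary *)

Section c11.
Context {R : realType}.

Definition locally_thin d (B U : set 'rV[R]_d.+1) : Prop :=
  exists2 C : R, 0 <= C & forall r (s : seq 'rV[R]_d.+1), 0 < r -> r < 1 -> dispersed r s ->
    (forall x, x \in s -> B x /\ U x) -> (size s)%:R <= C * r^-1 ^+ d.

Lemma locally_thinU d (B U V : set 'rV[R]_d.+1) :
  locally_thin B U -> locally_thin B V -> locally_thin B (U `|` V).
Proof.
move=> [C C0 HC] [D D0 HD]; exists (C + D); first exact: addr_ge0.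
move=> r s r0 r1 ss sUV.
rewrite -(count_predC (fun x => x \in U)) natrD -!size_filter mulrDl; apply: lerD.
  apply: HC => //; first exact: dispersed_filter.
  by move=> x; rewrite mem_filter => /andP[/set_mem Ux /sUV[]].
apply: HD => //; first exact: dispersed_filter.
move=> x; rewrite mem_filter /= => /andP[/negP Ux /sUV[Bx []]//].
by move=> xU; exfalso; apply: Ux; rewrite inE.
Qed.

Lemma locally_thin_compact d (B : set 'rV[R]_d.+1) : compact B ->
  (forall x, B x -> exists2 e, 0 < e & locally_thin B (oball x e)) ->
  locally_thin B B.
Proof.
move=> Bc Bloc.
have /choice[e eP] : forall x, exists e, B x -> 0 < e /\ locally_thin B (oball x e).
  move=> x; have [Bx|nBx] := pselect (B x); last by exists 0.
  by have [e e0 eB] := Bloc x Bx; exists e.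
move: Bc; rewrite compact_cover => /(_ _ B (fun x => oball x (e x))).
case=> [x _|x Bx|D' D'B BD]; first exact: open_oball.
  by exists x => //; rewrite /oball/= subrr l2norm0; have [] := eP x Bx.
have [C C0 HC] : locally_thin B (cover [set` D'] (fun x => oball x (e x))).
  have : forall x, x \in (D' : seq _) -> B x by move=> x /D'B; rewrite inE.
  have -> : cover [set` D'] (fun x => oball x (e x)) =
    [set y | exists2 x, x \in (D' : seq _) & oball x (e x) y].
    by apply/seteqP; split=> y [x xD xy]; exists x.
  elim: (D' : seq _) => [_|x l IH xlB].
    exists 0 => // r s r0 r1 _; case: s => [|x s /(_ x (mem_head _ _))[_ []//]].
    by rewrite mul0r.
  rewrite (_ : [set y | _] = oball x (e x) `|`
      [set y | exists2 x, x \in l & oball x (e x) y]); last first.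
    apply/seteqP; split=> y.
      move=> [z]; rewrite inE => /orP[/eqP -> zy|zl zy]; [by left|by right; exists z].
    by move=> [xy|[z zl zy]]; [exists x; rewrite ?mem_head|exists z; rewrite ?inE ?zl ?orbT].
  apply: locally_thinU; first by have [] := eP x (xlB x (mem_head _ _)).
  by apply: IH => z zl; apply: xlB; rewrite inE zl orbT.
by exists C => // r s r0 r1 ss sB; apply: HC => // x /sB[Bx _]; split => //; exact: BD.
Qed.

Lemma dot_base n (u v : 'rV[R]_n.+1) :
  dot u v = u ord0 ord_max * v ord0 ord_max + dot (base_rV u) (base_rV v).
Proof.
rewrite /dot (bigD1_ord ord_max)//=; congr (_ + _).
by apply: eq_bigr => i _; rewrite !mxE.
Qed.

Lemma rotation_dot n (Q : 'M[R]_n) (u v : 'rV[R]_n) : rotation Q ->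
  dot (u *m Q) (v *m Q) = dot u v.
Proof.
have dotE' (w z : 'rV[R]_n) : dot w z = (w *m z^T) ord0 ord0.
  by rewrite mxE; apply: eq_bigr => i _; rewrite mxE.
by move=> [QQ _]; rewrite !dotE' trmx_mul mulmxA -(mulmxA u) QQ mulmx1.
Qed.

Lemma base_rVB n (u v : 'rV[R]_n.+1) : base_rV (u - v) = base_rV u - base_rV v.
Proof. by apply/rowP => i; rewrite !mxE. Qed.

Lemma linear_l2norm_bound n (g : {linear 'rV[R]_n -> R}) :
  exists2 K, 0 <= K & forall h, `|g h| <= K * l2norm h.
Proof.
exists (\sum_i `|g (delta_mx 0 i)|); first exact: sumr_ge0.
move=> h; rewrite {1}(row_sum_delta h) linear_sum/=.
apply: le_trans (ler_norm_sum _ _ _) _; rewrite mulr_suml; apply: ler_sum => i _.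
by rewrite linearZ/= normrM mulrC ler_wpM2l// coord_le_l2norm.
Qed.

Lemma lipschitz_of_bounded_diff n (phi : 'rV[R]_n -> R) (z z' : 'rV[R]_n) (K : R) :
  (forall t, 0 <= t -> t <= 1 -> differentiable phi (z + t *: (z' - z)) /\
     `|'d phi (z + t *: (z' - z)) (z' - z)| <= K) ->
  `|phi z' - phi z| <= K.
Proof.
move=> H; pose g (t : R) := phi (z + t *: (z' - z)).
have gd (t : R) : 0 <= t -> t <= 1 -> is_derive t 1 g ('d phi (z + t *: (z' - z)) (z' - z)).
  move=> t0 t1; have [dphi _] := H t t0 t1.
  have E : (fun h : R => h^-1 *: ((g \o shift t) (h *: 1) - g t)) =
    (fun h => h^-1 *: ((phi \o shift (z + t *: (z' - z))) (h *: (z' - z)) - phi (z + t *: (z' - z)))).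
    apply/funext => h /=; congr (_ *: (phi _ - _)).
    by rewrite scalerDl [h *: 1]mulr1 addrCA.
  apply: DeriveDef; first by rewrite /derivable E; exact: diff_derivable.
  by rewrite /derive E -deriveE.
have gc : {within `[0, 1], continuous g}.
  apply: derivable_within_continuous => t; rewrite in_itv/= => /andP[t0 t1].
  by apply: ex_derive; exact: gd.
have [|c] := @MVT R g (fun t => 'd phi (z + t *: (z' - z)) (z' - z)) 0 1 ltr01 _ gc.
  by move=> t; rewrite in_itv/= => /andP[t0 t1]; apply: gd; exact: ltW.
rewrite in_itv/= => /andP[c0 c1]; rewrite /g scale1r scale0r addr0 subr0 mulr1 (_ : z + (z' - z) = z') => [->|]; last by rewrite addrC subrK.
by have [] := H c (ltW c0) (ltW c1).
Qed.

(** The differential is bounded at [b], and its Lipschitz continuity keeps it bounded by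
    [K0 + |L| e] on the ball. The ball is convex, so the mean value theorem applies along
    segments. *)
Lemma C11_locally_lipschitz n (V : set 'rV[R]_n) (phi : 'rV[R]_n -> R) (b : 'rV[R]_n) :
  open V -> C11_on V phi -> V b ->
  exists e K, [/\ 0 < e, 0 <= K & forall z z', cball b e z -> cball b e z' ->
    `|phi z' - phi z| <= K * l2norm (z' - z)].
Proof.
move=> oV [dphi [L HL]] Vb.
have /nbhs_cballP[e e0 eV] : nbhs b V by exact: open_nbhs_nbhs.
have [K0 K00 HK0] := linear_l2norm_bound ('d phi b).
exists e, (K0 + `|L| * e); split => //; first by rewrite addr_ge0// mulr_ge0// ltW.
move=> z z' bz bz'; apply: lipschitz_of_bounded_diff => t t0 t1.
have bt : cball b e (z + t *: (z' - z)).
  rewrite /cball/=; apply: le_trans (l2norm_segment _ _ _ t0 t1) _.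
  move: bz bz'; rewrite /cball/=; set a := l2norm _; set a' := l2norm _; nra.
split; first exact/dphi/eV.
rewrite -['d phi _ _](subrK ('d phi b (z' - z))).
apply: le_trans (ler_normD _ _) _; rewrite addrC mulrDl; apply: lerD; first exact: HK0.
apply: le_trans (HL _ _ _ (eV _ bt) Vb) _; rewrite ler_wpM2r ?l2norm_ge0//.
apply: (@le_trans _ _ (`|L| * l2norm (z + t *: (z' - z) - b))).
  by rewrite ler_wpM2r ?l2norm_ge0// ler_norm.
by rewrite ler_wpM2l.
Qed.

Lemma dispersed_map n m (f : 'rV[R]_n -> 'rV[R]_m) (r r' : R) (s : seq 'rV[R]_n) :
  (forall x y, x \in s -> y \in s -> r < l2norm (x - y) -> r' < l2norm (f x - f y)) ->
  dispersed r s -> dispersed r' (map f s).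
Proof.
move=> H; rewrite /dispersed pairwise_map; apply: sub_in_pairwise (allss s).
by move=> x y xs ys; exact: H.
Qed.

(** Here the dimension drops: projecting a graph of Lipschitz constant [K] to its base shrinks
    distances by a factor at most [K + 1], so dispersed points of the boundary become dispersed
    points of a ball in dimension [d]. *)
Lemma graph_locally_thin d (A : set 'rV[R]_d.+1) (x : 'rV[R]_d.+1) :
  boundary A x ->
  (exists (U : set 'rV[R]_d.+1) (Q : 'M[R]_d.+1)
             (V : set 'rV[R]_d) (phi : 'rV[R]_d -> R),
        [/\ nbhs x U, rotation Q, open V, C11_on V phi &
            (fun y => y *m Q) @` (boundary A `&` U) = graph_on V phi]) ->
  exists2 e, 0 < e & locally_thin (boundary A) (oball x e).
Proof.
move=> Ax [U [Q [V [phi [/nbhs_cballP[e1 e10 e1U] Qrot oV phiC graphE]]]]].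
pose b (y : 'rV[R]_d.+1) := base_rV (y *m Q).
have gr y : boundary A y -> cball x e1 y -> V (b y) /\ (y *m Q) ord0 ord_max = phi (b y).
  move=> Ay xy; have : ((fun y => y *m Q) @` (boundary A `&` U)) (y *m Q).
    by exists y => //; split => //; exact: e1U.
  by rewrite graphE.
have xx : cball x e1 x by rewrite /cball/= subrr l2norm0 ltW.
have [e [K [e0 K0 HK]]] := C11_locally_lipschitz oV phiC (gr x Ax xx).1.
have bB y y' : b y - b y' = base_rV ((y - y') *m Q) by rewrite mulmxBl base_rVB.
have ble y y' : l2norm (b y - b y') <= l2norm (y - y').
  rewrite l2norm_le_sqr ?l2norm_ge0// sqr_l2norm bB -(rotation_dot _ _ Qrot) dot_base lerDr.
  by rewrite -expr2 sqr_ge0.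
pose f := Num.min e e1.
have f0 : 0 < f by rewrite lt_min e0.
have K1 : 0 < K + 1 by rewrite ltr_wpDl.
exists f => //; exists ((2 * f * (K + 1) + 1) ^+ d).
  by rewrite exprn_ge0// addr_ge0// !mulr_ge0// ltW.
move=> r s r0 r1 ss sA.
have r'0 : 0 < r / (K + 1) by rewrite divr_gt0.
have sin y : y \in s -> [/\ boundary A y, cball x e1 y & cball (b x) e (b y)].
  move=> /sA[Ay]; rewrite /oball/cball/= => /ltW xy; split => //.
    by apply: le_trans xy _; rewrite ge_min lexx orbT.
  by apply: le_trans (ble _ _) (le_trans xy _); rewrite ge_min lexx.
have ss' : dispersed (r / (K + 1)) (map b s).
  apply: dispersed_map ss => y y' /sin[Ay xy by_] /sin[Ay' xy' by_'] yy'.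
  rewrite ltr_pdivrMr//; apply: lt_le_trans yy' _.
  rewrite l2norm_le_sqr ?mulr_ge0 ?l2norm_ge0 ?(ltW K1)//.
  rewrite -(rotation_dot _ _ Qrot) dot_base -bB -sqr_l2norm exprMn.
  have := HK _ _ by_' by_; rewrite -(gr y Ay xy).2 -(gr y' Ay' xy').2.
  have -> : ((y - y') *m Q) ord0 ord_max = (y *m Q) ord0 ord_max - (y' *m Q) ord0 ord_max.
    by rewrite mulmxBl [LHS]mxE [X in _ + X]mxE.
  rewrite -expr2.
  move: (_ - _) (l2norm _) (l2norm_ge0 (b y - b y')) => a l l0.
  rewrite -ler_sqr ?nnegrE ?mulr_ge0// real_normK ?num_real// => aKl.
  have : 0 <= K * l ^+ 2 by rewrite mulr_ge0// sqr_ge0.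
  move: aKl; rewrite exprMn; nra.
have := @packing_cball _ _ _ f (b x) _ r'0 (ltW f0) ss' _; rewrite size_map => H.
apply: le_trans (H _) _.
  move=> _ /mapP[y /sA[_ xy] ->]; exact: le_trans (ble _ _) (ltW xy).
rewrite -exprMn; apply: lerXn2r; rewrite ?nnegrE.
- apply: divr_ge0; last exact: ltW.
  by apply: addr_ge0; [rewrite mulr_ge0// ltW|exact: ltW].
- apply: divr_ge0; last exact: ltW.
  by apply: addr_ge0 => //; rewrite !mulr_ge0// ltW.
rewrite (_ : (2 * f + r / (K + 1)) / (r / (K + 1)) = (2 * f * (K + 1) + r) * r^-1); last first.
  by field; rewrite !gt_eqF.
by rewrite ler_wpM2r ?invr_ge0 ?(ltW r0)// lerD2l ltW.
Qed.

Definition itv_endpoints (I : interval R) : seq R :=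
  let ep b := if b is BSide _ t then [:: t] else [::] in
  let: Interval b1 b2 := I in ep b1 ++ ep b2.

Lemma near_side (t a : R) : a != t ->
  exists2 e, 0 < e & forall b, `|b - a| <= e -> ((b < t) = (a < t)) /\ ((b <= t) = (a <= t)).
Proof.
move=> at_; exists (`|a - t| / 2); first by rewrite divr_gt0// normr_gt0 subr_eq0.
move=> b; rewrite ler_norml; move: at_; rewrite neq_lt => /orP[lt|gt].
  rewrite (ltW lt) lt ltr0_norm ?subr_lt0// => /andP[h1 h2].
  by split; [apply/idP|apply/idP]; lra.
rewrite (lt_gtF gt) (lt_geF gt) gtr0_norm ?subr_gt0// => /andP[h1 h2].
by split; apply/negbTE; rewrite -?leNgt -?ltNge; lra.
Qed.

Lemma near_itv (I : interval R) a : a \notin itv_endpoints I ->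
  exists2 e, 0 < e & forall b, `|b - a| <= e -> (b \in I) = (a \in I).
Proof.
have bnd (b : itv_bound R) : a \notin (if b is BSide _ t then [:: t] else [::]) ->
    exists2 e, 0 < e & forall c, `|c - a| <= e ->
      (b <= BLeft c)%O = (b <= BLeft a)%O /\ (BRight c <= b)%O = (BRight a <= b)%O.
  case: b => [b t|b]; last by move=> _; exists 1.
  rewrite inE => /near_side[e e0 H]; exists e => // c /H[h1 h2].
  case: b; rewrite !bnd_simp; split;
    by [rewrite h1|rewrite h2|rewrite !leNgt h1|rewrite !ltNge h2].
case: I => b1 b2; rewrite /itv_endpoints/= mem_cat negb_or => /andP[/bnd[e1 e10 H1] /bnd[e2 e20 H2]].
exists (Num.min e1 e2); first by rewrite lt_min e10.
move=> b; rewrite le_min => /andP[/H1[h1 _] /H2[_ h2]].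
by rewrite !itv_boundlr; move: h1 h2; rewrite /= => -> ->.
Qed.

Lemma near_itvs (s : seq (interval R)) a :
  (forall I, I \in s -> a \notin itv_endpoints I) ->
  exists2 e, 0 < e & forall b, `|b - a| <= e -> forall I, I \in s -> (b \in I) = (a \in I).
Proof.
elim: s => [_|I s IH H]; first by exists 1.
have [e1 e10 H1] := near_itv (H I (mem_head _ _)).
have [|e2 e20 H2] := IH; first by move=> J Js; apply: H; rewrite inE Js orbT.
exists (Num.min e1 e2); first by rewrite lt_min e10.
move=> b; rewrite le_min => /andP[b1 b2] J; rewrite inE => /orP[/eqP ->|Js].
  exact: H1.
exact: H2.
Qed.

(** Away from all endpoints, membership in each of the intervals is locally constant, so the point
    is interior to [A] or to its complement. *)
Lemma boundary_intervals (A : set 'rV[R]_1) (s : seq (interval R)) x :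
  A = [set x | exists2 I, I \in s & x ord0 ord0 \in I] ->
  boundary A x -> x ord0 ord0 \in flatten (map itv_endpoints s).
Proof.
move=> AE [xcl xint]; apply: contrapT => /negP xs.
have [|e e0 He] := @near_itvs s (x ord0 ord0).
  by move=> I Is; apply: contra xs => xI; apply/flattenP; exists (itv_endpoints I) => //; apply: map_f.
have coord y : cball x e y -> `|y ord0 ord0 - x ord0 ord0| <= e.
  by move=> xy; apply: le_trans xy; have := coord_le_l2norm (y - x) ord0; rewrite !mxE.
have [|z [Az xz]] := xcl (cball x e); first by apply/nbhs_cballP; exists e.
move: Az; rewrite AE => -[I Is zI]; apply: xint; apply/nbhs_cballP; exists e => // y /coord xy.
rewrite AE; exists I => //; rewrite (He _ xy)//.
by rewrite -(He _ (coord _ xz) _ Is).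
Qed.

Lemma C11_thin_boundary d (A : set 'rV[R]_d.+1) : compact A -> C11_boundary A ->
  thin_boundary A.
Proof.
move=> Ac; have Acl := closed_compact_rV Ac.
have clA : closure A `<=` A by [].
have bc : compact (boundary A).
  apply: (subclosed_compact _ Ac); last by move=> x [/clA].
  rewrite /boundary (_ : closure A `\` A° = closure A `&` ~` A°)//.
  apply: closedI; first exact: closed_closure.
  by apply: open_closedC; exact: open_interior.
case: d A Ac Acl clA bc => [|d] A Ac Acl clA bc; rewrite /C11_boundary/=; last first.
  move=> charts.
  have [C C0 HC] : locally_thin (boundary A) (boundary A).
    by apply: locally_thin_compact bc _ => x Ax; apply: graph_locally_thin (charts x Ax).
  by apply: (thin_boundary_of_dispersed Acl C0) => r s r0 r1 ss sA; apply: HC => // x /sA.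
move=> [s AE].
apply: (@thin_boundary_of_dispersed _ _ _ (size (flatten (map itv_endpoints s)))%:R) => //.
move=> r l r0 r1 ll lA; rewrite expr0 mulr1 ler_nat.
rewrite -(size_map (fun x : 'rV[R]_1 => x ord0 ord0)); apply: uniq_leq_size.
  rewrite map_inj_uniq; last by move=> x y xy; apply/rowP => i; rewrite (ord1 i).
  apply/(uniqP 0) => i j il jl ij; apply: contrapT => /eqP ij'.
  have := dispersed_nth ll il jl ij'; rewrite ij subrr l2norm0.
  by rewrite ltNge ltW.
by move=> _ /mapP[x /lA xA ->]; apply: boundary_intervals xA.
Qed.

End c11.

(** * Measurability *)

Section measurability.
Context {R : realType}.

Lemma rat_dense_rV n (y : 'rV[R]_n) (e : R) : 0 < e ->
  exists q : 'rV[rat]_n, l2norm (map_mx ratr q - y) <= e.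
Proof.
move=> e0; have e10 : 0 < e / n.+1%:R by rewrite divr_gt0.
have /choice[q qP] : forall i, exists q : rat, `|ratr q - y ord0 i| <= e / n.+1%:R.
  move=> i; have [|q /[!in_itv] /andP[q1 q2]] :=
      @rat_in_itvoo R (y ord0 i) (y ord0 i + e / n.+1%:R); first by rewrite ltrDl.
  exists q; rewrite ger0_norm ?subr_ge0 ?ltW//.
  by rewrite ltrBlDl.
exists (\row_i q i); apply: le_trans (l2norm_le_sum _) _.
apply: (@le_trans _ _ (\sum_(i < n) e / n.+1%:R)).
  by apply: ler_sum => i _; rewrite !mxE; exact: qP.
rewrite sumr_const card_ord -[_ *+ n]mulr_natr mulrAC ler_pdivrMr// ler_wpM2l ?(ltW e0)//.
by rewrite ler_nat.
Qed.

Lemma measurable_coord n (i : 'I_n) :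
  measurable_fun setT (fun v : borel_rV R n => (v : 'rV[R]_n) ord0 i : measurableTypeR R).
Proof.
apply: (@measurability _ _ (borel_rV R n) (measurableTypeR R) _ _ _
  (measurable_realfun.RGenOInfty.measurableE R)).
move=> _ [_ [a ->] <-]; rewrite setTI; apply: sub_sigma_algebra.
apply: (@open_comp 'rV[R]_n R) => [v _|]; first exact: coord_continuous.
exact: interval_open.
Qed.

Context {disp} {S : measurableType disp}.

Lemma measurable_rV_coord n (g : S -> 'rV[R]_n) :
  (forall i, measurable_fun setT (fun w => g w ord0 i : measurableTypeR R)) ->
  measurable_fun setT (g : S -> borel_rV R n).
Proof.
elim: n g => [|n IH] g mg.
  rewrite (_ : g = cst 0); first exact: measurable_cst.
  by apply/funext => w; exact: rV0_all.
rewrite (_ : g = (fun w => cons_rV (g w ord0 ord0, \row_i g w ord0 (lift ord0 i)))).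
  apply: (measurableT_comp (@measurable_cons_rV R n)).
  apply/measurable_fun_pairP; split; first exact: mg.
  apply: IH => i; rewrite (_ : (fun _ => _) = fun w => g w ord0 (lift ord0 i)); first exact: mg.
  by apply/funext => w; rewrite mxE.
apply/funext => w; apply/rowP => i.
by have [k ->|->] := unliftP ord0 i; rewrite ?cons_rV0 ?cons_rVS//= mxE.
Qed.

Lemma measurable_coord_comp n (g : S -> 'rV[R]_n) i :
  measurable_fun setT (g : S -> borel_rV R n) ->
  measurable_fun setT (fun w => g w ord0 i : measurableTypeR R).
Proof. move=> mg; exact: (measurableT_comp (@measurable_coord n i) mg). Qed.

Lemma measurable_dilation n (g h : S -> 'rV[R]_n) (a : R) :
  measurable_fun setT (g : S -> borel_rV R n) ->
  measurable_fun setT (h : S -> borel_rV R n) ->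
  measurable_fun setT (fun w => g w + a *: (h w - g w) : borel_rV R n).
Proof.
move=> mg mh; apply: measurable_rV_coord => i.
rewrite (_ : (fun _ => _) = fun w => g w ord0 i + a * (h w ord0 i - g w ord0 i)); last first.
  by apply/funext => w; rewrite !mxE.
apply: measurable_funD; first exact: measurable_coord_comp.
apply: measurable_funM => //; apply: measurable_funB; exact: measurable_coord_comp.
Qed.

Lemma measurable_preimage n (g : S -> 'rV[R]_n) (D : set (borel_rV R n)) :
  measurable_fun setT (g : S -> borel_rV R n) -> measurable D ->
  measurable [set w | D (g w)].
Proof. by move=> mg mD; have := mg measurableT D mD; rewrite setTI. Qed.

Lemma measurable_bool_set (p : S -> bool) : measurable_fun setT p ->
  measurable [set w | p w].
Proof. by move=> mp; have := mp measurableT [set true] I; rewrite setTI. Qed.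

Lemma measurable_eq_rV n (g h : S -> 'rV[R]_n) :
  measurable_fun setT (g : S -> borel_rV R n) ->
  measurable_fun setT (h : S -> borel_rV R n) ->
  measurable [set w | g w = h w].
Proof.
move=> mg mh; rewrite (_ : [set w | _] =
    \bigcap_(i in [set: 'I_n]) [set w | g w ord0 i == h w ord0 i]); last first.
  apply/seteqP; split=> [w /= gh i _|w gh /=]; first by rewrite /= gh.
  by apply/rowP => i; apply/eqP; exact: gh.
apply: fin_bigcap_measurable => // i _; apply: measurable_bool_set.
apply: measurable_realfun.measurable_fun_eqr; exact: measurable_coord_comp.
Qed.

Lemma measurable_lt_set (g h : S -> R) : measurable_fun setT g -> measurable_fun setT h ->
  measurable [set w | g w < h w].
Proof. by move=> mg mh; apply: measurable_bool_set; exact: measurable_fun_ltr. Qed.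

Lemma measurable_fun_R_lt (g : S -> R) :
  (forall r, measurable [set w | g w < r]) -> measurable_fun setT g.
Proof.
move=> H; apply: (@measurability _ _ _ (measurableTypeR R) _ _ _
  (measurable_realfun.RGenInftyO.measurableE R)).
move=> _ [_ [a ->] <-]; rewrite setTI (_ : _ @^-1` _ = [set w | g w < a]) //.
Qed.

Lemma measurable_fun_R_gt (g : S -> R) :
  (forall r, measurable [set w | r < g w]) -> measurable_fun setT g.
Proof.
move=> H; apply: (@measurability _ _ _ (measurableTypeR R) _ _ _
  (measurable_realfun.RGenOInfty.measurableE R)).
move=> _ [_ [a ->] <-]; rewrite setTI (_ : _ @^-1` _ = [set w | a < g w]) //.
by apply/seteqP; split=> w /=; rewrite in_itv /= andbT.
Qed.

Lemma measurable_forall_seq (I : seq nat) (Q : nat -> set S) :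
  (forall i, i \in I -> measurable (Q i)) -> measurable [set w | forall i, i \in I -> Q i w].
Proof.
move=> mQ; rewrite (_ : [set w | _] = \bigcap_(i in [set` I]) Q i).
  by apply: fin_bigcap_measurable => [|i iI]; [exact: finite_seq|exact: mQ].
by apply/seteqP; split=> w.
Qed.

Lemma exists_natV (r s : R) : s < r -> exists m : nat, s + m.+1%:R^-1 < r.
Proof.
rewrite -subr_gt0 => rs; exists (Num.trunc (r - s)^-1).
rewrite -ltrBrDl invf_plt ?posrE//; exact: truncnS_gt.
Qed.

Section sample.
Context {d : nat} (x : S -> nat -> 'rV[R]_d).
Hypothesis mx : forall j, measurable_fun setT (fun w => x w j : borel_rV R d).

(** The event that the radius is below [r] is a countable union over rational centres: an enclosing
    ball of smaller radius leaves room to move its centre. *)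
Lemma measurable_encl (I : seq nat) : measurable_fun setT (fun w => encl (x w) I).
Proof.
case: I => [|i0 I].
  rewrite (_ : (fun _ => _) = cst (encl (fun=> 0 : 'rV[R]_d) [::])); first exact: measurable_cst.
  apply/funext => w; congr inf; apply/seteqP.
  by split=> r [y _]; exists y => j; rewrite in_nil.
move: (i0 :: I) (mem_head i0 I) => {}I i0I.
apply: measurable_fun_R_lt => r.
rewrite (_ : [set w | _] = \bigcup_(p : 'rV[rat]_d * nat)
    [set w | forall i, i \in I -> l2norm (x w i - map_mx ratr p.1) <= r - p.2.+1%:R^-1]).
  apply: countable_bigcupT_measurable => [|p]; first exact: countableP.
  apply: (@measurable_forall_seq I (fun i => [set w | l2norm (x w i - map_mx ratr p.1) <= _])) => i _.
  by apply: (measurable_preimage (mx i) (measurable_cball _ _)).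
apply/seteqP; split=> w /=.
  move=> /[dup] /exists_natV[m0 h1] _; have /exists_natV[m h2] := h1.
  have [y ye] : exists y, enclosed (x w) I (r - m0.+1%:R^-1) y.
    by apply: (encl_lt i0I); rewrite ltrBrDr.
  have [q qy] : exists q : 'rV[rat]_d, l2norm (map_mx ratr q - y) <= m0.+1%:R^-1 / 2.
    by apply: rat_dense_rV; rewrite divr_gt0.
  have [m' hm'] : exists m' : nat, 0 + m'.+1%:R^-1 < (m0.+1%:R^-1 : R) / 2.
    by apply: exists_natV; rewrite divr_gt0.
  exists (q, m') => // i iI /=; apply: le_trans (l2norm_triangle _ y _) _.
  rewrite (l2normC y); have := ye i iI; move: qy hm'; rewrite add0r.
  move: (m0.+1%:R^-1) (m'.+1%:R^-1) => u v; set a := l2norm _; set b := l2norm _; lra.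
move=> [[q m] _ /= H]; apply: (@le_lt_trans _ _ (r - m.+1%:R^-1)).
  by apply: (encl_le (y := map_mx ratr q) i0I) => i /H.
by rewrite gtrBl invr_gt0.
Qed.

Lemma measurable_npoints n (D : set (borel_rV R d)) : measurable D ->
  forall j, measurable [set w | npoints (x w) n D = j].
Proof.
move=> mD; elim: n => [|n IH] j.
  rewrite (_ : [set w | _] = if 0%N == j then setT else set0); first by case: ifP.
  by case: ifPn => [/eqP <-|j0]; apply/seteqP; split=> w //= /eqP; rewrite (negbTE j0).
pose E := [set w | (x w n \notin mkseq (x w) n) && (x w n \in D)].
have mE : measurable E.
  rewrite (_ : E = [set w | D (x w n)] `&` [set w | forall i, i \in iota 0 n ->
      (~` [set w | x w i = x w n]) w]).
    apply: measurableI; first exact: (measurable_preimage (mx n)).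
    by apply: measurable_forall_seq => i _; apply: measurableC; exact: measurable_eq_rV.
  apply/seteqP; split=> w /=.
    move=> /andP[/negP xn /set_mem Dx]; split=> // i iI xi; apply: xn.
    by apply/mapP; exists i.
  move=> [Dx H]; apply/andP; split; last exact/mem_set; apply/negP => /mapP[i /H xi xn].
  exact: xi.
rewrite (_ : [set w | _] = ([set w | npoints (x w) n D = j] `&` ~` E) `|`
    ((if j is j'.+1 then [set w | npoints (x w) n D = j'] else set0) `&` E)).
  apply: measurableU; apply: measurableI => //; first exact: measurableC.
  by case: j => [|j].
apply/seteqP; split=> w /=; rewrite npointsS /E /=; case: (_ && _).
- by rewrite addn1 => <-; right.
- by rewrite addn0 => <-; left.
- by case=> -[//]; case: j => // j /= -> _; rewrite addn1.
- by case=> -[] // -> _; rewrite addn0.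
Qed.

Lemma measurable_npoints_lt n (D : set (borel_rV R d)) k : measurable D ->
  measurable [set w | (npoints (x w) n D < k)%N].
Proof.
move=> mD; rewrite (_ : [set w | _] = \bigcup_(j < k) [set w | npoints (x w) n D = j]).
  by apply: bigcup_measurable => j _; exact: measurable_npoints.
apply/seteqP; split=> w /=; first by move=> wk; exists (npoints (x w) n D).
by move=> [j jk /= ->].
Qed.

End sample.

(** For [s >= 0] the radius exceeds [s] iff some ball in [A] of radius above [s] holds fewer than
    [k] points; shrinking it slightly makes its centre and radius rational, which leaves countably
    many balls. *)
Lemma measurable_spacing_radius {d : nat} (A : set 'rV[R]_d.+1) (k n : nat)
    (x : S -> nat -> 'rV[R]_d.+1) : compact A ->
  (forall j, measurable_fun setT (fun w => x w j : borel_rV R d.+1)) ->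
  measurable_fun setT (fun w => spacing_radius A (x w) k n).
Proof.
move=> Ac mx; apply: measurable_fun_R_gt => s.
pose H (p : 'rV[rat]_d.+1 * rat) : set S :=
  if pselect (s < ratr p.2 /\ 0 < ratr p.2 :> R /\ cball (map_mx ratr p.1) (ratr p.2 : R) `<=` A) then
  [set w | (npoints (x w) n (cball (map_mx ratr p.1) (ratr p.2)) < k)%N] else set0.
have [s0|s0] := ltP s 0.
  rewrite (_ : [set w | _] = setT)//; apply/seteqP; split=> // w _ /=.
  by apply: lt_le_trans s0 _; exact: spacing_radius_ge0.
rewrite (_ : [set w | _] = \bigcup_p H p).
  apply: countable_bigcupT_measurable => [|p]; first exact: countableP.
  rewrite /H; case: pselect => /= [_|_]; last exact: measurable0.
  apply: measurable_npoints_lt => //.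
  exact: measurable_cball.
apply/seteqP; split=> w /=; last first.
  move=> [[q r] _]; rewrite /H; case: pselect => //= -[sr [r0 qA]] qk.
  by apply: lt_le_trans sr _; apply: (hole_le Ac _ qA qk); exact: ltW.
move=> sR; set r := spacing_radius _ _ _ _ in sR.
pose s' := (s + r) / 2.
have [y [yA yk]] : exists y, cball y s' `<=` A /\ (npoints (x w) n (cball y s') < k)%N.
  apply: contrapT => Hn.
  have : spacing_set A k (x w) n s'.
    split=> [|y [Ay yA]]; first by rewrite /s'; move: sR s0; lra.
    by rewrite leqNgt; apply/negP => yk; apply: Hn; exists y.
  by move=> /(spacing_radius_le Ac); rewrite -/r /s'; move: sR; lra.
have e0 : 0 < (s' - s) / 2 by rewrite /s'; move: sR; lra.
have [q qy] := rat_dense_rV y e0.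
have [|t /[!in_itv]/= /andP[t1 t2]] := @rat_in_itvoo R s (s' - (s' - s) / 2).
  by move: e0; lra.
have sub : cball (map_mx ratr q) (ratr t : R) `<=` cball y s'.
  by apply: cball_sub; move: qy t2; set a := l2norm _; lra.
exists (q, t) => //; rewrite /H /=; case: pselect => /= [_|[]].
  by apply: leq_ltn_trans yk; exact: le_npoints.
split=> //; split; first exact: le_lt_trans t1.
exact: subset_trans yA.
Qed.

End measurability.

(** * Independence *)

Section freezing.
Context {disp} {T : measurableType disp} {R : realType} (P : probability T R).
Context {d : nat} (X : nat -> {RV P >-> borel_rV R d}).
Hypothesis X_indep : mutually_independent X.

Definition cylinders (i : nat) : set (set T) :=
  [set E | exists (J : {fset nat}) (B : nat -> set (borel_rV R d)),
    [/\ i \notin J, forall j, measurable (B j) &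
        E = \bigcap_(j in [set` J]) (X j @^-1` B j)]].

(* [T] under an alias, so that its sub-sigma-algebra generated by the [X j],
   [j != i], can be a factor of a product space. *)
Definition others (i : nat) := g_sigma_algebraType (cylinders i).

Lemma measurable_cylinder i : cylinders i `<=` measurable.
Proof.
move=> _ [J [B [_ mB ->]]]; apply: fin_bigcap_measurable => [|j _].
  exact: finite_fset.
by rewrite -[X in measurable X]setTI; apply: measurable_funPT.
Qed.

Lemma measurable_others i (E : set (others i)) : measurable E ->
  measurable (E : set T).
Proof.
move=> mE; suff : <<s cylinders i >> `<=` (measurable : set (set T)) by apply.
by apply: smallest_sub; [exact: sigma_algebra_measurable|exact: measurable_cylinder].
Qed.

Lemma measurable_others_id i : measurable_fun setT (idfun : T -> others i).
Proof. by move=> _ Y mY; rewrite setTI; apply: (@measurable_others i). Qed.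

Lemma measurable_others_RV i j : j != i ->
  measurable_fun setT (X j : others i -> borel_rV R d).
Proof.
move=> ji _ Y mY; rewrite setTI; apply: sub_sigma_algebra.
exists [fset j]%fset, (fun=> Y); split => //; first by rewrite inE eq_sym.
by rewrite set_fset1 bigcap_set1.
Qed.

Lemma setI_closed_cylinders i : setI_closed (cylinders i).
Proof.
move=> _ _ [J [B [iJ mB ->]]] [K [C [iK mC ->]]].
exists (J `|` K)%fset, (fun j => (if j \in J then B j else setT) `&` (if j \in K then C j else setT)).
split; first by rewrite inE negb_or iJ.
  by move=> j; apply: measurableI; case: ifP.
apply/seteqP; split=> w /=.
  move=> [wJ wK] j /=; rewrite inE => jJK; split; case: ifPn => // jin; [exact: wJ|exact: wK].
move=> H; split=> j /= jin.
  by have := H j; rewrite /= !inE jin => /(_ isT)[].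
by have := H j; rewrite /= !inE jin orbT => /(_ isT)[_].
Qed.

(** Both sides are finite measures in [E]. They agree on the cylinders by independence over [J] with
    [i] adjoined, and the cylinders are stable under intersection. *)
Lemma others_indep i (E : set (others i)) (B : set (borel_rV R d)) :
  measurable E -> measurable B ->
  P (E `&` X i @^-1` B) = (P E * P (X i @^-1` B))%E.
Proof.
move=> mE mB.
have mY : measurable (X i @^-1` B).
  by rewrite -[X in measurable X]setTI; apply: measurable_funPT.
have PY0 : 0 <= fine (P (X i @^-1` B)) by rewrite fine_ge0.
pose m1 := pushm (mrestr P mY) (@measurable_others_id i).
pose m2 := mscale (NngNum PY0) (pushm P (@measurable_others_id i)).
have : m1 E = m2 E.
  apply: (@measure_unique _ _ (g_sigma_algebraType (cylinders i)) (cylinders i) (fun=> setT) _ _ _ _ m1 m2) => //.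
  - exact: setI_closed_cylinders.
  - move=> _; exists fset0, (fun=> setT); split => //.
    by rewrite set_fset0 bigcap_set0.
  - by rewrite bigcup_const//; exists 0%N.
  - move=> _ [J [C [iJ mC ->]]].
    rewrite -[LHS]/(P (_ `&` _)) -[RHS]/((_%:E * P _)%E)/= fineK ?fin_num_measure//.
    rewrite X_indep//.
    pose D j := if j == i then B else C j.
    have mD j : measurable (D j) by rewrite /D; case: ifP.
    have Di : D i = B by rewrite /D eqxx.
    have DC j : j \in J -> D j = C j.
      by move=> jJ; rewrite /D ifN//; apply: contraNneq iJ => <-.
    have := X_indep (i |` J)%fset mD.
    rewrite big_fsetU1//= Di => E1.
    transitivity (P (\bigcap_(j in [set` (i |` J)%fset]) X j @^-1` D j)).
      congr (P _); apply/seteqP; split=> w /=.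
        move=> [wC wB] j /=; rewrite !inE => /orP[/eqP ->|jJ]; first by rewrite Di.
        by rewrite DC//; exact: wC.
      move=> H; split=> [j /= jJ|]; last by have := H i; rewrite /= Di !inE eqxx; exact.
      by have := H j; rewrite /= DC// !inE jJ orbT; exact.
    rewrite E1; congr (_ * _)%E; apply: eq_big_seq => j jJ; by rewrite DC.
  - move=> _; rewrite -[ltLHS]/(P (_ `&` _)).
    by rewrite preimage_setT setTI (le_lt_trans (probability_le1 _ mY)) ?ltry.
rewrite -[LHS]/(P (_ `&` _)) -[RHS]/((_%:E * P _)%E)/= fineK ?fin_num_measure//.
by rewrite muleC.
Qed.

Lemma measurable_pair_others i :
  measurable_fun setT (fun w => (w, X i w) : others i * borel_rV R d).
Proof.
apply/measurable_fun_pairP; split; first exact: measurable_others_id.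
exact: measurable_funPT.
Qed.

Definition law i : probability (borel_rV R d) R := distribution P (X i).

Definition Pothers i : set (others i) -> \bar R := pushm P (@measurable_others_id i).
Arguments Pothers i A : clear implicits.

HB.instance Definition _ i := Measure.copy (Pothers i) (pushm P (@measurable_others_id i)).

Lemma Pothers_sigma_finite i : sigma_finite setT (Pothers i).
Proof.
exists (fun=> setT); first by rewrite bigcup_const//; exists 0%N.
by move=> _; split => //; rewrite -[ltLHS]/(P setT) probability_setT ltry.
Qed.

HB.instance Definition _ i := @Measure_isSigmaFinite.Build _ _ _ (Pothers i)
  (Pothers_sigma_finite i).

Lemma pair_law i (E : set (others i * borel_rV R d)) : measurable E ->
  (Pothers i \x law i)%E E = P [set w | E (w, X i w)].
Proof.
move=> mE.
rewrite (@product_measure_unique _ _ _ _ _ (Pothers i) (law i)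
  (pushm P (@measurable_pair_others i)) _ E mE)//.
move=> A B mA mB; rewrite -[LHS]/(P (_ `&` _)) -[RHS]/(P _ * P _)%E.
exact: others_indep.
Qed.

(** Tonelli for the joint law of [X i] and the other points, which is a product; it stands in for
    conditioning on all points but [X i]. *)
Lemma freezing i (F : others i * borel_rV R d -> \bar R) :
  measurable_fun setT F -> (forall z, 0 <= F z)%E ->
  (\int[P]_w F (w, X i w) = \int[P]_w \int[law i]_y F (w, y))%E.
Proof.
move=> mF F0.
transitivity (\int[Pothers i \x law i]_z F z)%E.
  rewrite (eq_measure_integral (pushm P (@measurable_pair_others i))); last first.
    by move=> E mE _; exact: pair_law.
  apply/esym; rewrite /pushm.
  have := @ge0_integral_pushforward _ _ _ _ _ _ (@measurable_pair_others i) P setT F measurableT mF.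
  by move=> ->.
rewrite fubini_tonelli1// /Pothers ge0_integral_pushforward//.
- exact: measurable_others_id.
- exact: (measurable_fun_fubini_tonelli_F _ mF).
- by move=> w _; apply: integral_ge0 => y _; exact: F0.
Qed.

Lemma freezing_null i (E : set (others i * borel_rV R d)) : measurable E ->
  (forall w, law i [set y | E (w, y)] = 0%E) -> P [set w | E (w, X i w)] = 0%E.
Proof.
move=> mE E0; rewrite -pair_law// /product_measure1 integral0_eq// => w _ /=.
by rewrite -[RHS](E0 w); congr (law i _); apply/seteqP; split=> y; rewrite /xsection/= ?inE.
Qed.

End freezing.

Lemma ae_forall_count {disp} {T : measurableType disp} {R : realType}
    (P : {measure set T -> \bar R}) (I : countType) (Q : I -> T -> Prop) :
  (forall i, {ae P, forall w, Q i w}) -> {ae P, forall w, forall i, Q i w}.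
Proof.
move=> H.
have : forall n, {ae P, forall w, match @choice.unpickle I n with Some i => Q i w | None => True end}.
  by move=> n; case: (@choice.unpickle I n) => [i|]; [exact: H|exact: aeW].
by move=> /ae_foralln; apply: filterS => w Hw i; have := Hw (choice.pickle i); rewrite choice.pickleK.
Qed.

(** * Ties have probability zero *)

Section almost_surely_generic.
Context {disp} {T : measurableType disp} {R : realType} (P : probability T R).
Context {d : nat} (X : nat -> {RV P >-> borel_rV R d.+1}) (f : 'rV[R]_d.+1 -> R).
Hypotheses (X_indep : mutually_independent X) (X_density : forall i, has_density (X i) f).

Lemma law_null i (B : set (borel_rV R d.+1)) : measurable B ->
  lebesgue_measure_rV d.+1 B = 0%E -> law X i B = 0%E.
Proof.
move=> mB B0; have [mf f0 fE] := X_density i.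
rewrite -[LHS]/(distribution P (X i) B) fE// null_set_integral//; apply: measurable_funTS.
exact: measurableT_comp.
Qed.

Lemma measurable_upd i j :
  measurable_fun setT (fun z : others X i * borel_rV R d.+1 =>
    upd (fun j => X j z.1) i z.2 j : borel_rV R d.+1).
Proof.
have [->|ji] := eqVneq j i.
  rewrite (_ : (fun _ => _) = snd); first exact: measurable_snd.
  by apply/funext => z; rewrite upd_eq.
rewrite (_ : (fun _ => _) = (fun z : others X i * borel_rV R d.+1 => X j z.1)); last first.
  by apply/funext => z; rewrite upd_neq.
apply: (measurableT_comp (@measurable_others_RV _ _ _ P _ X i j ji)); exact: measurable_fst.
Qed.

Lemma upd_id (w : T) i : upd (fun j => X j w) i (X i w) = (fun j => X j w).
Proof. by apply/funext => j; rewrite /upd; case: eqP => // ->. Qed.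

Lemma eq_encl (x x' : nat -> 'rV[R]_d.+1) (I : seq nat) :
  (forall i, i \in I -> x i = x' i) -> encl x I = encl x' I.
Proof.
move=> xx; congr inf; apply/seteqP.
by split=> r [y ye]; exists y => i iI; have := ye i iI; rewrite xx.
Qed.

Lemma ae_neq i j : i != j -> {ae P, forall w, X i w != X j w}.
Proof.
move=> ij; pose E := [set z : others X i * borel_rV R d.+1 | (z.2 : 'rV[R]_d.+1) = X j z.1].
have mE : measurable E.
  apply: (@measurable_eq_rV R _ (others X i * borel_rV R d.+1)%type d.+1 snd (fun z => X j z.1)).
    exact: measurable_snd.
  have ji : j != i by rewrite eq_sym.
  apply: (measurableT_comp (@measurable_others_RV _ _ _ P _ X i j ji)); exact: measurable_fst.
have := freezing_null X_indep mE; rewrite /E /= => H.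
exists [set w | X i w = X j w]; split.
- by apply: measurable_eq_rV; exact: measurable_funPT.
- apply: H => w; apply: law_null.
    by have := measurable_xsection w mE; rewrite /xsection/= (_ : mkset _ = [set y | y = X j w])//;
      apply/seteqP; split => y /=; rewrite ?inE.
  exact: lebesgue_measure_rV1.
- by move=> w /= /negP; rewrite negbK => /eqP.
Qed.

(** Let [1 + 1/(m+1) < l]. The stretched point lies between [x i0] and the dilate, so a ball
    enclosing the dilated configuration encloses the stretched one. By the second tie its radius is
    [encl] of [J], which the first tie forbids. *)
Lemma tie_dilation (x : nat -> 'rV[R]_d.+1) (I J : seq nat) (i i0 : nat) p (l : R) :
  i0 \in I -> i \notin I -> i \notin J -> tie (upd x i p) I J i i0 -> 1 < l ->
  ~ tie (upd x i (x i0 + l *: (p - x i0))) I J i i0.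
Proof.
move=> i0I iI iJ [t1 t2] l1 [t3 t4].
have i0i : i0 != i by apply: contraNneq iI => <-.
have nI (a b : 'rV[R]_d.+1) j : j \in I -> upd x i a j = upd x i b j.
  by move=> jI; rewrite !upd_neq//; apply: contraNneq iI => <-.
have EJ (a b : 'rV[R]_d.+1) : encl (upd x i a) J = encl (upd x i b) J.
  by apply: eq_encl => j jJ; rewrite !upd_neq//; apply: contraNneq iJ => <-.
have [m hm] := @exists_natV R l 1 l1.
have iiI : i \in i :: I by rewrite mem_head.
set p' := x i0 + l *: (p - x i0) in t3 t4.
have [y ye] := encl_attained (upd x i p') iiI.
have := t2 m; rewrite (EJ p p') -t3 ltNge => /negP; apply.
apply: (encl_le (y := y) iiI) => j; rewrite inE => /orP[/eqP ->|jI].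
  rewrite /stretch upd_eq (upd_neq _ _ i0i) upd_eq.
  have -> : x i0 + (1 + m.+1%:R^-1) *: (p - x i0) =
      x i0 + ((1 + m.+1%:R^-1) / l) *: (p' - x i0).
    by rewrite /p' addrAC subrr add0r scalerA divfK// gt_eqF// (lt_trans _ l1).
  have l0 : 0 < l := lt_trans ltr01 l1.
  have a0 : 0 <= (1 + m.+1%:R^-1) / l by rewrite divr_ge0 ?addr_ge0// ltW.
  have a1 : (1 + m.+1%:R^-1) / l <= 1 by rewrite ler_pdivrMr// mul1r ltW.
  apply: le_trans (l2norm_segment _ _ _ a0 a1) _.
  have h1 := ye i iiI; rewrite upd_eq in h1.
  have := ye i0; rewrite inE i0I orbT => /(_ isT); rewrite upd_neq// => h2.
  move: (_ / l) a0 a1 h1 h2 => a; set u := l2norm _; set v := l2norm _; set e := encl _ _.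
  nra.
have ji : j != i by apply: contraNneq iI => <-.
by have := ye j; rewrite inE jI orbT /stretch !upd_neq//; exact.
Qed.

(** With the other points frozen, the tying positions of [X i] are disjoint from their dilates about
    [X i0], hence Lebesgue null, hence null for a law with a density. *)
Lemma ae_not_tie I J i i0 : i0 \in I -> i \notin I -> i \notin J ->
  {ae P, forall w, ~ tie (fun j => X j w) I J i i0}.
Proof.
move=> i0I iI iJ.
have i0i : i0 != i by apply: contraNneq iI => <-.
pose E := [set z : others X i * borel_rV R d.+1 | tie (upd (fun j => X j z.1) i z.2) I J i i0].
have mE : measurable E.
  rewrite (_ : E = [set z | encl (upd (fun j => X j z.1) i z.2) (i :: I) ==
       encl (upd (fun j => X j z.1) i z.2) J] `&`
     \bigcap_m [set z | encl (upd (fun j => X j z.1) i z.2) J <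
       encl (stretch (upd (fun j => X j z.1) i z.2) i i0 m) (i :: I)]); last first.
    apply/seteqP; split=> z /=; first by move=> [h1 h2]; split; [apply/eqP|move=> m _; exact: h2].
    by move=> [/eqP h1 h2]; split=> // m; exact: h2.
  have mu j := @measurable_upd i j.
  apply: measurableI.
    apply: measurable_bool_set; apply: measurable_realfun.measurable_fun_eqr;
    by apply: measurable_encl => j; exact: mu.
  apply: bigcapT_measurable => m; apply: measurable_lt_set; apply: measurable_encl => j //.
  rewrite /stretch; have [->|ji] := eqVneq j i.
    rewrite (_ : (fun _ => _) = (fun z : others X i * borel_rV R d.+1 =>
      upd (fun j => X j z.1) i z.2 i0 + (1 + m.+1%:R^-1) *:
      (upd (fun j => X j z.1) i z.2 i - upd (fun j => X j z.1) i z.2 i0))); last first.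
      by apply/funext => z; rewrite upd_eq.
    by apply: measurable_dilation; exact: mu.
  rewrite (_ : (fun _ => _) = (fun z : others X i * borel_rV R d.+1 =>
      upd (fun j => X j z.1) i z.2 j)); first exact: mu.
  by apply/funext => z; rewrite upd_neq.
have PE : P [set w | E (w, X i w)] = 0%E.
  apply: (freezing_null X_indep mE) => w; apply: law_null.
    by have := measurable_xsection w mE; rewrite /xsection/= (_ : mkset _ = [set y | E (w, y)])//;
      apply/seteqP; split => y /=; rewrite ?inE.
  apply: (@dilation_null _ _ _ (X i0 w)).
    by have := measurable_xsection w mE; rewrite /xsection/= (_ : mkset _ = [set y | E (w, y)])//;
      apply/seteqP; split => y /=; rewrite ?inE.
  move=> p l; rewrite /E /= => h1 h2; exact: (tie_dilation i0I iI iJ h1 h2).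
exists [set w | E (w, X i w)]; split => //.
  have := @measurable_pair_others _ _ _ _ _ X i measurableT E mE.
  by rewrite setTI.
by move=> w /= /contrapT; rewrite /E /= upd_id.
Qed.

Lemma ae_generic : {ae P, forall w, generic (fun i => X i w)}.
Proof.
have H1 : {ae P, forall w, forall p : nat * nat, p.1 != p.2 -> X p.1 w != X p.2 w}.
  apply: ae_forall_count => -[i j] /=; have [->|/ae_neq] := eqVneq i j; first exact: aeW.
  by apply: filterS => w.
have H2 : {ae P, forall w, forall p : seq nat * seq nat * nat * nat,
    p.2 \in p.1.1.1 -> p.1.2 \notin p.1.1.1 -> p.1.2 \notin p.1.1.2 ->
    ~ tie (fun j => X j w) p.1.1.1 p.1.1.2 p.1.2 p.2}.
  apply: ae_forall_count => -[[[I J] i] i0] /=.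
  have [i0I|i0I] := boolP (i0 \in I); last by apply: aeW.
  have [iI|iI] := boolP (i \in I); first by apply: aeW.
  have [iJ|iJ] := boolP (i \in J); first by apply: aeW.
  by apply: filterS (ae_not_tie i0I iI iJ) => w.
apply: filterS2 H1 H2 => w h1 h2; split=> [i j|I J i i0]; first exact: (h1 (i, j)).
exact: (h2 (I, J, i, i0)).
Qed.

End almost_surely_generic.

(** * Holes of a random sample *)

Section tail.
Context {disp} {T : measurableType disp} {R : realType} (P : probability T R).
Context {d : nat} (X : nat -> {RV P >-> borel_rV R d.+1}) (f : 'rV[R]_d.+1 -> R).
Hypotheses (X_indep : mutually_independent X) (X_density : forall i, has_density (X i) f).
Local Notation leb := (@lebesgue_measure_rV R).
Local Notation samp w := (fun i => X i w).

Lemma law_eq i j (B : set (borel_rV R d.+1)) : measurable B -> law X i B = law X j B.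
Proof.
move=> mB; have [_ _ fi] := X_density i; have [_ _ fj] := X_density j.
by rewrite -[LHS]/(distribution P (X i) B) fi// -fj.
Qed.

Definition mass (B : set (borel_rV R d.+1)) : R := fine (law X 0 B).

Lemma law_mass i B : measurable B -> law X i B = (mass B)%:E.
Proof. by move=> mB; rewrite (law_eq i 0)// /mass fineK// fin_num_measure. Qed.

Lemma mass_ge0 B : 0 <= mass B.
Proof. by rewrite fine_ge0. Qed.

Lemma mass_le1 B : measurable B -> mass B <= 1.
Proof. by move=> mB; rewrite -lee_fin -(law_mass 0)// probability_le1. Qed.

Lemma mass_ge (a v : R) (B : set (borel_rV R d.+1)) : measurable B -> 0 <= a ->
  (forall x, B x -> a <= f x) -> leb d.+1 B = v%:E -> a * v <= mass B.
Proof.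
move=> mB a0 af vB; rewrite -lee_fin -(law_mass 0)//.
have [mf f0 fE] := X_density 0%N.
rewrite -[leRHS]/(distribution P (X 0) B) fE// EFinM -vB -integral_cst//.
apply: ge0_le_integral => //.
by apply: measurable_funTS; exact: measurableT_comp.
Qed.

Lemma mass_le (b v : R) (B : set (borel_rV R d.+1)) : measurable B -> 0 <= b ->
  (forall x, B x -> f x <= b) -> (leb d.+1 B <= v%:E)%E -> mass B <= b * v.
Proof.
move=> mB b0 fb vB; rewrite -lee_fin -(law_mass 0)//.
have [mf f0 fE] := X_density 0%N.
rewrite -[leLHS]/(distribution P (X 0) B) fE//.
apply: (@le_trans _ _ (b%:E * leb d.+1 B)%E); last by rewrite EFinM lee_wpmul2l.
rewrite -integral_cst//; apply: ge0_le_integral => //.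
  by move=> x _; rewrite lee_fin.
by apply: measurable_funTS; exact: measurableT_comp.
Qed.

Lemma le_mass (B C : set (borel_rV R d.+1)) : measurable B -> measurable C ->
  B `<=` C -> mass B <= mass C.
Proof.
move=> mB mC BC; rewrite -lee_fin -!(law_mass 0)//.
by apply: le_measure; rewrite ?inE.
Qed.

Lemma measurable_samp_npoints n (B : set (borel_rV R d.+1)) k : measurable B ->
  measurable [set w | (npoints (samp w) n B < k)%N].
Proof.
by move=> mB; apply: measurable_npoints_lt => // j; exact: measurable_funPT.
Qed.

Lemma measurable_others_npoints n (B : set (borel_rV R d.+1)) k : measurable B ->
  measurable ([set w | (npoints (samp w) n B < k)%N] : set (others X n)).
Proof.
move=> mB; rewrite (_ : [set w | _] =
    [set w : others X n | (npoints (upd (samp w) n 0) n B < k)%N]); last first.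
  by apply/funext => w /=; rewrite npoints_upd.
apply: measurable_npoints_lt => // j.
have [->|jn] := eqVneq j n.
  by rewrite (_ : (fun _ => _) = cst 0); [exact: measurable_cst|apply/funext => w; rewrite upd_eq].
rewrite (_ : (fun _ => _) = (X j : others X n -> borel_rV R d.+1)).
  exact: (@measurable_others_RV _ _ _ P _ X n j jn).
by apply/funext => w; rewrite upd_neq.
Qed.

Lemma indep_npoints n k (B C : set (borel_rV R d.+1)) : measurable B -> measurable C ->
  P ([set w | (npoints (samp w) n B < k)%N] `&` X n @^-1` C) =
  (P [set w | (npoints (samp w) n B < k)%N] * P (X n @^-1` C))%E.
Proof.
move=> mB mC; apply: (@others_indep _ _ _ P _ X X_indep n) => //.
exact: measurable_others_npoints.
Qed.

Lemma measurable_repeated n : measurable [set w | X n w \in mkseq (samp w) n].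
Proof.
rewrite (_ : [set w | _] = ~` [set w | forall i, i \in iota 0 n -> (~` [set w | X i w = X n w]) w]).
  apply: measurableC; apply: measurable_forall_seq => i _; apply: measurableC.
  by apply: measurable_eq_rV; exact: measurable_funPT.
apply/seteqP; split=> w /=.
  by move=> /mapP[i iI xi] H; apply: (H i iI); rewrite xi.
move=> /existsNP[i /not_implyP[iI /contrapT xi]]; apply/mapP; exists i => //.
Qed.

Lemma repeated_null n : P [set w | X n w \in mkseq (samp w) n] = 0%E.
Proof.
have : {ae P, forall w, X n w \notin mkseq (samp w) n}.
  have := ae_generic X_indep X_density; apply: filterS => w [H _].
  apply/negP => /mapP[i]; rewrite mem_iota add0n => /= ni xi.
  by have := H n i; rewrite gtn_eqF// => /(_ isT); rewrite xi eqxx.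
case=> N [mN N0 HN]; apply/eqP; rewrite eq_le measure_ge0 andbT -N0.
apply: le_measure; rewrite ?inE//; first exact: measurable_repeated.
by move=> w /= h; apply: HN => /=; rewrite h.
Qed.

(** Markov's inequality for [s] to the power of the count, whose mean is [(1 - (1 - s) mass B)^n]
    when the points are distinct; the induction conditions on the last point. Small [s] brings the
    decay close to that of an empty ball, at the price of the constant [s^-k]. *)
Lemma npoints_tail (s : R) (B : set (borel_rV R d.+1)) n k : measurable B ->
  0 < s -> s <= 1 ->
  (P [set w | (npoints (samp w) n B < k)%N] <=
    (s^-1 ^+ k * (1 - (1 - s) * mass B) ^+ n)%:E)%E.
Proof.
move=> mB s0 s1; set m := mass B.
have m0 : 0 <= m by exact: mass_ge0.
have m1 : m <= 1 by exact: mass_le1.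
have q0 : 0 <= 1 - (1 - s) * m by nra.
elim: n k => [|n IH] k.
  rewrite expr0 mulr1; apply: le_trans (probability_le1 _ (measurable_samp_npoints _ _ mB)) _.
  by rewrite lee_fin exprn_ege1// invf_ge1.
case: k => [|k].
  rewrite (_ : [set w | _] = set0); last by apply/seteqP; split.
  by rewrite measure0 lee_fin mulr_ge0// exprn_ge0// invr_ge0 ltW.
have mY : measurable (X n @^-1` B).
  by rewrite -[X in measurable X]setTI; apply: measurable_funPT.
have PY : P (X n @^-1` B) = m%:E by rewrite -(law_mass n).
have PYC : P (X n @^-1` (~` B)) = (1 - m)%:E.
  by rewrite preimage_setC probability_setC// PY.
set E := fun k => [set w | (npoints (samp w) n B < k)%N].
have mE j : measurable (E j) by exact: measurable_samp_npoints.
set N := [set w | X n w \in mkseq (samp w) n].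
have PE1 : P (E k.+1 `&` X n @^-1` (~` B)) = (P (E k.+1) * (1 - m)%:E)%E.
  by rewrite -PYC; apply: indep_npoints => //; exact: measurableC.
have PE2 : P (E k `&` X n @^-1` B) = (P (E k) * m%:E)%E.
  by rewrite -PY; exact: indep_npoints.
have mYC : measurable (X n @^-1` (~` B)) by rewrite preimage_setC; exact: measurableC.
have mN : measurable N by exact: measurable_repeated.
have sub : [set w | (npoints (samp w) n.+1 B < k.+1)%N] `<=`
    ((E k.+1 `&` X n @^-1` (~` B)) `|` (E k `&` X n @^-1` B)) `|` N.
  move=> w /=; rewrite npointsS /N /E /=.
  case: (boolP (X n w \in mkseq _ n)) => xn /=; first by right.
  have [Bx|Bx] := pselect (B (X n w)).
    by rewrite mem_set// addn1 ltnS => lt; left; right.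
  by rewrite memNset// addn0 => lt; left; left.
apply: (@le_trans _ _ (P (((E k.+1 `&` X n @^-1` (~` B)) `|` (E k `&` X n @^-1` B)) `|` N))).
  apply: le_measure => //; rewrite inE; first exact: measurable_samp_npoints.
  by apply: measurableU => //; apply: measurableU; exact: measurableI.
apply: le_trans (measureU2 _ _ mN) _; first by apply: measurableU; exact: measurableI.
rewrite [X in (_ + X)%E](repeated_null n) adde0.
apply: le_trans (measureU2 _ _ _) _; [exact: measurableI|exact: measurableI|].
apply: (@le_trans _ _ (P (E k.+1) * (1 - m)%:E + P (E k) * m%:E)%E).
  by rewrite -PE1 -PE2.
apply: (@le_trans _ _ ((s^-1 ^+ k.+1 * (1 - (1 - s) * m) ^+ n)%:E * (1 - m)%:E +
   (s^-1 ^+ k * (1 - (1 - s) * m) ^+ n)%:E * m%:E)%E).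
  by apply: leeD; apply: lee_wpmul2r; rewrite ?lee_fin ?subr_ge0//; exact: IH.
rewrite -!EFinM -EFinD lee_fin le_eqVlt; apply/orP; left; apply/eqP.
by rewrite !exprS; field; rewrite gt_eqF.
Qed.

(** A continuum of centres is replaced by a net of mesh [delta * r]: shrunk to radius
    [(1 - delta) r], the ball about a net point lies in the ball about a nearby centre. The
    measurable superset [V] is the finite union over the net. *)
Lemma hole_union_bound (S : set 'rV[R]_d.+1) (r delta s a : R) (n k M : nat) :
  0 < r -> 0 < delta -> delta < 1 -> 0 < s -> s <= 1 -> 0 <= a ->
  (forall l, dispersed (delta * r) l -> (forall x, x \in l -> S x) -> (size l <= M)%N) ->
  (forall x y, S x -> cball x r y -> a <= f y) ->
  exists V, [/\ measurable V,
    [set w | exists2 x, S x & (npoints (samp w) n (cball x r) < k)%N] `<=` V &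
    (P V <= (M%:R * s^-1 ^+ k *
       expR (- (n%:R * ((1 - s) * (a * (ballvol d.+1 * ((1 - delta) * r) ^+ d.+1))))))%:E)%E].
Proof.
move=> r0 d0 d1 s0 s1 a0 HM Sf.
have [Z [Zd ZS Znet]] := maximal_dispersed (ltW (mulr_gt0 d0 r0)) HM.
set m := a * _; set rho := (1 - delta) * r.
have rho0 : 0 < rho by rewrite mulr_gt0// subr_gt0.
pose V := \big[setU/set0]_(z <- Z) [set w | (npoints (samp w) n (cball z rho) < k)%N].
have mV z : measurable [set w | (npoints (samp w) n (cball z rho) < k)%N].
  by apply: measurable_samp_npoints; exact: measurable_cball.
have bnd z : z \in Z -> (P [set w | (npoints (samp w) n (cball z rho) < k)%N] <=
    (s^-1 ^+ k * expR (- (n%:R * ((1 - s) * m))))%:E)%E.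
  move=> zZ; apply: le_trans (npoints_tail _ _ (measurable_cball _ _) s0 s1) _.
  rewrite lee_fin ler_wpM2l ?exprn_ge0 ?invr_ge0 ?(ltW s0)//.
  have mz : m <= mass (cball z rho).
    apply: mass_ge => //; first exact: measurable_cball.
      move=> x zx; apply: (Sf z) => //; first exact: ZS.
      by apply: le_cball zx; rewrite /rho ger_pMl// gerBl ltW.
    by rewrite lebesgue_measure_rV_cball.
  have mz1 : mass (cball z rho) <= 1 by apply: mass_le1; exact: measurable_cball.
  have m0 := mass_ge0 (cball z rho).
  have -> : expR (- (n%:R * ((1 - s) * m))) = expR (- ((1 - s) * m)) ^+ n.
    by rewrite -expRM_natr mulNr [in RHS]mulrC.
  apply: lerXn2r; rewrite ?nnegrE ?expR_ge0//; first nra.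
  apply: le_trans (expR_ge1Dx _); rewrite -mulrN; move: s0 s1 mz; nra.
exists V; split.
- by apply: bigsetU_measurable => z _.
- move=> w /= [x Sx xk]; have [z zZ xz] := Znet x Sx.
  rewrite /V -bigcup_seq; exists z => //=; apply: leq_ltn_trans xk.
  apply: le_npoints; apply: cball_sub; rewrite l2normC /rho mulrBl mul1r; move: xz; lra.
have : (P V <= ((size Z)%:R * (s^-1 ^+ k * expR (- (n%:R * ((1 - s) * m)))))%:E)%E.
  rewrite /V; elim: (Z) bnd => [_|z l IH bnd].
    by rewrite big_nil measure0 mul0r.
  rewrite big_cons; apply: le_trans (measureU2 _ _ _) _ => //.
    by apply: bigsetU_measurable.
  set c := _ * expR _.
  have -> : (size (z :: l))%:R * c = c + (size l)%:R * c.
    by rewrite /= -natr1 mulrDl mul1r addrC.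
  rewrite EFinD; apply: leeD; first by apply: bnd; rewrite mem_head.
  by apply: IH => z' z'l; apply: bnd; rewrite inE z'l orbT.
move=> /le_trans; apply; rewrite lee_fin -mulrA ler_wpM2r ?ler_nat ?HM//.
by rewrite mulr_ge0 ?expR_ge0// exprn_ge0// invr_ge0 ltW.
Qed.

End tail.

(** * Elementary estimates for the logarithm *)

Section analysis.
Context {R : realType}.

Lemma sum_inv_sqr_le n : \sum_(j < n.+1) (j.+1%:R ^+ 2)^-1 <= 2 - n.+1%:R^-1 :> R.
Proof.
elim: n => [|n IH]; first by rewrite big_ord1 expr1n invr1; lra.
rewrite big_ord_recr/=; apply: le_trans (lerD IH (lexx _)) _.
have n1 : 0 < n.+1%:R :> R by [].
rewrite -(natr1 n.+1); move: (n.+1%:R : R) n1 => t t0.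
rewrite -subr_ge0 (_ : _ - _ = (t * (t + 1) ^+ 2)^-1).
  by rewrite invr_ge0 mulr_ge0 ?exprn_ge0 ?addr_ge0// ltW.
by field; rewrite !gt_eqF ?addr_gt0.
Qed.

Lemma ln_le_mul (eps : R) : 0 < eps ->
  exists n0, forall n, (n0 <= n)%N -> ln n%:R <= eps * n%:R.
Proof.
move=> e0; exists (Num.trunc (expR (2 / eps))).+1 => n hn.
have n0 : 0 < n%:R :> R by rewrite ltr0n; apply: leq_trans hn.
have hn' : expR (2 / eps) <= n%:R.
  by apply: le_trans (ltW (truncnS_gt _)) _; rewrite ler_nat.
have L1 : 2 / eps <= ln n%:R by rewrite -ler_expR lnK.
have L0 : 0 < ln n%:R :> R by apply: lt_le_trans L1; rewrite divr_gt0.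
rewrite -[in leRHS](@lnK R n%:R)//.
apply: le_trans (_ : eps * (1 + (ln n%:R) ^+ 2 / 2) <= _); last first.
  by rewrite ler_wpM2l ?(ltW e0)//; have := expR_ge1Dxn 1 (ltW L0); rewrite !factS fact0 muln1.
move: L1 L0; rewrite ler_pdivrMr//; move: (ln _) => L; nra.
Qed.

(** The recurring bound [4] stands for the number e: [exp (-1/2) >= 1/2] gives [exp 1 <= 4]. *)
Lemma ln_ge1 n : (4 <= n)%N -> 1 <= ln n%:R :> R.
Proof.
move=> n4; rewrite -ler_expR lnK ?posrE ?ltr0n; last exact: leq_trans n4.
apply: le_trans (_ : 4 <= _); last by rewrite ler_nat.
rewrite -[X in expR X]opprK expRN -[leRHS]invrK lef_pV2 ?posrE ?expR_gt0//.
have -> : - 1 = - 2^-1 + - 2^-1 :> R by lra.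
have := expR_ge1Dx (- 2^-1 : R); rewrite expRD; nra.
Qed.

Lemma ln_natX j q : ln (j.+1 ^ q)%:R = q%:R * ln j.+1%:R :> R.
Proof. by rewrite natrX lnXn// mulr_natl. Qed.

End analysis.

(** * Rare events along powers *)

Section rare.
Context {disp} {T : measurableType disp} {R : realType} (P : probability T R).

Lemma borel_cantelli_ae (V : nat -> set T) (C : R) (j0 : nat) :
  (forall j, measurable (V j)) -> 0 <= C ->
  (forall j, (j0 <= j)%N -> (P (V j) <= (C * (j.+1%:R ^+ 2)^-1)%:E)%E) ->
  {ae P, forall w, \forall j \near \oo, ~ V j w}.
Proof.
move=> mV C0 PV; pose W j := V (j0 + j)%N.
have mW j : measurable (W j) by exact: mV.
have WC j : (P (W j) <= (C * (j.+1%:R ^+ 2)^-1)%:E)%E.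
  apply: le_trans (PV _ (leq_addr _ _)) _; rewrite lee_fin ler_wpM2l//.
  rewrite lef_pV2 ?posrE ?exprn_gt0//; apply: lerXn2r; rewrite ?nnegrE//.
  by rewrite ler_nat ltnS leq_addl.
have PW0 : P (lim_sup_set W) = 0%E.
  apply: (lim_sup_set_cvg0 mW).
  apply: (@le_lt_trans _ _ (C * 2)%:E); last by rewrite ltry.
  apply: lime_le; first by apply: is_cvg_nneseries => n _ _; exact: measure_ge0.
  apply: nearW => n; apply: (@le_trans _ _ (\sum_(0 <= j < n) (C * (j.+1%:R ^+ 2)^-1)%:E)%E).
    by apply: lee_sum => j _; exact: WC.
  rewrite sumEFin lee_fin -mulr_sumr ler_wpM2l// big_mkord.
  case: n => [|n]; first by rewrite big_ord0.
  by apply: le_trans (sum_inv_sqr_le n) _; rewrite gerBl.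
exists (lim_sup_set W); split => //.
  apply: bigcap_measurable => [|n _]; first by exists 0%N.
  by apply: bigcup_measurable.
move=> w /= Hw n _ /=; apply: contrapT => Hn; apply: Hw.
exists (j0 + n)%N => // j /= nj Vj; apply: Hn; exists (j - j0)%N => /=.
  by rewrite leq_subRL// (leq_trans _ nj)// leq_addr.
by rewrite /W subnKC// (leq_trans _ nj)// leq_addr.
Qed.

(* The sequences [1, 2 ^ q, 3 ^ q, ...] suffice because the spacing radius is
   monotone in the sample size; finitely many rare events have a common [q]. *)
Definition rare (E : nat -> set T) : Prop :=
  exists q0, forall q, (q0 <= q)%N ->
    {ae P, forall w, \forall j \near \oo, ~ E (j.+1 ^ q)%N w}.

(** The bound is [C n^-eta]. The events range over a continuum of centres, so they are estimated
    through measurable supersets. *)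
Definition poly_small (E : nat -> set T) (eta : R) : Prop :=
  exists C n0, 0 <= C /\ forall n, (n0 <= n)%N ->
    exists V, [/\ measurable V, E n `<=` V & (P V <= (C * expR (- (eta * ln n%:R)))%:E)%E].

Lemma rare_poly_small E eta : 0 < eta -> poly_small E eta -> rare E.
Proof.
move=> e0 [C [n0 [C0 HC]]].
(* [q * eta >= 2] makes the bound at [j.+1 ^ q] at most [C] times [j.+1 ^ -2], which is summable. *)
exists (Num.trunc (2 / eta)).+1 => q hq.
have q2 : 2 <= eta * q%:R.
  rewrite mulrC -ler_pdivrMr//; apply: le_trans (ltW (truncnS_gt _)) _.
  by rewrite ler_nat.
have jq j : (j <= j.+1 ^ q)%N.
  case: q hq {q2} => // q _; rewrite expnS.
  by apply: leq_trans (leqnSn _) _; rewrite leq_pmulr// expn_gt0.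
have /choice[V VP] : forall j, exists V, measurable V /\ ((n0 <= j)%N ->
   E (j.+1 ^ q)%N `<=` V /\ (P V <= (C * (j.+1%:R ^+ 2)^-1)%:E)%E).
  move=> j; have [nj|nj] := leqP n0 j; last by exists set0; split; [exact: measurable0|].
  have [V [mV EV PV]] := HC _ (leq_trans nj (jq j)).
  exists V; split => // _; split => //; apply: le_trans PV _.
  rewrite lee_fin ler_wpM2l// ln_natX.
  rewrite -[X in _ <= X^-1](@lnK R) ?posrE ?exprn_gt0// -expRN ler_expR lerN2 lnXn//.
  by rewrite mulrA -[_ *+ 2]mulr_natl ler_wpM2r// ln_ge0// ler1n.
have := @borel_cantelli_ae V C n0 (fun j => (VP j).1) C0 (fun j nj => ((VP j).2 nj).2).
apply: filterS => w [N _ HN]; exists (maxn N n0) => // j /=.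
rewrite geq_max => /andP[Nj nj] Ej; apply: (HN j Nj).
by have [EV _] := (VP j).2 nj; exact: EV.
Qed.

End rare.

(** * The critical scale of the radius *)

Section rate.
Context {R : realType} (d : nat) (th : R) (th0 : 0 < th).

(* The radius [r] with [n * th * r ^ d.+1 = c * ln n]. *)
Definition rho (n : nat) (c : R) : R := expR (ln (c * ln n%:R / (n%:R * th)) / d.+1%:R).

Lemma rho_gt0 n c : 0 < rho n c.
Proof. exact: expR_gt0. Qed.

Lemma rho_arg_gt0 n c : (2 <= n)%N -> 0 < c -> 0 < c * ln n%:R / (n%:R * th).
Proof.
move=> n2 c0; rewrite divr_gt0// mulr_gt0//; last by rewrite ltr0n ltnW.
by rewrite ln_gt0// ltr1n.
Qed.

Lemma rhoX n c : (2 <= n)%N -> 0 < c -> rho n c ^+ d.+1 = c * ln n%:R / (n%:R * th).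
Proof.
move=> n2 c0; rewrite /rho -expRM_natr divfK ?pnatr_eq0//.
by rewrite lnK// posrE rho_arg_gt0.
Qed.

Lemma rho_small c e : 0 < c -> 0 < e -> exists n0, forall n, (n0 <= n)%N -> rho n c < e.
Proof.
move=> c0 e0; have e1 : 0 < e ^+ d.+1 * th / (2 * c).
  by rewrite divr_gt0 ?mulr_gt0 ?exprn_gt0.
have [n0 Hn0] := ln_le_mul e1; exists (maxn n0 2) => n; rewrite geq_max => /andP[/Hn0 h n2].
have n1 : 0 < n%:R :> R by rewrite ltr0n ltnW.
rewrite -(@ltr_pXn2r _ d.+1) ?nnegrE ?(ltW e0) ?(ltW (rho_gt0 _ _))// rhoX//.
rewrite ltr_pdivrMr ?mulr_gt0//.
have : c * ln n%:R <= c * (e ^+ d.+1 * th / (2 * c) * n%:R) by rewrite ler_pM2l.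
rewrite (_ : c * (_ / _ * _) = e ^+ d.+1 * (n%:R * th) / 2); last by field; rewrite gt_eqF.
have : 0 < e ^+ d.+1 * (n%:R * th) by rewrite !mulr_gt0 ?exprn_gt0.
lra.
Qed.

(** The left side is of order [(n / ln n)^(b / d.+1)]; as [ln n >= 1], the logarithm is dropped. *)
Lemma rhoV_le n c b : (4 <= n)%N -> 0 < c ->
  (rho n c)^-1 ^+ b <= expR (b%:R / d.+1%:R * (`|ln (c / th)| + ln n%:R)).
Proof.
move=> n3 c0; have n1 : 0 < n%:R :> R by rewrite ltr0n; exact: leq_trans n3.
have L1 : 1 <= ln n%:R :> R by exact: ln_ge1.
rewrite /rho -expRN -expRM_natr ler_expR.
rewrite -mulNr -mulrA mulrC -!mulrA (mulrC d.+1%:R^-1); apply: ler_wpM2l => //.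
rewrite ler_pM2r ?invr_gt0// lerNl opprD -[X in _ + X]opprK.
rewrite (_ : c * (ln n%:R / (n%:R * th)) = c / th * ln n%:R / n%:R); last first.
  by field; rewrite !gt_eqF.
have ct : 0 < c / th by rewrite divr_gt0.
have L0 : 0 < ln n%:R :> R := lt_le_trans ltr01 L1.
have -> : ln (c / th * ln n%:R / n%:R) = ln (c / th) + ln (ln n%:R) - ln n%:R.
  have ctL : 0 < c / th * ln n%:R by rewrite mulr_gt0.
  by rewrite [LHS]ln_div// lnM.
have := ln_ge0 L1; have := ler_norm (- ln (c / th)); rewrite normrN.
set u := ln (c / th); set v := ln (ln _); lra.
Qed.

End rate.

(** * Continuity and bounds of the density *)

Section density.
Context {R : realType} {d : nat} (A : set 'rV[R]_d.+1) (f : 'rV[R]_d.+1 -> R).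
Hypotheses (A_compact : compact A) (A_interior : A° !=set0) (A_regular : closure A° = A).
Hypotheses (f_ge0 : forall x, 0 <= f x).
Hypotheses (f_support : closure [set x | f x != 0] = A) (f_cont : {within A, continuous f}).
Hypothesis (f_inf : 0 < inf (f @` A)).

Lemma density_ge_inf x : A x -> inf (f @` A) <= f x.
Proof.
move=> Ax; apply: ge_inf; last by exists x.
by exists 0 => _ [y _ <-].
Qed.

Lemma density_out x : ~ A x -> f x = 0.
Proof.
move=> nAx; apply/eqP; apply: contrapT => /negP fx; apply: nAx.
by rewrite -f_support; apply: subset_closure.
Qed.

Lemma density_near x e : A x -> 0 < e ->
  exists2 r, 0 < r & forall y, A y -> l2norm (y - x) <= r -> `|f y - f x| <= e.
Proof.
move=> Ax e0; have /subspace_continuousP/(_ x Ax) := f_cont.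
move=> /cvgrPdist_le/(_ e e0); rewrite near_withinE => /nbhs_cballP[r r0 H].
by exists r => // y Ay yx; rewrite distrC; apply: (H y).
Qed.

Lemma density_unif e : 0 < e -> exists2 r, 0 < r &
  forall x y, A x -> A y -> l2norm (x - y) <= r -> `|f x - f y| <= e.
Proof.
move=> e0; apply: contrapT => Hn.
have H (m : nat) : exists p : 'rV[R]_d.+1 * 'rV[R]_d.+1, [/\ A p.1, A p.2,
    l2norm (p.1 - p.2) <= m.+1%:R^-1 & e < `|f p.1 - f p.2|].
  apply: contrapT => Hm; apply: Hn; exists m.+1%:R^-1; first by rewrite invr_gt0.
  move=> x y Ax Ay xy; rewrite leNgt; apply/negP => fxy; apply: Hm.
  by exists (x, y).
have [p pP] := choice H.
have pA m : A (p m).1 by have [] := pP m.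
have [x Ax xp] := compact_subseq A_compact pA.
have e20 : 0 < e / 2 by rewrite divr_gt0.
have [r r0 Hr] := density_near Ax e20.
have r20 : 0 < r / 2 by rewrite divr_gt0.
have [m Nm pm] := xp (r / 2) (Num.trunc (r / 2)^-1) r20.
have [A1 A2 p12 fp] := pP m.
have mr : m.+1%:R^-1 <= r / 2.
  rewrite invf_ple ?posrE//; apply: le_trans (ltW (truncnS_gt _)) _.
  by rewrite ler_nat ltnS.
have h1 : `|f (p m).1 - f x| <= e / 2.
  by apply: Hr => //; apply: le_trans pm _; rewrite ler_pdivrMr// mulr_natr mulr2n lerDl ltW.
have h2 : `|f (p m).2 - f x| <= e / 2.
  apply: Hr => //; apply: le_trans (l2norm_triangle _ (p m).1 _) _.
  rewrite l2normC [leRHS]splitr; apply: lerD => //; exact: le_trans mr.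
have := ler_distD (f x) (f (p m).1) (f (p m).2); rewrite (distrC (f x)).
by move: fp h1 h2; set a := `|_|; set b := `|_|; set c := `|_|; lra.
Qed.

Lemma density_bounded : exists2 M, 0 < M & forall x, f x <= M.
Proof.
have : bounded_set (f @` A) by apply: compact_bounded; exact: continuous_compact.
move=> [M [_ HM]]; exists (`|M| + 1); first by rewrite ltr_wpDl.
move=> x; have [Ax|/density_out ->] := pselect (A x); last by rewrite addr_ge0.
apply: le_trans (ler_norm _) _; apply: HM; last by exists x.
by rewrite ltr_pwDr// ler_norm.
Qed.

(** A near-minimizer of [f] may lie on the boundary; since [A] is the closure of its interior, there
    is a ball inside [A] close to it. *)
Lemma density_near_inf e : 0 < e -> exists x r, [/\ 0 < r, cball x r `<=` A &
  forall y, cball x r y -> f y <= (1 + e) * inf (f @` A)].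
Proof.
move=> e0; set f0 := inf _; have f00 : 0 < f0 := f_inf.
have [a Aa] : A !=set0 by have [a /interior_subset] := A_interior; exists a.
have hinf : has_inf (f @` A).
  by split; [exists (f a), a|exists 0 => _ [y _ <-]].
have ef0 : 0 < e * f0 / 2 by rewrite divr_gt0// mulr_gt0.
have [_ [x Ax <-] fx] := inf_adherent ef0 hinf; rewrite -/f0 in fx.
have [r r0 Hr] := density_near Ax ef0.
have : closure A° x by rewrite A_regular.
move=> /(_ (cball x (r / 2))) [|y [/nbhs_cballP[s s0 sA] xy]].
  by apply/nbhs_cballP; exists (r / 2) => //; rewrite divr_gt0.
exists y, (Num.min s (r / 2)); split; first by rewrite lt_min s0 divr_gt0.
  by apply: subset_trans sA; apply: le_cball; rewrite ge_min lexx.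
move=> z yz; have Az : A z by apply: sA; apply: le_cball yz; rewrite ge_min lexx.
have zx : l2norm (z - x) <= r.
  apply: le_trans (l2norm_triangle _ y _) _; move: xy yz; rewrite /cball/= => xy yz.
  rewrite [r]splitr; apply: lerD => //; apply: le_trans yz _.
  by rewrite ge_min lexx orbT.
have := Hr z Az zx; rewrite ler_norml => /andP[_]; move: fx; lra.
Qed.

End density.

(** * Union bounds for holes *)

Section union.
Context {disp} {T : measurableType disp} {R : realType} (P : probability T R).
Context {d : nat} (X : nat -> {RV P >-> borel_rV R d.+1}) (f : 'rV[R]_d.+1 -> R) (k : nat).
Hypotheses (X_indep : mutually_independent X) (X_density : forall i, has_density (X i) f).
Local Notation samp w := (fun i => X i w).

(** [b] is a box dimension for the sets of centres. The constants may depend on [delta], which is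
    fixed before [r] tends to 0. *)
Definition entropy_le (S : R -> set 'rV[R]_d.+1) (b : nat) : Prop :=
  forall delta, 0 < delta -> delta < 1 -> exists C r0, [/\ 0 <= C, 0 < r0 &
    forall r l, 0 < r -> r < r0 -> dispersed (delta * r) l ->
      (forall x, x \in l -> S r x) -> (size l)%:R <= C * r^-1 ^+ b].

Definition has_hole (n : nat) (r : R) (S : set 'rV[R]_d.+1) : set T :=
  [set w | exists2 x, S x & (npoints (samp w) n (cball x r) < k)%N].

Lemma choose_delta (D : nat) (u v : R) : 0 <= u -> u < v ->
  exists t, [/\ 0 < t, t < 1 & u <= (1 - t) ^+ D.+1 * v].
Proof.
move=> u0 uv; have v0 : 0 < v by exact: le_lt_trans uv.
pose t := (v - u) / (v * (D.+1.+1)%:R).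
have D0 : 0 < D.+2%:R :> R by [].
have t0 : 0 < t by rewrite divr_gt0 ?subr_gt0// mulr_gt0.
have t1 : t < 1.
  rewrite ltr_pdivrMr ?mulr_gt0// mul1r; apply: (@le_lt_trans _ _ v); first lra.
  by rewrite ltr_pMr// ltr1n.
exists t; split => //.
apply: le_trans (_ : (1 - D.+1%:R * t) * v <= _); last first.
  by rewrite ler_wpM2r ?(ltW v0)// bernoulli_le// ltW.
rewrite mulrBl mul1r lerBrDl -lerBrDr /t.
rewrite (_ : D.+1%:R * ((v - u) / (v * D.+2%:R)) * v = (v - u) * (D.+1%:R / D.+2%:R)); last first.
  by field; rewrite gt_eqF//= gt_eqF.
by rewrite ler_piMr ?subr_ge0 ?(ltW uv)// ler_pdivrMr// mul1r ler_nat.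
Qed.

(** A comparison of exponents: at the radius [rho] a net has about [n^(b / d.+1)] points, and a ball
    about each is sparse with probability about [n^-(c a V / th)]. The strict inequality leaves room
    for the discretization. *)
Lemma hole_poly_small (th a c eta : R) (b : nat) (S : R -> set 'rV[R]_d.+1) :
  0 < th -> 0 < a -> 0 < c -> 0 <= eta -> entropy_le S b ->
  (exists2 r1, 0 < r1 & forall r x y, 0 < r -> r < r1 -> S r x -> cball x r y -> a <= f y) ->
  b%:R / d.+1%:R + eta < c * (a * ballvol d.+1 / th) ->
  poly_small P (fun n => has_hole n (rho d th n c) (S (rho d th n c))) eta.
Proof.
move=> th0 a0 c0 eta0 Sb [r1 r10 Sf] L.
have v0 : 0 < ballvol d.+1 :> R by exact: ballvol_gt0.
(* The same [t] is used for the mesh of the net and for the base [s] of the tail bound: the shrunken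
   radius costs [(1 - t)^(d+1)] and the tail bound one more factor. *)
have [|t [t0 t1 tL]] := @choose_delta d.+1 _ _ _ L; first by rewrite addr_ge0// divr_ge0.
have [C [r0 [C0 r00 HC]]] := Sb t t0 t1.
have [n0 Hn0] := @rho_small R d th th0 c (Num.min r0 r1) c0 ltac:(by rewrite lt_min r00).
pose kappa := expR (b%:R / d.+1%:R * `|ln (c / th)|).
exists (C * kappa * t^-1 ^+ k), (maxn n0 4); split.
  by rewrite !mulr_ge0 ?expR_ge0// exprn_ge0// invr_ge0 ltW.
move=> n; rewrite geq_max => /andP[/Hn0 + n4]; set r := rho d th n c.
rewrite lt_min => /andP[rr0 rr1]; have r_gt0 : 0 < r by exact: rho_gt0.
pose M := Num.trunc (C * r^-1 ^+ b).
have HM l : dispersed (t * r) l -> (forall x, x \in l -> S r x) -> (size l <= M)%N.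
  move=> ld lS; rewrite /M truncn_ge_nat; first exact: HC.
  by rewrite mulr_ge0// exprn_ge0// invr_ge0 ltW.
have [V [mV EV PV]] := @hole_union_bound _ _ _ _ _ _ _ X_indep X_density (S r) r t t a n k M
  r_gt0 t0 t1 t0 (ltW t1) (ltW a0) HM (fun x y => Sf r x y r_gt0 rr1).
exists V; split => //; apply: le_trans PV _; rewrite lee_fin.
have Mle : M%:R <= C * r^-1 ^+ b.
  by rewrite -truncn_ge_nat// mulr_ge0// exprn_ge0// invr_ge0 ltW.
apply: (@le_trans _ _ (C * r^-1 ^+ b * t^-1 ^+ k * expR (- ((b%:R / d.+1%:R + eta) * ln n%:R)))).
  apply: ler_pM; rewrite ?expR_ge0 ?mulr_ge0 ?exprn_ge0 ?invr_ge0 ?(ltW t0)//.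
    by rewrite ler_wpM2r// exprn_ge0// invr_ge0 ltW.
  rewrite ler_expR lerN2 exprMn rhoX//; last exact: leq_trans n4.
  have n1 : 0 < n%:R :> R by rewrite ltr0n; exact: leq_trans n4.
  have L0 : 0 <= ln n%:R :> R by apply: le_trans (ln_ge1 n4).
  rewrite (_ : n%:R * _ = (1 - t) ^+ d.+2 * (c * (a * ballvol d.+1 / th)) * ln n%:R); last first.
    by rewrite [in RHS]exprS; field; rewrite !gt_eqF.
  by rewrite ler_wpM2r.
have rV := @rhoV_le R d th th0 n c b n4 c0; rewrite -/r in rV.
apply: (@le_trans _ _ (C * (kappa * expR (b%:R / d.+1%:R * ln n%:R)) * t^-1 ^+ k *
   expR (- ((b%:R / d.+1%:R + eta) * ln n%:R)))).
  rewrite ler_wpM2r ?expR_ge0// ler_wpM2r ?exprn_ge0 ?invr_ge0 ?(ltW t0)// ler_wpM2l//.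
  by apply: le_trans rV _; rewrite mulrDr expRD.
rewrite mulrDl opprD expRD le_eqVlt; apply/orP; left; apply/eqP.
have key (C' h u v z w : R) : u * v = 1 -> C' * (h * u) * z * (v * w) = C' * h * z * w.
  by move=> uv; rewrite -[RHS]mulr1 -uv; ring.
by apply: key; rewrite -expRD subrr expR0.
Qed.

Lemma entropy_sub (S : R -> set 'rV[R]_d.+1) (A : set 'rV[R]_d.+1) : compact A ->
  (forall r x, 0 < r -> S r x -> A x) -> entropy_le S d.+1.
Proof.
move=> /compact_sub_cball[D D0 AD] SA delta d0 d1.
exists (((2 * D + 1) / delta) ^+ d.+1), 1; split => //.
  by rewrite exprn_ge0// divr_ge0 ?addr_ge0 ?mulr_ge0// ltW.
move=> r l r0 r1 ld lS; have dr0 : 0 < delta * r by rewrite mulr_gt0.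
apply: le_trans (packing_cball (x := 0) dr0 (ltW D0) ld _) _.
  by move=> y /lS /(SA _ _ r0) /AD.
rewrite -exprMn; apply: lerXn2r; rewrite ?nnegrE.
- by rewrite divr_ge0 ?addr_ge0 ?mulr_ge0// ltW.
- by rewrite !mulr_ge0 ?addr_ge0 ?mulr_ge0 ?invr_ge0// ltW.
rewrite invfM mulrA ler_wpM2r ?invr_ge0 ?(ltW r0)// ler_wpM2r ?invr_ge0 ?(ltW d0)// lerD2l.
by rewrite -[leRHS]mulr1 ler_pM// ltW.
Qed.

Lemma entropy_nearb (A : set 'rV[R]_d.+1) : thin_boundary A -> entropy_le (nearb A) d.
Proof.
move=> [C C0 HC] delta d0 d1; exists (C * ((2 + delta) / delta) ^+ d.+1), 1; split => //.
  by rewrite mulr_ge0// exprn_ge0// divr_ge0 ?addr_ge0// ltW.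
move=> r l r0 r1 ld lS.
have Hm s' : dispersed r s' -> (forall x, x \in s' -> nearb A r x) ->
    (size s' <= (Num.trunc (C * r^-1 ^+ d)).+1)%N.
  move=> ss' sA'; rewrite ltnW// -(ltr_nat R) (le_lt_trans (HC r s' r0 r1 ss' sA'))//.
  exact: truncnS_gt.
have [Z [sZ ZA Znet]] := maximal_dispersed (ltW r0) Hm.
have := @dispersed_net _ _ (delta * r) r Z l (mulr_gt0 d0 r0) (ltW r0) ld (fun x xl => Znet x (lS x xl)).
rewrite (_ : (2 * r + delta * r) / (delta * r) = (2 + delta) / delta); last first.
  by field; rewrite !gt_eqF.
move=> /le_trans; apply; rewrite mulrAC ler_wpM2r ?HC//.
by rewrite exprn_ge0// divr_ge0 ?addr_ge0// ltW.
Qed.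

End union.

(** * Lower bound on the spacing radius *)

Section second_moment.
Context {disp} {T : measurableType disp} {R : realType} (P : probability T R).

(** Integrating a pointwise inequality between weighted indicators turns second moments into finite
    sums of probabilities. *)
Lemma sum_indic_le (I J : Type) (s : seq I) (t : seq J) (c : I -> R) (e : J -> R)
    (E : I -> set T) (F : J -> set T) :
  (forall i, 0 <= c i) -> (forall j, 0 <= e j) ->
  (forall i, measurable (E i)) -> (forall j, measurable (F j)) ->
  (forall w, \sum_(i <- s) c i * \1_(E i) w <= \sum_(j <- t) e j * \1_(F j) w) ->
  \sum_(i <- s) c i * fine (P (E i)) <= \sum_(j <- t) e j * fine (P (F j)).
Proof.
move=> c0 e0 mE mF H.
have int (K : Type) (u : seq K) (b : K -> R) (G : K -> set T) : (forall k, 0 <= b k) ->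
    (forall k, measurable (G k)) ->
    (\int[P]_w (\sum_(k <- u) b k * \1_(G k) w)%:E)%E = (\sum_(k <- u) b k * fine (P (G k)))%:E.
  move=> b0 mG; under eq_integral do rewrite -sumEFin.
  have mf k : measurable_fun setT (fun w => (b k * \1_(G k) w)%:E).
    by apply/measurable_EFinP; apply: measurable_funM => //; exact: measurable_indic.
  rewrite ge0_integral_sum//; last by move=> k w _; rewrite lee_fin mulr_ge0.
  rewrite -sumEFin; apply: eq_bigr => k _.
  under eq_integral do rewrite EFinM.
  rewrite ge0_integralZl ?lee_fin//; last by apply/measurable_EFinP; exact: measurable_indic.
  by rewrite integral_indic// setIT EFinM fineK// fin_num_measure.
rewrite -lee_fin -!int//; apply: ge0_le_integral => //.
- by move=> w _; rewrite lee_fin; apply: sumr_ge0 => i _; rewrite mulr_ge0.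
- apply/measurable_EFinP; apply: measurable_sum => i.
  by apply: measurable_funM => //; exact: measurable_indic.
- apply/measurable_EFinP; apply: measurable_sum => i.
  by apply: measurable_funM => //; exact: measurable_indic.
- by move=> w _; rewrite lee_fin.
Qed.

(* Chebyshev's inequality for the number of the [E i] that occur. *)
Lemma second_moment (m : nat) (E : 'I_m -> set T) (p : 'I_m -> R) :
  (forall i, measurable (E i)) -> (forall i, P (E i) = (p i)%:E) ->
  (forall i j, i != j -> (P (E i `&` E j) <= (p i * p j)%:E)%E) ->
  0 < \sum_i p i ->
  (P (\bigcap_i ~` E i) <= ((\sum_i p i)^-1)%:E)%E.
Proof.
move=> mE pE pEE; set a := \sum_i p i => a0.
have mV : measurable (\bigcap_i ~` E i).
  by apply: fin_bigcap_measurable => // i _; exact: measurableC.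
(* The inequality integrated is [1_V + 2 W / a <= 1 + W^2 / a^2], where [W] counts the events that
   occur and [V] is [W = 0]: an equality on [V], and [(1 - W / a)^2 >= 0] elsewhere. [None] carries
   the terms [1_V] and [1]. *)
pose c (o : option 'I_m) : R := if o is Some _ then 2 / a else 1.
pose F (o : option 'I_m) : set T := if o is Some i then E i else \bigcap_i ~` E i.
pose e (o : option ('I_m * 'I_m)) : R := if o is Some _ then a^-1 ^+ 2 else 1.
pose G (o : option ('I_m * 'I_m)) : set T := if o is Some q then E q.1 `&` E q.2 else setT.
have := @sum_indic_le _ _ (None :: map Some (index_enum 'I_m)) (None :: map Some (index_enum ('I_m * 'I_m)%type)) c e F G.
rewrite !big_cons !big_map /= !mul1r -!mulr_sumr.
have pe i : fine (P (E i)) = p i by rewrite pE.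
under [X in 2 / a * X]eq_bigr do rewrite pe.
rewrite -/a => H.
have {H} : fine (P (\bigcap_i ~` E i)) + 2 / a * a <=
    fine (P setT) + a^-1 ^+ 2 * \sum_(q : 'I_m * 'I_m) fine (P (E q.1 `&` E q.2)).
  apply: H.
  - by case=> [i|] //=; rewrite divr_ge0// ltW.
  - by case=> [q|] //=; rewrite exprn_ge0// invr_ge0 ltW.
  - by case.
  - by case=> [q|] //=; exact: measurableI.
  move=> w; rewrite !big_cons !big_map /= !mul1r -!mulr_sumr.
  rewrite (_ : \sum_(q : 'I_m * 'I_m) _ = (\sum_i \1_(E i) w) ^+ 2); last first.
    rewrite expr2 mulr_suml; under [RHS]eq_bigr do rewrite mulr_sumr.
    by rewrite pair_bigA/=; apply: eq_bigr => -[i j] _; rewrite indicI.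
  rewrite indicT /=; have [V|V] := pselect ((\bigcap_i ~` E i) w).
    rewrite (_ : \sum_i \1_(E i) w = 0).
      by rewrite mulr0 expr0n mulr0 !addr0 indicE; case: (_ \in _).
    by apply: big1 => i _; rewrite indicE memNset//; exact: V.
  rewrite [X in X + _]indicE memNset// add0r.
  move: (\sum_i _) => W; rewrite -exprMn -subr_ge0.
  rewrite (_ : _ - _ = (1 - a^-1 * W) ^+ 2) ?sqr_ge0//; ring.
rewrite probability_setT /= divfK ?gt_eqF// => H.
have S2 : \sum_(q : 'I_m * 'I_m) fine (P (E q.1 `&` E q.2)) <= a + a ^+ 2.
  apply: (@le_trans _ _ (\sum_(q : 'I_m * 'I_m) ((if q.1 == q.2 then p q.1 else 0) + p q.1 * p q.2))).
    apply: ler_sum => -[i j] _ /=; have [->|ij] := eqVneq i j.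
      rewrite setIid pE /= lerDl mulr_ge0// -lee_fin -pE; exact: measure_ge0.
    rewrite add0r -lee_fin fineK ?fin_num_measure//; first exact: pEE.
    exact: measurableI.
  rewrite big_split/= -(pair_bigA _ (fun i j => if i == j then p i else 0))/=.
  rewrite -(pair_bigA _ (fun i j => p i * p j))/= lerD//.
    apply: ler_sum => i _; rewrite (bigD1 i)//= eqxx big1 ?addr0// => j.
    by rewrite eq_sym => /negPf ->.
  by rewrite expr2 mulr_suml; apply: ler_sum => i _; rewrite mulr_sumr.
rewrite -[P _]fineK ?fin_num_measure// lee_fin.
have : a^-1 ^+ 2 * \sum_(q : 'I_m * 'I_m) fine (P (E q.1 `&` E q.2)) <= a^-1 ^+ 2 * (a + a ^+ 2).
  by rewrite ler_wpM2l// exprn_ge0// invr_ge0 ltW.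
rewrite (_ : a^-1 ^+ 2 * (a + a ^+ 2) = a^-1 + 1); last by field; rewrite gt_eqF.
move: H; lra.
Qed.

End second_moment.

Section empty_balls.
Context {disp} {T : measurableType disp} {R : realType} (P : probability T R).
Context {d : nat} (X : nat -> {RV P >-> borel_rV R d.+1}) (f : 'rV[R]_d.+1 -> R) (k : nat).
Hypotheses (X_indep : mutually_independent X) (X_density : forall i, has_density (X i) f).
Local Notation samp w := (fun i => X i w).
Local Notation leb := (@lebesgue_measure_rV R).
Local Notation mass := (@mass _ T R P d X).

Lemma npoints_eq0P (x : nat -> 'rV[R]_d.+1) n D :
  (npoints x n D < 1)%N <-> forall i, (i < n)%N -> ~ D (x i).
Proof.
rewrite /npoints size_filter ltnNge -has_count has_undup; split.
  move=> /hasPn H i ni Dx; have := H (x i); rewrite mem_set//.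
  by move=> /(_ _)/negP; apply=> //; apply/mapP; exists i => //; rewrite mem_iota.
move=> H; apply/hasPn => y /mapP[i]; rewrite mem_iota add0n => /= ni ->.
by rewrite memNset//; exact: H.
Qed.

Lemma prob_empty (B : set (borel_rV R d.+1)) n : measurable B ->
  P [set w | (npoints (samp w) n B < 1)%N] = ((1 - mass B) ^+ n)%:E.
Proof.
move=> mB; elim: n => [|n IH].
  by rewrite (_ : [set w | _] = setT) ?probability_setT//; apply/seteqP; split=> w.
rewrite (_ : [set w | _] = [set w | (npoints (samp w) n B < 1)%N] `&` X n @^-1` (~` B)); last first.
  apply/seteqP; split=> w /=.
    move=> /npoints_eq0P H; split; last exact: H.
    by apply/npoints_eq0P => i ni; apply: H; exact: ltnW.
  move=> [/npoints_eq0P H Hn]; apply/npoints_eq0P => i; rewrite ltnS leq_eqVlt.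
  by move=> /predU1P[->//|]; exact: H.
rewrite (indep_npoints X_indep)//; last exact: measurableC.
rewrite IH exprSr EFinM; congr (_ * _)%E.
rewrite preimage_setC probability_setC//.
  by rewrite -[P _]/(law X n B) (law_mass X_density).
by rewrite -[X in measurable X]setTI; exact: measurable_funPT.
Qed.

(** [1 - b - c <= (1 - b) (1 - c)]: emptiness of disjoint sets is negatively correlated, which is
    the hypothesis of [second_moment]. *)
Lemma prob_empty2 (B C : set (borel_rV R d.+1)) n : measurable B -> measurable C ->
  B `&` C = set0 ->
  (P ([set w | (npoints (samp w) n B < 1)%N] `&` [set w | (npoints (samp w) n C < 1)%N]) <=
   ((1 - mass B) ^+ n * (1 - mass C) ^+ n)%:E)%E.
Proof.
move=> mB mC BC; rewrite (_ : _ `&` _ = [set w | (npoints (samp w) n (B `|` C) < 1)%N]); last first.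
  apply/seteqP; split=> w /=.
    by move=> [/npoints_eq0P HB /npoints_eq0P HC]; apply/npoints_eq0P => i ni [/HB|/HC]; exact.
  by move=> /npoints_eq0P H; split; apply/npoints_eq0P => i ni ?; apply: (H i ni); [left|right].
have mBC : measurable (B `|` C) by exact: measurableU.
rewrite prob_empty// lee_fin -exprMn.
have E : mass (B `|` C) = mass B + mass C.
  apply: EFin_inj; rewrite EFinD -!(law_mass X_density 0)// measureU//.
have := mass_ge0 X B; have := mass_ge0 X C; have := mass_le1 X_density mBC; rewrite E => h1 h2 h3.
apply: lerXn2r; rewrite ?nnegrE; nra.
Qed.


Lemma cover_count n (x0 : 'rV[R]_n) (u t : R) (Z : seq 'rV[R]_n) : 0 < t -> 0 < u ->
  (forall x, cball x0 u x -> exists2 z, z \in Z & l2norm (x - z) <= t) ->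
  u ^+ n <= (size Z)%:R * t ^+ n.
Proof.
move=> t0 u0 H; have v0 : 0 < ballvol n :> R by exact: ballvol_gt0.
rewrite -(ler_pM2l v0) mulrCA -lee_fin -(lebesgue_measure_rV_cball x0)//.
pose B i : set (borel_rV R n) := cball (nth 0 Z i) t.
have mB i : measurable (B i) by exact: measurable_cball.
apply: (@le_trans _ _ (leb n (\big[setU/set0]_(i < size Z) B i))).
  apply: le_measure; rewrite ?inE; first exact: measurable_cball.
    by apply: bigsetU_measurable.
  move=> x /H[z zZ xz]; rewrite -bigcup_mkord; exists (index z Z); rewrite /= ?index_mem//.
  by rewrite /B nth_index.
apply: le_trans (Boole_inequality _ _) _; first by move=> i _.
rewrite (eq_bigr (fun=> (ballvol n * t ^+ n)%:E)); last first.
  by move=> i _; exact: lebesgue_measure_rV_cball.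
by rewrite sumEFin lee_fin sumr_const card_ord mulr_natl.
Qed.

Lemma ln_le_exp (eta x : R) : 0 < eta -> 0 < x -> ln x <= eta^-1 * expR (eta * ln x).
Proof.
move=> e0 x0; have := expR_ge1Dx (eta * ln x); move: (ln x) (expR _) => L E LE.
by rewrite mulrC ler_pdivlMr// mulrC; lra.
Qed.

(** [exp ((1 + e) p) (1 - p) >= (1 + (1 + e) p) (1 - p) >= 1] for [0 <= p <= e / (1 + e)]. *)
Lemma expn_1B_ge (p e : R) n : 0 <= p -> 0 < e -> p <= e / (1 + e) ->
  expR (- ((1 + e) * (n%:R * p))) <= (1 - p) ^+ n.
Proof.
move=> p0 e0 pe; have e1 : 0 < 1 + e by rewrite addr_gt0.
have p1 : 0 < 1 - p.
  by rewrite subr_gt0; apply: le_lt_trans pe _; rewrite ltr_pdivrMr// mul1r ltrDr.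
rewrite (_ : - _ = - ((1 + e) * p) * n%:R); last by ring.
rewrite expRM_natr; apply: lerXn2r; rewrite ?nnegrE ?expR_ge0 ?(ltW p1)//.
rewrite expRN -[leRHS]invrK lef_pV2 ?posrE ?expR_gt0 ?invr_gt0//.
apply: le_trans (expR_ge1Dx _); rewrite -(ler_pM2r p1) mulVf ?gt_eqF//.
by move: pe; rewrite ler_pdivlMr//; nra.
Qed.

(* The disjoint balls centred at a maximal separated subset of a ball on which [f] is
   nearly minimal are empty with nearly independent probabilities about [n ^ - c]. *)
Lemma radius_ge_poly_small (A : set 'rV[R]_d.+1) (f0 c : R) : (0 < k)%N ->
  compact A -> 0 < f0 -> 0 < c -> c < 1 ->
  (forall e, 0 < e -> exists x r, [/\ 0 < r, cball x r `<=` A &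
    forall y, cball x r y -> f y <= (1 + e) * f0]) ->
  exists2 eta, 0 < eta & poly_small P (fun n =>
    [set w | spacing_radius A (samp w) k n < rho d (ballvol d.+1 * f0) n c]) eta.
Proof.
move=> k0 cA f00 c0 c1 Hf; set th := ballvol d.+1 * f0.
have v0 : 0 < ballvol d.+1 :> R by exact: ballvol_gt0.
have th0 : 0 < th by rewrite mulr_gt0.
(* One factor [1 + e] comes from the density near its minimum, the other from bounding [1 - p] below
   by an exponential. About [n / ln n] balls, each empty with probability at least [n^-(1 - 2e)],
   have a mean number of order [n^(2e) / ln n]; one [n^e] absorbs the logarithm. *)
pose e := (1 - c) / 4; have e0 : 0 < e by rewrite divr_gt0// subr_gt0.
have ec : (1 + e) ^+ 2 * c <= 1 - 2 * e.
  by rewrite (_ : c = 1 - 4 * e); [move: e0; rewrite expr2; nra|rewrite /e; lra].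
exists e => //.
have [x0 [s [s0 sA fs]]] := Hf e e0.
have s40 : 0 < s / 4 by rewrite divr_gt0.
have [n0 Hn0] := @rho_small R d th th0 c (Num.min 1 (s / 4)) c0 ltac:(by rewrite lt_min ltr01).
have ee : 0 < e / (1 + e) / ((1 + e) * c) by apply: divr_gt0; [apply: divr_gt0|apply: mulr_gt0] => //; exact: addr_gt0.
have [n1 Hn1] := ln_le_mul ee.
pose K := (s / 4) ^+ d.+1 * th / c; have K0 : 0 < K by rewrite divr_gt0// mulr_gt0// exprn_gt0.
exists (K^-1 * e^-1), (maxn (maxn n0 n1) 4); split; first by rewrite mulr_ge0 ?invr_ge0// ltW.
move=> n; rewrite !geq_max => /andP[/andP[/Hn0 + /Hn1 nL] n4]; set r := rho d th n c.
rewrite lt_min => /andP[r1 rs]; have r0 : 0 < r by exact: rho_gt0.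
have n_gt0 : 0 < n%:R :> R by rewrite ltr0n; exact: leq_trans n4.
have L1 : 1 <= ln n%:R :> R by exact: ln_ge1.
have L0 : 0 < ln n%:R :> R by exact: lt_le_trans L1.
have rX : r ^+ d.+1 = c * ln n%:R / (n%:R * th) by apply: rhoX => //; exact: leq_trans n4.
have r20 : 0 < 2 * r by rewrite mulr_gt0.
have s20 : 0 < s / 2 by rewrite divr_gt0.
have HM l : dispersed (2 * r) l -> (forall x, x \in l -> cball x0 (s / 2) x) ->
    (size l <= Num.trunc (((2 * (s / 2) + 2 * r) / (2 * r)) ^+ d.+1))%N.
  move=> ld lS; rewrite truncn_ge_nat; first exact: (packing_cball r20 (ltW s20) ld lS).
  by rewrite exprn_ge0// divr_ge0 ?addr_ge0 ?mulr_ge0// ltW.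
have [Z [Zd ZS Znet]] := maximal_dispersed (ltW r20) HM.
have Zsize : K * n%:R / ln n%:R <= (size Z)%:R.
  have := cover_count r20 s20 Znet.
  rewrite (_ : s / 2 = 2 * (s / 4)); last by field.
  rewrite (@exprMn _ _ 2 (s / 4)) (@exprMn _ _ 2 r) [leRHS]mulrCA ler_pM2l ?exprn_gt0// rX.
  rewrite -ler_pdivrMr; last by rewrite divr_gt0 ?mulr_gt0.
  apply: le_trans; rewrite /K le_eqVlt; apply/orP; left; apply/eqP.
  by move: (_ ^+ d.+1) => u; field; rewrite !gt_eqF.
pose z (i : 'I_(size Z)) := nth 0 Z i.
pose E i := [set w | (npoints (samp w) n (cball (z i) r) < 1)%N].
have zx i : cball x0 (s / 2) (z i) by apply: ZS; rewrite mem_nth.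
have zs i : cball (z i) r `<=` cball x0 s.
  apply: cball_sub; move: (zx i); rewrite /cball /= => h.
  by rewrite [leRHS]splitr lerD//; move: rs; move: (s) (r) s0 => a b; lra.
have mz i : measurable (cball (z i) r : set (borel_rV R d.+1)) by exact: measurable_cball.
pose p i := (1 - mass (cball (z i) r)) ^+ n.
have pge i : expR (- ((1 - 2 * e) * ln n%:R)) <= p i.
  have mle : mass (cball (z i) r) <= (1 + e) * f0 * (ballvol d.+1 * r ^+ d.+1).
    apply: (mass_le X_density) => //; first by rewrite !mulr_ge0// ?addr_ge0// ltW.
      by move=> x /zs /fs.
    by rewrite lebesgue_measure_rV_cball.
  have mle' : mass (cball (z i) r) <= (1 + e) * c * ln n%:R / n%:R.
    apply: le_trans mle _; rewrite rX le_eqVlt; apply/orP; left; apply/eqP.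
    by rewrite /th; field; rewrite !gt_eqF.
  apply: le_trans (expn_1B_ge n (mass_ge0 _ _) e0 _); last first.
    apply: le_trans mle' _; rewrite ler_pdivrMr// mulrC -ler_pdivlMr; last first.
      by rewrite mulr_gt0// addr_gt0.
    by apply: le_trans nL _; rewrite mulrAC.
  rewrite ler_expR lerN2.
  apply: (@le_trans _ _ ((1 + e) * (n%:R * ((1 + e) * c * ln n%:R / n%:R)))).
    by rewrite ler_wpM2l ?addr_ge0 ?(ltW e0)// ler_wpM2l.
  rewrite (_ : (1 + e) * _ = (1 + e) ^+ 2 * c * ln n%:R); last by field; rewrite gt_eqF.
  by rewrite ler_wpM2r// ltW.
have p0 i : 0 < p i by apply: lt_le_trans (pge i); exact: expR_gt0.
have ple : K * expR (2 * e * ln n%:R) / ln n%:R <= \sum_i p i.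
  apply: (@le_trans _ _ (\sum_(i < size Z) expR (- ((1 - 2 * e) * ln n%:R)))).
    rewrite sumr_const card_ord -[leRHS]mulr_natl.
    apply: le_trans (ler_wpM2r (expR_ge0 _) Zsize).
    rewrite (_ : - _ = 2 * e * ln n%:R - ln n%:R); last by ring.
    rewrite expRD expRN lnK// le_eqVlt; apply/orP; left; apply/eqP.
    by field; rewrite !gt_eqF.
  by apply: ler_sum.
exists (\bigcap_i ~` E i); split.
- by apply: fin_bigcap_measurable => // i _; apply: measurableC; exact: measurable_samp_npoints.
- move=> w /= Rw i _ /= /npoints_eq0P Ew.
  have [_ /(_ (z i))] := spacing_radius_lt cA Rw.
  have zi : inner_set A r (z i).
    split; last by apply: subset_trans sA; exact: zs.
    by apply: sA; apply: (zs i); rewrite /cball /= subrr l2norm0 ltW.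
  move=> /(_ zi); rewrite leqNgt => /negP; apply; apply: leq_trans k0.
  exact/npoints_eq0P.
have pp : 0 < \sum_i p i.
  by apply: lt_le_trans ple; rewrite divr_gt0// mulr_gt0// expR_gt0.
have pE i : P (E i) = (p i)%:E by apply: prob_empty.
apply: le_trans (@second_moment _ _ _ P _ E p _ pE _ pp) _.
- by move=> i; exact: measurable_samp_npoints.
- move=> i j ij; apply: prob_empty2 => //; apply/seteqP; split=> // y [yi yj].
  have := dispersed_nth Zd (ltn_ord i) (ltn_ord j) ij; rewrite ltNge => /negP; apply.
  apply: le_trans (l2norm_triangle _ y _) _; rewrite mulr_natl mulr2n lerD//.
  by rewrite l2normC.
rewrite lee_fin; apply: (@le_trans _ _ (K * expR (2 * e * ln n%:R) / ln n%:R)^-1).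
  by rewrite lef_pV2 ?posrE// divr_gt0// mulr_gt0// expR_gt0.
clearbody K e; rewrite -[leRHS]mulrA invf_div invfM [leLHS]mulrCA.
rewrite ler_wpM2l ?invr_ge0 ?(ltW K0)//.
rewrite -expRN; apply: le_trans (ler_wpM2r (expR_ge0 _) (ln_le_exp e0 n_gt0)) _.
by rewrite -[leLHS]mulrA ler_wpM2l ?invr_ge0 ?(ltW e0)// -expRD ler_expR; lra.
Qed.

End empty_balls.

(** * Typical samples *)

Section powers.
Context {R : realType}.

Lemma power_ratio (q : nat) (delta : R) : 0 < delta ->
  exists j0, forall j, (j0 <= j)%N -> (j.+2 ^ q)%:R <= (1 + delta) * (j.+1 ^ q)%:R.
Proof.
move=> d0; have d1 : 1 < 1 + delta by rewrite ltrDl.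
have L0 : 0 < ln (1 + delta) by rewrite ln_gt0.
exists (Num.trunc (q%:R / ln (1 + delta))) => j hj.
have j0 : 0 < j.+1%:R :> R by [].
rewrite !natrX -ler_pdivrMr ?exprn_gt0// -expr_div_n.
have -> : j.+2%:R / j.+1%:R = 1 + j.+1%:R^-1 :> R by rewrite -natr1; field; rewrite gt_eqF.
apply: (@le_trans _ _ (expR (j.+1%:R^-1) ^+ q)).
  by apply: lerXn2r; rewrite ?nnegrE ?expR_ge0 ?addr_ge0 ?invr_ge0// expR_ge1Dx.
rewrite -expRM_natr -[leRHS]lnK ?posrE ?ler_expR; last exact: lt_trans d1.
rewrite mulrC ler_pdivrMr// mulrC -ler_pdivrMr//.
by apply: le_trans (ltW (truncnS_gt _)) _; rewrite ler_nat ltnS.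
Qed.

(** Carries information along powers to all [n] for monotone quantities: [n] lies between
    consecutive powers, whose ratio tends to 1. *)
Lemma power_sandwich (q n0 : nat) (delta : R) (E : nat -> Prop) : (0 < q)%N -> 0 < delta ->
  (\forall j \near \oo, E (j.+1 ^ q)%N) ->
  \forall n \near \oo, exists M M', [/\ E M /\ E M', (n0 <= M)%N, (M <= n)%N, (n <= M')%N &
    M'%:R <= (1 + delta) * M%:R].
Proof.
move=> q0 d0 [j1 _ Ej]; have [j2 Hj2] := power_ratio q d0.
pose j0 := maxn (maxn j1 j2) n0; exists (j0.+1 ^ q)%N => // n /= hn.
have jq j : (j <= j.+1 ^ q)%N.
  case: q q0 {Ej Hj2 hn} => // q _; rewrite expnS.
  by apply: leq_trans (leqnSn _) _; rewrite leq_pmulr// expn_gt0.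
have ex : exists j, (j.+1 ^ q <= n)%N by exists j0.
have bd j : (j.+1 ^ q <= n)%N -> (j <= n)%N by exact: leq_trans.
have [j jn jmax] := ex_maxnP ex bd.
have j0j : (j0 <= j)%N by exact: jmax.
have nj : (n <= j.+2 ^ q)%N.
  by rewrite leqNgt; apply/negP => /ltnW /jmax; rewrite ltnn.
move: j0j; rewrite !geq_max => /andP[/andP[h1 h2] h3].
exists (j.+1 ^ q)%N, (j.+2 ^ q)%N; split => //; last exact: Hj2.
- by split; apply: Ej => //=; apply: leq_trans h1 _.
- exact: leq_trans (jq j).
Qed.

End powers.

Lemma filterS4 (S : Type) (F : set_system S) {FF : Filter F} (P1 P2 P3 P4 Q : set S) :
  (forall x, P1 x -> P2 x -> P3 x -> P4 x -> Q x) -> F P1 -> F P2 -> F P3 -> F P4 -> F Q.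
Proof.
move=> H F1 F2 F3 F4; have F34 : F (P3 `&` P4) by exact: filterI.
by move: F1 F2 F34; apply: filterS3 => x p1 p2 [p3 p4]; exact: H.
Qed.

Section tight.
Context {disp} {T : measurableType disp} {R : realType} (P : probability T R).
Context {d : nat} (X : nat -> {RV P >-> borel_rV R d.+1}) (f : 'rV[R]_d.+1 -> R) (k : nat).
Context (A : set 'rV[R]_d.+1).
Hypotheses (X_indep : mutually_independent X) (X_density : forall i, has_density (X i) f).
Hypotheses (A_compact : compact A) (A_interior : A° !=set0) (A_regular : closure A° = A).
Hypotheses (f_support : closure [set x | f x != 0] = A) (f_cont : {within A, continuous f}).
Hypotheses (f_inf : 0 < inf (f @` A)) (A_thin : thin_boundary A) (k_gt0 : (0 < k)%N).
Local Notation samp w := (fun i => X i w).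
Local Notation f0 := (inf (f @` A)).
Local Notation th := (ballvol d.+1 * f0).
Local Notation rad x n := (spacing_radius A x k n).
Local Notation rh := (rho d th).

Definition heavy (e r : R) : set 'rV[R]_d.+1 :=
  [set x | cball x r `<=` A /\ (1 + 8 * e) * f0 < f x].

Definition fits (r : R) : set 'rV[R]_d.+1 := [set x | cball x r `<=` A].

(* The radius is bounded from both sides, and there are no holes where [f] is not
   nearly minimal and none next to the boundary. *)
Definition typical (e : R) (w : T) (n : nat) : Prop :=
  [/\ ~ has_hole X k n (rh n (1 + e)) (fits (rh n (1 + e))) w,
      rh n (1 - e) <= rad (samp w) n,
      ~ has_hole X k n (rh n (1 - 2 * e)) (heavy e (rh n (1 - 2 * e))) w &
      ~ has_hole X k n (rh n (1 - 2 * e)) (nearb A (rh n (1 - 2 * e))) w].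

Let th0 : 0 < th.
Proof. by rewrite mulr_gt0// ballvol_gt0. Qed.

Let f_ge0 x : 0 <= f x.
Proof. by have [_ + _] := X_density 0%N. Qed.

Lemma fits_in r x : 0 <= r -> fits r x -> A x.
Proof. by move=> r0; apply; rewrite /cball/= subrr l2norm0. Qed.

Lemma typical_rare e : 0 < e -> e * (8 * d.+1%:R) <= 1 ->
  exists2 q, (0 < q)%N & {ae P, forall w, \forall j \near \oo, typical e w (j.+1 ^ q)%N}.
Proof.
move=> e0 ed; have d1 : 1 <= d.+1%:R :> R by rewrite ler1n.
have e8 : e * 8 <= 1 by apply: le_trans ed; rewrite ler_wpM2l ?(ltW e0)// ler_peMr.
have v0 : 0 < ballvol d.+1 :> R by exact: ballvol_gt0.
have c2 : 0 < 1 - 2 * e by lra.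
have fa : f0 * ballvol d.+1 / th = 1 by rewrite [f0 * _]mulrC divff// gt_eqF.
have low r x y : 0 < r -> cball x r `<=` A -> cball x r y -> f0 <= f y.
  by move=> r0 xA /xA; exact: density_ge_inf.
have U1 : rare P (fun n => has_hole X k n (rh n (1 + e)) (fits (rh n (1 + e)))).
  apply: (@rare_poly_small _ _ _ _ _ (e / 2)); first by rewrite divr_gt0.
  apply: (@hole_poly_small _ _ _ _ _ _ f k X_indep X_density _ f0 _ _ d.+1) => //.
  - by rewrite addr_gt0.
  - by rewrite divr_ge0// ltW.
  - by apply: (entropy_sub A_compact) => r x /ltW r0; exact: fits_in.
  - by exists 1 => // r x y r0 _; exact: low.
  - by rewrite fa mulr1 divff ?pnatr_eq0//; lra.
have U2 : rare P (fun n => [set w | rad (samp w) n < rh n (1 - e)]).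
  have [|||eta eta0] := @radius_ge_poly_small _ _ _ P d X f k X_indep X_density A f0 (1 - e) k_gt0 A_compact f_inf.
  - lra.
  - lra.
  - exact: density_near_inf.
  exact: rare_poly_small.
have U3 : rare P (fun n => has_hole X k n (rh n (1 - 2 * e)) (heavy e (rh n (1 - 2 * e)))).
  have ef0 : 0 < 4 * e * f0 by rewrite !mulr_gt0.
  have [r1 r10 Hr1] := density_unif A_compact f_cont ef0.
  (* Half of the excess [8 e] at the centre is given up to uniform continuity; the remaining factor
     [1 + 4 e] on the whole ball still outweighs the smaller volume [1 - 2 e]. *)
  have h : 0 < (1 - 2 * e) * (1 + 4 * e) - 1 by nra.
  apply: (@rare_poly_small _ _ _ _ _ (((1 - 2 * e) * (1 + 4 * e) - 1) / 2)); first by rewrite divr_gt0.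
  apply: (@hole_poly_small _ _ _ _ _ _ f k X_indep X_density _ ((1 + 4 * e) * f0) _ _ d.+1) => //.
  - by rewrite mulr_gt0// addr_gt0// mulr_gt0.
  - by rewrite divr_ge0// ltW.
  - by apply: (entropy_sub A_compact) => r x /ltW r0 [+ _]; exact: fits_in.
  - exists r1 => // r x y r0 rr1 [xA fx] xy.
    have := Hr1 x y (fits_in (ltW r0) xA) (xA _ xy); rewrite l2normC => /(_ (le_trans xy (ltW rr1))).
    by rewrite ler_norml => /andP[_]; move: fx; lra.
  - by rewrite -[(1 + 4 * e) * f0 * _]mulrA -[_ * _ / _]mulrA fa mulr1 divff ?pnatr_eq0//; lra.
have U4 : rare P (fun n => has_hole X k n (rh n (1 - 2 * e)) (nearb A (rh n (1 - 2 * e)))).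
  (* This dictates the bound on [e]: the boundary layer gains [1 / d.+1] in the exponent, which must
     pay for the reduced volume [1 - 2 e] and leave the decay [e]. *)
  have h : d%:R / d.+1%:R <= 1 - 8 * e.
    rewrite ler_pdivrMr// mulrBl mul1r -natr1; move: ed; rewrite -natr1; lra.
  apply: (@rare_poly_small _ _ _ _ _ e) => //.
  apply: (@hole_poly_small _ _ _ _ _ _ f k X_indep X_density _ f0 _ _ d) => //.
  - exact: ltW.
  - exact: entropy_nearb.
  - by exists 1 => // r x y r0 _ [xA _]; exact: low r0 xA.
  - by rewrite fa mulr1; apply: le_lt_trans (lerD h (lexx e)) _; lra.
have [q1 H1] := U1; have [q2 H2] := U2; have [q3 H3] := U3; have [q4 H4] := U4.
exists (maxn (maxn q1 q2) (maxn q3 q4)).+1 => //; set q := _.+1.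
have /H1 {}H1 : (q1 <= q)%N by rewrite /q ltnW// ltnS !leq_max leqnn.
have /H2 {}H2 : (q2 <= q)%N by rewrite /q ltnW// ltnS !leq_max leqnn !orbT.
have /H3 {}H3 : (q3 <= q)%N by rewrite /q ltnW// ltnS !leq_max leqnn !orbT.
have /H4 {}H4 : (q4 <= q)%N by rewrite /q ltnW// ltnS !leq_max leqnn !orbT.
move: H1 H2 H3 H4; apply: filterS4 => w H1 H2 H3 H4.
move: H1 H2 H3 H4; apply: filterS4 => j H1 /negP H2 H3 H4.
by split; [exact: H1|rewrite leNgt; exact: H2|exact: H3|exact: H4].
Qed.


Lemma rhoMth (n : nat) (c : R) : (2 <= n)%N -> 0 < c ->
  rh n c ^+ d.+1 * th = c * ln n%:R / n%:R.
Proof.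
move=> n2 c0; rewrite rhoX//; move: th0; move: th => t t0.
by rewrite invfM mulrA mulfVK// gt_eqF.
Qed.

Lemma lt_rho (m n : nat) (c c' : R) (m2 : (2 <= m)%N) (n2 : (2 <= n)%N) : 0 < c -> 0 < c' ->
  c * ln m%:R / m%:R < c' * ln n%:R / n%:R -> rh m c < rh n c'.
Proof.
move=> c0 c'0 H; rewrite -(@ltr_pXn2r _ d.+1) ?nnegrE ?(ltW (rho_gt0 _ _ _ _))//.
by rewrite -(ltr_pM2r th0) !rhoMth.
Qed.

Lemma not_has_hole n r S w x : ~ has_hole X k n r S w ->
  (npoints (samp w) n (cball x r) < k)%N -> ~ S x.
Proof. by move=> H xk Sx; apply: H; exists x. Qed.

(* Adding [y] to the sample of size [n] lowers the radius iff [y] lies in [oball c (rad x n)],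
   up to repeated points. *)
Definition tight (e : R) (x : nat -> 'rV[R]_d.+1) (n : nat) : Prop := exists c,
  [/\ holes A k x n c, forall c', holes A k x n c' -> c' = c,
      npoints x n (oball c (rad x n)) = k.-1,
      forall y, oball c (rad x n) y -> f y <= (1 + 10 * e) * f0 &
      (1 - e) / (1 + e) * (ln n%:R / n%:R) <= th * rad x n ^+ d.+1 <=
      (1 + e) ^+ 2 * (ln n%:R / n%:R)].

(** A hole at [n] contains a ball of radius [s < r] that held fewer than [k] points already at [M];
    what [typical] excludes at [M] is therefore excluded for every hole at [n]. The radius at [n] is
    trapped between those at [M] and [M']. *)
Lemma typical_tight e w (r1 : R) (M n M' : nat) : 0 < e -> e * 8 <= 1 ->
  generic (samp w) -> typical e w M -> typical e w M' -> (4 <= M)%N -> (M <= n)%N ->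
  (n <= M')%N -> M'%:R <= (1 + e) * M%:R -> rh M (1 + e) < r1 ->
  (forall x y, A x -> A y -> l2norm (x - y) <= r1 -> `|f x - f y| <= 2 * e * f0) ->
  tight e (samp w) n.
Proof.
move=> e0 e8 gw [M1 _ M3 M4] [_ M'2 _ _] M4' Mn nM' M'M rr1 Hr1.
set x := samp w; set r := rad x n.
have n4 : (4 <= n)%N := leq_trans M4' Mn.
have M'4 : (4 <= M')%N := leq_trans n4 nM'.
have [M2 n2 M'2'] : [/\ (2 <= M)%N, (2 <= n)%N & (2 <= M')%N] by split; exact: (@leq_trans 4).
have Mgt : 0 < M%:R :> R by rewrite ltr0n; exact: leq_trans M2.
have ngt : 0 < n%:R :> R by rewrite ltr0n; exact: leq_trans n2.
have M'gt : 0 < M'%:R :> R by rewrite ltr0n; exact: leq_trans M'2'.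
have MnR : M%:R <= n%:R :> R by rewrite ler_nat.
have nM'R : n%:R <= M'%:R :> R by rewrite ler_nat.
have LMn : ln M%:R <= ln n%:R :> R by rewrite ler_ln ?posrE.
have LnM' : ln n%:R <= ln M'%:R :> R by rewrite ler_ln ?posrE.
have LM : 1 <= ln M%:R :> R by exact: ln_ge1.
have r0 : 0 < r by exact: spacing_radius_gt0.
have c1 : 0 < 1 - e by lra.
have c2 : 0 < 1 - 2 * e by lra.
have c3 : 0 < 1 + e by lra.
have rM : rad x M <= rh M (1 + e).
  apply: spacing_radius_le => //; split; first exact: rho_gt0.
  move=> y [Ay yA]; rewrite leqNgt; apply/negP => yk; exact: (not_has_hole M1 yk).
have rle : r <= rh M (1 + e) by apply: le_trans rM; exact: spacing_radius_homo.
have rge : rh M' (1 - e) <= r by apply: le_trans M'2 _; exact: spacing_radius_homo.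
pose s := rh M (1 - 2 * e).
have s0 : 0 < s by exact: rho_gt0.
(* [(1 - 2 e) (1 + e) < 1 - e]: the gap between the two constants pays for the ratio of [M'] to
   [M]. *)
have sr : s < r.
  apply: lt_le_trans rge; apply: lt_rho => //.
  rewrite ltr_pdivrMr// mulrAC ltr_pdivlMr//.
  move: LM LMn LnM' M'M Mgt M'gt; move: (ln M%:R) (ln n%:R) (ln M'%:R) => a b g.
  move: (M%:R) (M'%:R) => u v.
  move=> a1 ab bg vu u0 v0; have ag : a <= g := le_trans ab bg.
  have h1 : (1 - 2 * e) * a * v <= (1 - 2 * e) * a * ((1 + e) * u).
    by rewrite ler_wpM2l// mulr_ge0 ?(ltW c2)//; apply: le_trans a1.
  apply: le_lt_trans h1 _; rewrite (_ : _ * _ * _ = (1 - 2 * e) * (1 + e) * (a * u)); last by ring.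
  rewrite -mulrA; apply: (@lt_le_trans _ _ ((1 - e) * (a * u))).
    by rewrite mulrA ltr_pM2r; [nra|rewrite mulr_gt0//; apply: lt_le_trans a1].
  by rewrite mulrA ler_wpM2r ?(ltW u0)// ler_wpM2l ?(ltW c1).
(* [1 + e < 2 (1 - 2 e)]. Not being in [nearb] at scale [s] thus leaves the room [2 s - r] around a
   hole of radius [r]. *)
have r2s : r < 2 * s.
  apply: le_lt_trans rle _; rewrite -(@ltr_pXn2r _ d.+1) ?nnegrE ?(ltW (rho_gt0 _ _ _ _)) ?mulr_ge0 ?(ltW s0)//.
  rewrite exprMn !rhoX//.
  rewrite -!mulrA (mulrA (2 ^+ _)) ltr_pM2r; last first.
    by apply: divr_gt0; [exact: (lt_le_trans ltr01 LM)|exact: mulr_gt0].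
  apply: (@lt_le_trans _ _ (2 * (1 - 2 * e))); first lra.
  rewrite ler_wpM2r ?(ltW c2)// exprS ler_peMr//.
  by rewrite exprn_ege1// ler1n.
have interior c : holes A k x n c -> [/\ cball c (2 * s) `<=` A & f c <= (1 + 8 * e) * f0].
  move=> [cA ck]; have csk : (npoints x M (cball c s) < k)%N.
    apply: leq_ltn_trans ck; apply: leq_trans (npoints_homo _ _ Mn) _.
    by apply: le_npoints; exact: cball_oball.
  have csA : cball c s `<=` A by apply: subset_trans cA; apply: le_cball; exact: ltW.
  split.
    by have := not_has_hole M4 csk; rewrite /nearb/= => /not_andP[|/contrapT].
  have := not_has_hole M3 csk; rewrite /heavy/= => /not_andP[//|/negP].
  by rewrite -leNgt.
have eta0 : 0 < 2 * s - r by rewrite subr_gt0.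
have rs : r + (2 * s - r) = 2 * s by rewrite addrC subrK.
have [c ch] := holes_nonempty A_compact r0.
have [cA fc] := interior c ch.
exists c; split => //.
- move=> c' c'h; have [c'A _] := interior c' c'h.
  by apply: (hole_unique A_compact A_interior k_gt0 gw eta0 _ c'h _ ch); rewrite rs.
- by apply: (hole_count A_compact A_interior k_gt0 gw eta0 _ ch); rewrite rs.
- move=> y yc; have Ay : A y by apply: ch.1; exact: oball_cball.
  have Ac : A c by apply: ch.1; rewrite /cball/= subrr l2norm0 ltW.
  have := Hr1 y c Ay Ac (le_trans (ltW yc) (le_trans rle (ltW rr1))).
  by rewrite ler_norml => /andP[_]; move: fc; lra.
have rX : th * r ^+ d.+1 <= (1 + e) * (ln M%:R / M%:R).
  rewrite mulrA -rhoMth// mulrC ler_pM2r//.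
  by apply: lerXn2r; rewrite ?nnegrE ?(ltW r0) ?(ltW (rho_gt0 _ _ _ _)).
have rX' : (1 - e) * (ln M'%:R / M'%:R) <= th * r ^+ d.+1.
  rewrite mulrA -rhoMth// [leRHS]mulrC ler_pM2r//.
  by apply: lerXn2r; rewrite ?nnegrE ?(ltW r0) ?(ltW (rho_gt0 _ _ _ _)).
apply/andP; split.
  apply: le_trans rX'; rewrite -mulrA ler_wpM2l ?(ltW c1)//.
  rewrite ler_pdivrMl// mulrA ler_pdivrMr// mulrAC ler_pdivlMr//.
  have vn : M'%:R <= (1 + e) * n%:R by apply: le_trans M'M _; rewrite ler_pM2l.
  have L0 : 0 <= ln n%:R :> R by apply: le_trans LMn; apply: le_trans LM.
  by rewrite [leRHS]mulrAC [leRHS]mulrC; apply: ler_pM => //; exact: ltW.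
apply: (le_trans rX); rewrite expr2 -mulrA ler_wpM2l ?(ltW c3)//.
rewrite ler_pdivrMr// mulrA mulrAC ler_pdivlMr//.
have vn : n%:R <= (1 + e) * M%:R by apply: le_trans nM'R M'M.
have L0 : 0 <= ln M%:R :> R by apply: le_trans LM.
by rewrite [leRHS]mulrAC [leRHS]mulrC; apply: ler_pM => //; exact: ltW.
Qed.

Lemma tight_ae e : 0 < e -> e * (8 * d.+1%:R) <= 1 ->
  {ae P, forall w, \forall n \near \oo, tight e (samp w) n}.
Proof.
move=> e0 ed; have d1 : 1 <= d.+1%:R :> R by rewrite ler1n.
have e8 : e * 8 <= 1 by apply: le_trans ed; rewrite ler_wpM2l ?(ltW e0)// ler_peMr.
have [q q0 Hq] := typical_rare e0 ed.
have ef0 : 0 < 2 * e * f0 by rewrite !mulr_gt0.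
have [r1 r10 Hr1] := density_unif A_compact f_cont ef0.
have e1 : 0 < 1 + e by rewrite addr_gt0.
have [n0 Hn0] := @rho_small R d th th0 (1 + e) r1 e1 r10.
have := ae_generic X_indep X_density; move: Hq; apply: filterS2 => w Hw gw.
have := power_sandwich (maxn n0 4) q0 e0 Hw; apply: filterS => n [M [M' [[tM tM'] + Mn nM' MM']]].
rewrite geq_max => /andP[/Hn0 rr1 M4].
exact: (typical_tight e0 e8 gw tM tM' M4 Mn nM' MM' rr1 Hr1).
Qed.

End tight.

(** * Conditional probability of a record *)

Section gain.
Context {disp} {T : measurableType disp} {R : realType} (P : probability T R).
Context {d : nat} (X : nat -> {RV P >-> borel_rV R d.+1}) (f : 'rV[R]_d.+1 -> R) (k : nat).
Context (A : set 'rV[R]_d.+1).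
Hypotheses (X_indep : mutually_independent X) (X_density : forall i, has_density (X i) f).
Hypotheses (A_compact : compact A) (A_interior : A° !=set0) (k_gt0 : (0 < k)%N).
Local Notation samp w := (fun i => X i w).
Local Notation f0 := (inf (f @` A)).
Local Notation th := (ballvol d.+1 * f0).
Local Notation rad x n := (spacing_radius A x k n).
Local Notation mass := (@mass _ T R P d X).

Definition gain (x : nat -> 'rV[R]_d.+1) (n : nat) : set (borel_rV R d.+1) :=
  [set y | rad (upd x n y) n.+1 < rad x n].

(* The conditional probability of a record at time [n.+1]. *)
Definition gain_prob (x : nat -> 'rV[R]_d.+1) (n : nat) : R := mass (gain x n).

Lemma measurable_gain_graph {disp'} {S : measurableType disp'} (x : S -> nat -> 'rV[R]_d.+1) n :
  (forall j, measurable_fun setT (fun w => x w j : borel_rV R d.+1)) ->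
  measurable [set z : S * borel_rV R d.+1 | gain (x z.1) n z.2].
Proof.
move=> mx; apply: measurable_lt_set; apply: measurable_spacing_radius => // j.
  rewrite /upd; case: (j == n); first exact: measurable_snd.
  exact: (measurableT_comp (mx j) measurable_fst).
exact: (measurableT_comp (mx j) measurable_fst).
Qed.

Lemma measurable_gain x n : measurable (gain x n).
Proof.
apply: measurable_lt_set; last exact: measurable_cst.
apply: measurable_spacing_radius => // j.
by rewrite /upd; case: (j == n); [exact: measurable_id|exact: measurable_cst].
Qed.

Lemma measurable_gain_prob {disp'} {S : measurableType disp'} (x : S -> nat -> 'rV[R]_d.+1) n :
  (forall j, measurable_fun setT (fun w => x w j : borel_rV R d.+1)) ->
  measurable_fun setT (fun w => gain_prob (x w) n).
Proof.
move=> mx; apply/measurable_EFinP.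
have := measurable_fun_xsection (law X 0) (measurable_gain_graph n mx).
congr (measurable_fun _ _); apply/funext => w /=.
rewrite /gain_prob -(law_mass X_density 0); last exact: measurable_gain.
by congr (law X 0 _); apply/seteqP; split=> y; rewrite /xsection/= inE.
Qed.

Lemma eq_gain x x' n : (forall i, (i < n)%N -> x i = x' i) -> gain x n = gain x' n.
Proof.
move=> xx'; apply/funext => y; rewrite /gain/=.
rewrite (@eq_spacing_radius _ _ A k x x' n)//.
rewrite (@eq_spacing_radius _ _ A k (upd x n y) (upd x' n y) n.+1)// => i ni.
by rewrite /upd; case: eqP => // /eqP iN; apply: xx'; rewrite ltn_neqAle iN.
Qed.

Lemma gain_prob_ge0 x n : 0 <= gain_prob x n.
Proof. exact: mass_ge0. Qed.

Lemma gain_prob_le1 x n : gain_prob x n <= 1.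
Proof. by apply: (mass_le1 X_density); exact: measurable_gain. Qed.

Lemma gain_prob_le x n (b : R) : 0 <= b ->
  (forall c, holes A k x n c -> forall y, oball c (rad x n) y -> f y <= b) ->
  gain_prob x n <= b * (ballvol d.+1 * rad x n ^+ d.+1).
Proof.
move=> b0 fb; have r0 : 0 < rad x n by exact: spacing_radius_gt0.
have [c ch] := holes_nonempty A_compact r0.
apply: (@le_trans _ _ (mass (oball c (rad x n)))).
  apply: (le_mass X_density); [exact: measurable_gain|exact: measurable_oball|].
  by move=> y; exact: record_in_holes.
apply: (mass_le X_density) => //; first exact: measurable_oball.
  exact: fb.
exact: lebesgue_measure_rV_oball_le.
Qed.

Lemma mass_seq (s : seq 'rV[R]_d.+1) :
  measurable ([set` s] : set (borel_rV R d.+1)) /\ mass [set` s] = 0.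
Proof.
have m1 (x : 'rV[R]_d.+1) : measurable ([set x] : set (borel_rV R d.+1)).
  by apply: measurable_compact_rV; exact: compact_set1.
elim: s => [|x s [ms s0]].
  by rewrite set_nil; split; [exact: measurable0|rewrite /mass measure0].
have -> : [set` x :: s] = [set x] `|` [set` s].
  apply/seteqP; split=> y /=; rewrite inE; first by move=> /orP[/eqP ->|]; [left|right].
  by move=> [->|->]; rewrite ?eqxx ?orbT.
split; first exact: measurableU.
apply/eqP; rewrite eq_le mass_ge0 andbT -lee_fin -(law_mass X_density 0); last exact: measurableU.
apply: le_trans (measureU2 _ _ _) _ => //.
rewrite [X in (_ + X)%E](law_mass X_density 0 ms) s0 adde0.
rewrite [leLHS](_ : _ = 0%E)//.
by apply: (law_null X_density 0 (m1 x)); exact: lebesgue_measure_rV1.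
Qed.

(** All points of the open ball of the unique hole yield a record, except the sampled ones, a finite
    set of mass 0. *)
Lemma gain_prob_ge e x n : 0 < e -> e <= 1 ->
  (forall y, A y -> f0 <= f y) -> 0 < f0 -> tight f k A e x n ->
  (1 - e) * (th * rad x n ^+ d.+1) <= gain_prob x n.
Proof.
move=> e0 e1 Hf f00 [c [ch cu ck _ _]]; have r0 : 0 < rad x n by exact: spacing_radius_gt0.
have [h1 h2] : 0 <= 1 - e /\ 1 - e < 1 by lra.
(* A closed ball of known volume is fitted into the open one: shrinking by [1 - t] loses the factor
   [(1 - t)^(d+1) >= 1 - e]. *)
have [t [t0 t1 tL]] := @choose_delta R d _ _ h1 h2.
rewrite mulr1 in tL.
have t10 : 0 < 1 - t by lra.
have mO : measurable (oball c (rad x n) : set (borel_rV R d.+1)) by exact: measurable_oball.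
have [mS S0] := mass_seq (mkseq x n).
apply: (@le_trans _ _ (mass (cball c ((1 - t) * rad x n)))).
  have tr : 0 < (1 - t) * rad x n by rewrite mulr_gt0.
  have := @mass_ge _ _ _ P _ X f X_density f0 (ballvol d.+1 * ((1 - t) * rad x n) ^+ d.+1)
    (cball c ((1 - t) * rad x n)) (measurable_cball _ _) (ltW f00).
  move=> H; apply: le_trans (H _ (lebesgue_measure_rV_cball _ tr)).
    rewrite mulrA (mulrC f0) exprMn (mulrA th) [leLHS]mulrCA mulrA.
    rewrite ler_wpM2r ?exprn_ge0 ?(ltW r0)// ler_wpM2l// mulr_ge0// ?(ltW f00)//.
    by rewrite ltW// ballvol_gt0.
  move=> y yc; apply: Hf; apply: ch.1; apply: le_cball yc.
  by rewrite ger_pMl// gerBl ltW.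
apply: (@le_trans _ _ (mass (oball c (rad x n)))).
  apply: (le_mass X_density) => //; first exact: measurable_cball.
  by apply: cball_oball; rewrite gtr_pMl// gtrBl.
rewrite -lee_fin -!(law_mass X_density 0)//; last exact: measurable_gain.
apply: (@le_trans _ _ (law X 0 (gain x n `|` [set` mkseq x n]))).
  apply: le_measure; rewrite ?inE//; first by apply: measurableU => //; exact: measurable_gain.
  move=> y yc; have [yS|yS] := boolP (y \in mkseq x n); first by right.
  by left; exact: (record_of_unique_hole A_compact k_gt0 r0 cu ck yc yS).
apply: le_trans (measureU2 _ _ _) _ => //; first exact: measurable_gain.
by rewrite [X in (_ + X)%E](law_mass X_density 0)// S0 adde0.
Qed.


(** The index is shifted: [x n] is the point number [n + 1], and the event is decided by the points
    up to [x n]. *)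
Definition is_rec (x : nat -> 'rV[R]_d.+1) (n : nat) : bool := is_record A x k n.+1.

Lemma is_rec_upd x n y : is_rec (upd x n y) n = (y \in gain x n).
Proof.
have ux : rad (upd x n y) n = rad x n.
  by apply: eq_spacing_radius => i ni; rewrite upd_neq// ltn_eqF.
by apply/idP/idP; rewrite inE /is_rec /is_record /gain /= ux.
Qed.

Lemma eq_is_rec x x' n : (forall i, (i <= n)%N -> x i = x' i) -> is_rec x n = is_rec x' n.
Proof.
move=> xx'; rewrite /is_rec /is_record /=.
rewrite (@eq_spacing_radius _ _ A k x x' n) ?(@eq_spacing_radius _ _ A k x x' n.+1)//.
by move=> i /ltnW; exact: xx'.
Qed.

(* A martingale, whose increments are orthogonal. *)
Definition discrepancy (x : nat -> 'rV[R]_d.+1) (n : nat) : R :=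
  \sum_(k <= l < n) ((is_rec x l)%:R - gain_prob x l).

Lemma eq_discrepancy x x' n : (forall i, (i < n)%N -> x i = x' i) ->
  discrepancy x n = discrepancy x' n.
Proof.
move=> xx'; apply: eq_big_nat => l /andP[_ ln]; rewrite (@eq_is_rec x x'); last first.
  by move=> i il; apply: xx'; exact: leq_ltn_trans ln.
by rewrite /gain_prob (@eq_gain x x')// => i il; apply: xx'; exact: ltn_trans ln.
Qed.

Lemma measurable_is_rec {disp'} {S : measurableType disp'} (x : S -> nat -> 'rV[R]_d.+1) n :
  (forall j, measurable_fun setT (fun w => x w j : borel_rV R d.+1)) ->
  measurable [set w | is_rec (x w) n].
Proof. by move=> mx; apply: measurable_lt_set; exact: measurable_spacing_radius. Qed.

Lemma measurable_is_recR {disp'} {S : measurableType disp'} (x : S -> nat -> 'rV[R]_d.+1) n :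
  (forall j, measurable_fun setT (fun w => x w j : borel_rV R d.+1)) ->
  measurable_fun setT (fun w => (is_rec (x w) n)%:R : R).
Proof.
move=> mx; have := @measurable_indic _ S R setT _ (measurable_is_rec n mx).
congr (measurable_fun _ _); apply/funext => w; rewrite indicE.
by have -> : (w \in [set w0 | is_rec (x w0) n]) = is_rec (x w) n by apply/idP/idP; rewrite inE.
Qed.

Lemma measurable_discrepancy {disp'} {S : measurableType disp'} (x : S -> nat -> 'rV[R]_d.+1) n :
  (forall j, measurable_fun setT (fun w => x w j : borel_rV R d.+1)) ->
  measurable_fun setT (fun w => discrepancy (x w) n).
Proof.
move=> mx; apply: measurable_sum => l; apply: measurable_funB; first exact: measurable_is_recR.
exact: measurable_gain_prob.
Qed.

Lemma measurable_samp j : measurable_fun setT (fun w => X j w : borel_rV R d.+1).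
Proof. exact: measurable_funPT. Qed.

Lemma measurable_samp_others n j :
  measurable_fun setT (fun w : others X n => upd (samp w) n 0 j : borel_rV R d.+1).
Proof.
have [->|jn] := eqVneq j n.
  by rewrite (_ : (fun _ => _) = cst 0); [exact: measurable_cst|apply/funext => w; rewrite upd_eq].
rewrite (_ : (fun _ => _) = (X j : others X n -> borel_rV R d.+1)).
  exact: (@measurable_others_RV _ _ _ P _ X n j jn).
by apply/funext => w; rewrite upd_neq.
Qed.

(* Conditionally on the first [n] points a record occurs with probability [gain_prob]. *)
Lemma integral_is_rec n (g : (nat -> 'rV[R]_d.+1) -> bool -> R) :
  (forall x b, 0 <= g x b) -> (forall x y b, g (upd x n y) b = g x b) ->
  (forall b, measurable_fun setT (fun w : others X n => g (upd (samp w) n 0) b)) ->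
  (\int[P]_w (g (samp w) (is_rec (samp w) n))%:E)%E =
  (\int[P]_w (g (samp w) true * gain_prob (samp w) n +
              g (samp w) false * (1 - gain_prob (samp w) n))%:E)%E.
Proof.
move=> g0 gu mg.
pose F (z : others X n * borel_rV R d.+1) : \bar R :=
  (g (upd (samp z.1) n z.2) (is_rec (upd (samp z.1) n z.2) n))%:E.
have FE z : F z = (g (samp z.1) true * \1_[set z : others X n * borel_rV R d.+1 | gain (samp z.1) n z.2] z +
    g (samp z.1) false * (1 - \1_[set z : others X n * borel_rV R d.+1 | gain (samp z.1) n z.2] z))%:E.
  rewrite /F !gu is_rec_upd indicE; congr EFin.
  have -> : (z \in [set z : others X n * borel_rV R d.+1 | gain (samp z.1) n z.2]) = (z.2 \in gain (samp z.1) n).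
    by apply/idP/idP; rewrite !inE.
  by case: (_ \in _) => /=; rewrite ?subrr ?subr0 ?mulr0 ?mulr1 ?addr0 ?add0r.
have gs b w : g (upd (samp w) n 0) b = g (samp w) b by exact: gu.
have gsamp (w : T) : gain (upd (samp w) n 0) n = gain (samp w) n.
  by apply: eq_gain => i ni; rewrite upd_neq// ltn_eqF.
have mG : measurable [set z : others X n * borel_rV R d.+1 | gain (samp z.1) n z.2].
  have := measurable_gain_graph n (@measurable_samp_others n).
  by congr measurable; apply/seteqP; split=> z /=; rewrite gsamp.
have mg' b : measurable_fun setT (fun z : others X n * borel_rV R d.+1 => g (samp z.1) b).
  have := measurableT_comp (mg b) (@measurable_fst _ _ (others X n) (borel_rV R d.+1)).
  by congr (measurable_fun _ _); apply/funext => z /=; rewrite gs.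
have mF : measurable_fun setT F.
  have EF : F = _ := funext FE; rewrite EF.
  apply/measurable_EFinP; apply: measurable_funD; apply: measurable_funM => //; last first.
    by apply: measurable_funB => //; exact: measurable_indic.
have F0 z : (0 <= F z)%E by rewrite lee_fin.
transitivity (\int[P]_w F (w, X n w))%E.
  by apply: eq_integral => w _; rewrite /F /= upd_id.
rewrite (freezing X_indep mF F0); apply: eq_integral => w _.
have mw := measurable_gain (samp w) n.
transitivity (\int[law X n]_y ((g (samp w) true)%:E * (\1_(gain (samp w) n) y)%:E +
    (g (samp w) false)%:E * (\1_(~` gain (samp w) n) y)%:E))%E.
  apply: eq_integral => y _; rewrite FE EFinD !EFinM /=.
  have E : ((w, y) \in [set z : others X n * borel_rV R d.+1 | gain (samp z.1) n z.2]) =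
      (y \in gain (samp w) n) by apply/idP/idP; rewrite !inE.
  by rewrite !indicE E in_setC; case: (y \in _); rewrite /= ?subrr ?subr0.
have mi (B : set (borel_rV R d.+1)) : measurable B ->
    measurable_fun setT (fun y : borel_rV R d.+1 => (\1_B y : R)%:E).
  by move=> mB; apply/measurable_EFinP; exact: measurable_indic.
have mC := measurableC mw.
rewrite ge0_integralD//.
- rewrite !ge0_integralZl ?lee_fin//; try exact: mi; try by move=> y _; rewrite lee_fin.
  have -> : (\int[law X n]_y (\1_(gain (samp w) n) y)%:E)%E = (gain_prob (samp w) n)%:E.
    by rewrite integral_indic// setIT; exact: (law_mass X_density n mw).
  have -> : (\int[law X n]_y (\1_(~` gain (samp w) n) y)%:E)%E = (1 - gain_prob (samp w) n)%:E.
    rewrite integral_indic// setIT; transitivity (1 - law X n (gain (samp w) n))%E.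
      exact: probability_setC.
    by rewrite (law_mass X_density n mw).
  by rewrite -!EFinM -EFinD.
- by move=> y _; rewrite -EFinM lee_fin mulr_ge0.
- by apply: emeasurable_funM => //; exact: mi.
- by move=> y _; rewrite -EFinM lee_fin mulr_ge0.
- by apply: emeasurable_funM => //; exact: mi.
Qed.

Lemma integral_gain_prob n :
  (\int[P]_w ((is_rec (samp w) n)%:R)%:E)%E = (\int[P]_w (gain_prob (samp w) n)%:E)%E.
Proof.
rewrite (@integral_is_rec n (fun _ b => b%:R)) //.
by apply: eq_integral => w _; rewrite mul1r mul0r addr0.
Qed.

(** Given the past, the increment has mean 0 and variance [p - p^2 <= p], so each step adds at most
    the mean of [p] to the mean square. *)
Lemma discrepancy_sqr n : (k <= n)%N ->
  (\int[P]_w ((discrepancy (samp w) n) ^+ 2)%:E <=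
   \sum_(k <= l < n) \int[P]_w (gain_prob (samp w) l)%:E)%E.
Proof.
elim: n => [|n IH].
  by rewrite leqNgt k_gt0.
rewrite leq_eqVlt => /predU1P[<-|]; last rewrite ltnS => kn.
  rewrite big_geq// (eq_integral (cst 0%E)) ?integral0// => w _.
  by rewrite /discrepancy big_geq// expr0n.
rewrite big_nat_recr//=.
have mp (l : nat) : measurable_fun setT (fun w => (gain_prob (samp w) l)%:E).
  by apply/measurable_EFinP; apply: measurable_gain_prob; exact: measurable_samp.
have mD : measurable_fun setT (fun w => ((discrepancy (samp w) n) ^+ 2)%:E).
  apply/measurable_EFinP; apply: measurable_funX; apply: measurable_discrepancy.
  exact: measurable_samp.
apply: (@le_trans _ _ (\int[P]_w (((discrepancy (samp w) n) ^+ 2)%:E + (gain_prob (samp w) n)%:E))%E); last first.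
  rewrite ge0_integralD ?leeD//; first exact: IH.
  - by move=> w _; rewrite lee_fin sqr_ge0.
  - by move=> w _; rewrite lee_fin gain_prob_ge0.
pose g x (b : bool) : R := (discrepancy x n + b%:R - gain_prob x n) ^+ 2.
have du x y : discrepancy (upd x n y) n = discrepancy x n.
  by apply: eq_discrepancy => i ni; rewrite upd_neq// ltn_eqF.
have gu x y : gain_prob (upd x n y) n = gain_prob x n.
  by rewrite /gain_prob (@eq_gain _ x)// => i ni; rewrite upd_neq// ltn_eqF.
rewrite (eq_integral (fun w => (g (samp w) (is_rec (samp w) n))%:E)); last first.
  by move=> w _; rewrite /g /discrepancy big_nat_recr//= addrA.
rewrite (@integral_is_rec n g); first last.
- move=> b; apply: measurable_funX; apply: measurable_funB.
    by apply: measurable_funD => //; apply: measurable_discrepancy; exact: measurable_samp_others.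
  by apply: measurable_gain_prob; exact: measurable_samp_others.
- by move=> x y b; rewrite /g du gu.
- by move=> x b; exact: sqr_ge0.
apply: ge0_le_integral => //.
- move=> w _; rewrite lee_fin addr_ge0// mulr_ge0 ?sqr_ge0 ?gain_prob_ge0//.
  by rewrite subr_ge0 gain_prob_le1.
- have md : measurable_fun setT (fun w => discrepancy (samp w) n).
    by apply: measurable_discrepancy; exact: measurable_samp.
  have mq : measurable_fun setT (fun w => gain_prob (samp w) n).
    by apply: measurable_gain_prob; exact: measurable_samp.
  apply/measurable_EFinP; apply: measurable_funD; apply: measurable_funM => //.
  + by apply: measurable_funX; apply: measurable_funB => //; exact: measurable_funD.
  + by apply: measurable_funX; apply: measurable_funB => //; exact: measurable_funD.
  + exact: measurable_funB.
- by apply: emeasurable_funD.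
move=> w _; rewrite -EFinD lee_fin /g.
move: (discrepancy _ _) (gain_prob _ _) => D p.
have -> : (D + true%:R - p) ^+ 2 * p + (D + false%:R - p) ^+ 2 * (1 - p) = D ^+ 2 + p - p ^+ 2.
  by rewrite /=; ring.
by rewrite gerBl sqr_ge0.
Qed.

End gain.

Lemma cvg_natV (R : realType) : (n%:R^-1 : R) @[n --> \oo] --> (0 : R).
Proof.
apply/cvgrPdistC_le => e e0; exists (Num.trunc e^-1).+1 => // n /= hn.
have n0 : 0 < n%:R :> R by rewrite ltr0n; exact: leq_trans hn.
rewrite subr0 gtr0_norm ?invr_gt0// invf_ple ?posrE//.
by apply: le_trans (ltW (truncnS_gt _)) _; rewrite ler_nat.
Qed.

(** * Asymptotics of the conditional record probability *)

Section gain_asymptotics.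
Context {disp} {T : measurableType disp} {R : realType} (P : probability T R).
Context {d : nat} (X : nat -> {RV P >-> borel_rV R d.+1}) (f : 'rV[R]_d.+1 -> R) (k : nat).
Context (A : set 'rV[R]_d.+1).
Hypotheses (X_indep : mutually_independent X) (X_density : forall i, has_density (X i) f).
Hypotheses (A_compact : compact A) (A_interior : A° !=set0) (A_regular : closure A° = A).
Hypotheses (f_support : closure [set x | f x != 0] = A) (f_cont : {within A, continuous f}).
Hypotheses (f_inf : 0 < inf (f @` A)) (A_thin : thin_boundary A) (k_gt0 : (0 < k)%N).
Local Notation samp w := (fun i => X i w).
Local Notation f0 := (inf (f @` A)).
Local Notation th := (ballvol d.+1 * f0).
Local Notation rad x n := (spacing_radius A x k n).
Local Notation rh := (rho d th).
Local Notation gp := (@gain_prob _ T R P d X k A).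

Let f_ge0 x : 0 <= f x.
Proof. by have [_ + _] := X_density 0%N. Qed.

Let v0 : 0 < ballvol d.+1 :> R.
Proof. exact: ballvol_gt0. Qed.

Let th0 : 0 < th.
Proof. by rewrite mulr_gt0. Qed.

Definition lnr (n : nat) : R := ln n%:R / n%:R.

Lemma lnr_ge0 n : 0 <= lnr n.
Proof.
rewrite /lnr; case: n => [|n]; first by rewrite invr0 mulr0.
by rewrite divr_ge0// ln_ge0// ler1n.
Qed.

Lemma lnr_gt0 n : (4 <= n)%N -> 0 < lnr n.
Proof.
move=> n4; rewrite divr_gt0//; last by rewrite ltr0n; exact: leq_trans n4.
exact: (lt_le_trans ltr01 (ln_ge1 n4)).
Qed.

(** The ratio lies between [(1 - e)^2 / (1 + e)] and [(1 + 10 e) (1 + e)^2]; [100] is a crude common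
    bound. *)
Lemma gain_prob_tight e x n : 0 < e -> e * 8 <= 1 -> (4 <= n)%N -> tight f k A e x n ->
  `|gp x n / lnr n - 1| <= 100 * e.
Proof.
move=> e0 e8 n4 tx; have L0 := lnr_gt0 n4.
have e1 : e <= 1 by lra.
have c3 : 0 < 1 + e by lra.
have hl : (1 - e) * (th * rad x n ^+ d.+1) <= gp x n.
  apply: (gain_prob_ge X_density A_compact A_interior k_gt0 e0 e1 _ f_inf tx) => y.
  exact: density_ge_inf.
have [c [ch cu _ fc /andP[t1 t2]]] := tx.
have hu : gp x n <= (1 + 10 * e) * (th * rad x n ^+ d.+1).
  apply: (@le_trans _ _ ((1 + 10 * e) * f0 * (ballvol d.+1 * rad x n ^+ d.+1))).
    apply: (gain_prob_le X_density A_compact A_interior k_gt0).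
      by rewrite mulr_ge0 ?(ltW f_inf)// addr_ge0// mulr_ge0// ltW.
    by move=> c' /cu ->.
  by rewrite le_eqVlt; apply/orP; left; apply/eqP; ring.
rewrite ler_norml; apply/andP; split.
  rewrite lerBrDr ler_pdivlMr//; apply: le_trans hl.
  apply: (@le_trans _ _ ((1 - e) * ((1 - e) / (1 + e) * lnr n))); last by rewrite ler_wpM2l// subr_ge0.
  rewrite mulrA ler_wpM2r ?(ltW L0)// mulrA ler_pdivlMr//.
  by move: e0; nra.
rewrite lerBlDr ler_pdivrMr//; apply: (le_trans hu).
apply: (@le_trans _ _ ((1 + 10 * e) * ((1 + e) ^+ 2 * lnr n))); first by rewrite ler_wpM2l//; lra.
rewrite mulrA ler_wpM2r ?(ltW L0)// expr2.
by have : e * e <= e / 8 by [nra]; move: e0; nra.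
Qed.

Lemma gain_prob_cvg : {ae P, forall w, gp (samp w) n / lnr n @[n --> \oo] --> (1 : R)}.
Proof.
(* Tolerances tending to 0, so that countably many almost sure events suffice; the first factor
   meets the bound on [e] in [tight_ae]. *)
pose e m : R := (8 * d.+1%:R)^-1 * m.+1%:R^-1.
have D0 : 0 < 8 * d.+1%:R :> R by rewrite mulr_gt0.
have e0 m : 0 < e m by rewrite mulr_gt0 ?invr_gt0.
have m1 m : m.+1%:R^-1 <= 1 :> R by rewrite invf_le1// ler1n.
have ed m : e m * (8 * d.+1%:R) <= 1 by rewrite /e mulrAC mulVf ?gt_eqF// mul1r.
have e8 m : e m * 8 <= 1.
  by apply: le_trans (ed m); rewrite ler_wpM2l ?(ltW (e0 m))// ler_peMr// ler1n.
have : {ae P, forall w, forall m, \forall n \near \oo, tight f k A (e m) (samp w) n}.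
  by apply: ae_forall_count => m; exact: tight_ae.
apply: filterS => w Hw; apply/cvgrPdistC_le => eps eps0.
have [m me] : exists m, 100 * e m <= eps.
  exists (Num.trunc (100 / eps)); rewrite /e mulrA ler_pdivrMr//.
  apply: (@le_trans _ _ 100).
    by rewrite ler_piMr// invf_le1// (@le_trans _ _ 8)// ?ler1n// ler_peMr// ler1n.
  by rewrite mulrC -ler_pdivrMr// ltW// truncnS_gt.
have := Hw m; apply: filterS2 (nbhs_infty_ge 4) => n n4 tn.
exact: (le_trans (gain_prob_tight (e0 m) (e8 m) n4 tn)).
Qed.

(** Provides the domination for the means. The constant [4] in the radius makes the exceptional
    probability of order [n^-2], since [1 + 2 < 4] in the exponents; [K >= 2] keeps the later
    cut-off above the limit 1. *)
Lemma gain_prob_bound : exists2 K, 2 <= K & exists C n0, 0 <= C /\ forall n, (n0 <= n)%N ->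
  exists V, [/\ measurable V, (P V <= (C * expR (- (2 * ln n%:R)))%:E)%E &
    forall w, ~ V w -> gp (samp w) n <= K * lnr n].
Proof.
have [M M0 fM] := density_bounded A_compact f_support f_cont.
exists (2 + M / f0 * 4); first by rewrite lerDl mulr_ge0// divr_ge0// ltW.
have : poly_small P (fun n => has_hole X k n (rh n 4) (fits A (rh n 4))) 2.
  apply: (@hole_poly_small _ _ _ _ _ _ f k X_indep X_density _ f0 _ _ d.+1) => //.
  - by apply: (entropy_sub A_compact) => r x /ltW r0; exact: fits_in.
  - exists 1 => // r x y r0 _ xA /xA; exact: density_ge_inf.
  - rewrite [f0 * _]mulrC (divff (lt0r_neq0 th0)) divff ?pnatr_eq0//; lra.
move=> [C [n0 [C0 H]]]; exists C, (maxn n0 4); split => // n; rewrite geq_max => /andP[/H[V [mV EV PV]] n4].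
exists V; split => // w nV; have n2 : (2 <= n)%N by exact: leq_trans n4.
have rle : rad (samp w) n <= rh n 4.
  apply: spacing_radius_le => //; split; first exact: rho_gt0.
  move=> y [Ay yA]; rewrite leqNgt; apply/negP => yk; apply: nV; apply: EV.
  by exists y.
apply: le_trans (@gain_prob_le _ _ _ P d X f k A X_density A_compact A_interior k_gt0 _ n M (ltW M0) _) _.
  by move=> c _ y _; exact: fM.
have r0 : 0 <= rad (samp w) n by exact: spacing_radius_ge0.
apply: (@le_trans _ _ (M * (ballvol d.+1 * rh n 4 ^+ d.+1))).
  rewrite ler_wpM2l ?(ltW M0)// ler_wpM2l ?(ltW v0)//.
  by apply: lerXn2r; rewrite ?nnegrE ?(ltW (rho_gt0 _ _ _ _)).
apply: (@le_trans _ _ (M / f0 * 4 * lnr n)); last by rewrite ler_wpM2r ?lnr_ge0// lerDr.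
rewrite (_ : M * _ = M / f0 * (rh n 4 ^+ d.+1 * th)); last by field; rewrite gt_eqF.
by rewrite rhoMth// -!mulrA.
Qed.

Lemma measurable_gp n : measurable_fun setT (fun w => gp (samp w) n).
Proof.
exact: (@measurable_gain_prob _ _ _ P _ X f k A X_density A_compact _ _
  (fun w j => X j w) n (measurable_samp X)).
Qed.

Lemma integral_gp_fin n : (\int[P]_w (gp (samp w) n)%:E)%E = (fine (\int[P]_w (gp (samp w) n)%:E))%:E.
Proof.
rewrite fineK// ge0_fin_numE; last by apply: integral_ge0 => w _; rewrite lee_fin gain_prob_ge0.
apply: (@le_lt_trans _ _ (\int[P]_w (cst 1%E w))%E).
  apply: ge0_le_integral => //; first by move=> w _; rewrite lee_fin gain_prob_ge0.
  - by apply/measurable_EFinP; exact: measurable_gp.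
  - by move=> w _; rewrite lee_fin; exact: (@gain_prob_le1 _ _ _ P _ X f k A X_density A_compact).
by rewrite integral_cst//= mul1e probability_setT ltry.
Qed.

(** The ratio [Y], cut off at [K], converges in mean by dominated convergence. The cut-off changes
    [Y] only on [V n], where [Y <= n / ln n <= n]; this contributes at most [n * C / n^2]. *)
Lemma integral_gain_prob_cvg :
  fine (\int[P]_w (gp (samp w) n)%:E) / lnr n @[n --> \oo] --> (1 : R).
Proof.
have [K K2 [C [n0 [C0 HV]]]] := gain_prob_bound.
have [V VP] : exists V : nat -> set T, forall n, (n0 <= n)%N ->
    [/\ measurable (V n), (P (V n) <= (C * expR (- (2 * ln n%:R)))%:E)%E &
    forall w, ~ V n w -> gp (samp w) n <= K * lnr n].
  have /choice[V VP] : forall n, exists V, (n0 <= n)%N -> [/\ measurable V,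
      (P V <= (C * expR (- (2 * ln n%:R)))%:E)%E & forall w, ~ V w -> gp (samp w) n <= K * lnr n].
    by move=> n; have [nn|nn] := leqP n0 n; [have [V] := HV n nn; exists V|exists set0].
  by exists V.
have K0 : 0 <= K by lra.
pose Y n w := gp (samp w) n / lnr n.
have Y0 n w : 0 <= Y n w by rewrite divr_ge0 ?gain_prob_ge0 ?lnr_ge0.
have mY n : measurable_fun setT (Y n).
  by apply: measurable_funM => //; exact: measurable_gp.
pose Z n w := Num.min (Y n w) K.
have mZ n : measurable_fun setT (Z n) by exact: measurable_minr.
have Z0 n w : 0 <= Z n w by rewrite le_min Y0.
have ZK n w : Z n w <= K by rewrite ge_min lexx orbT.
have cZ : (\int[P]_w (Z n w)%:E)%E @[n --> \oo] --> 1%E.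
  have E1 : (\int[P]_w (cst 1%E w))%E = 1%E :> \bar R.
    by rewrite integral_cst//= probability_setT mule1.
  rewrite -[X in _ --> X]E1.
  have [|||||_ _] := @dominated_convergence _ _ _ P setT measurableT (fun n w => (Z n w)%:E) (cst 1%E) (EFin \o cst K).
  - by move=> n; apply/measurable_EFinP.
  - exact: measurable_cst.
  - have := gain_prob_cvg; apply: filterS => w Yw _; apply/fine_cvgP; split; first exact: nearW.
    apply/cvgrPdistC_le => eps eps0; have h : 0 < Num.min eps 1 by rewrite lt_min eps0 ltr01.
    move/cvgrPdistC_le: Yw => /(_ _ h); apply: filterS => n; rewrite le_min => /andP[h1 h2] /=.
    rewrite /Z min_l//; move: h2; rewrite ler_norml => /andP[_].
    by rewrite /Y; lra.
  - exact: finite_measure_integrable_cst.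
  - by apply: nearW => w n _; rewrite gee0_abs ?lee_fin.
  by apply.
have cY : (\int[P]_w (Y n w)%:E)%E @[n --> \oo] --> 1%E.
  apply: (@squeeze_cvge _ _ _ _ (fun n => \int[P]_w (Z n w)%:E)%E _
     (fun n => \int[P]_w (Z n w)%:E + (C * n%:R^-1)%:E)%E) => //; last first.
    rewrite -[1%E]adde0; apply: cvgeD => //.
    apply/fine_cvgP; split; first exact: nearW.
    rewrite -[X in _ --> X](mulr0 C); apply: cvgMr.
    exact: cvg_natV.
  near=> n; apply/andP; split.
    apply: ge0_le_integral => //; [by move=> w _; rewrite lee_fin|exact/measurable_EFinP|exact/measurable_EFinP|].
    by move=> w _; rewrite lee_fin ge_min lexx.
  have n4 : (4 <= n)%N by near: n; exact: nbhs_infty_ge.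
  have nn0 : (n0 <= n)%N by near: n; exact: nbhs_infty_ge.
  have [mV PV HVn] := VP n nn0; have L0 := lnr_gt0 n4.
  have n_gt0 : 0 < n%:R :> R by rewrite ltr0n; exact: leq_trans n4.
  apply: (@le_trans _ _ (\int[P]_w ((Z n w)%:E + (n%:R * \1_(V n) w)%:E))%E).
    apply: ge0_le_integral => //; first by move=> w _; rewrite lee_fin.
    - exact/measurable_EFinP.
    - apply: emeasurable_funD; first exact/measurable_EFinP.
      by apply/measurable_EFinP; apply: measurable_funM => //; exact: measurable_indic.
    move=> w _; rewrite -EFinD lee_fin indicE.
    have [Vw|Vw] := pselect (V n w).
      rewrite mem_set//= mulr1; apply: (@le_trans _ _ n%:R); last by rewrite lerDr.
      rewrite /Y /lnr invf_div mulrA ler_pdivrMr; last exact: (lt_le_trans ltr01 (ln_ge1 n4)).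
      rewrite mulrC ler_wpM2l//; apply: le_trans (ln_ge1 n4); exact: (@gain_prob_le1 _ _ _ P _ X f k A X_density A_compact).
    by rewrite memNset//= mulr0 addr0 /Z min_l// /Y ler_pdivrMr//; exact: HVn.
  rewrite ge0_integralD//; first last.
  - by apply/measurable_EFinP; apply: measurable_funM => //; exact: measurable_indic.
  - exact/measurable_EFinP.
  - by move=> w _; rewrite lee_fin.
  apply: leeD => //; under eq_integral do rewrite EFinM.
  rewrite ge0_integralZl ?lee_fin//; last by apply/measurable_EFinP; exact: measurable_indic.
  rewrite integral_indic// setIT; apply: (le_trans (lee_wpmul2l _ PV)); first by rewrite lee_fin.
  rewrite -EFinM lee_fin.
  have -> : - (2 * ln n%:R) = - (ln n%:R) + - (ln n%:R) :> R by lra.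
  rewrite expRD expRN lnK// le_eqVlt; apply/orP; left; apply/eqP.
  by field; rewrite gt_eqF.
have /fine_cvgP[_] := cY; apply: cvg_trans; apply: near_eq_cvg; near=> n.
have n4 : (4 <= n)%N by near: n; exact: nbhs_infty_ge.
have L0 := lnr_gt0 n4; rewrite /= /Y.
under eq_integral do rewrite mulrC EFinM.
rewrite ge0_integralZl//; last 3 first.
- by apply/measurable_EFinP; exact: measurable_gp.
- by move=> w _; rewrite lee_fin gain_prob_ge0.
- by rewrite lee_fin invr_ge0 ltW.
by rewrite integral_gp_fin/= mulrC.
Unshelve. all: by end_near. Qed.

End gain_asymptotics.

(** * Asymptotics of sums *)

Section half_log_square.
Context {R : realType}.

(** A primitive of [ln x / x], hence the natural comparison for sums of [lnr]. *)
Definition hls (n : nat) : R := 2^-1 * ln n%:R ^+ 2.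

Lemma ln_ge0n n : 0 <= ln n%:R :> R.
Proof. by case: n => [|n]; [rewrite ln0|rewrite ln_ge0// ler1n]. Qed.

Lemma le_lnn m n : (m <= n)%N -> ln m%:R <= ln n%:R :> R.
Proof.
case: m => [_|m mn]; first by rewrite ln0// ln_ge0n.
by rewrite ler_ln ?posrE ?ltr0n ?ler_nat//; exact: leq_trans mn.
Qed.

Lemma le_hls m n : (m <= n)%N -> hls m <= hls n.
Proof.
by move=> mn; rewrite ler_wpM2l// lerXn2r ?nnegrE ?ln_ge0n// le_lnn.
Qed.

Lemma hls_ge0 n : 0 <= hls n.
Proof. by rewrite mulr_ge0// sqr_ge0. Qed.

Lemma hls_gt0 n : (4 <= n)%N -> 0 < hls n.
Proof. by move=> n4; rewrite mulr_gt0// exprn_gt0// (lt_le_trans ltr01)// ln_ge1. Qed.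

Lemma hls_large (C : R) : \forall n \near \oo, C <= hls n.
Proof.
exists (Num.trunc (expR (1 + `|C|))).+1 => // n /= hn.
have L : 1 + `|C| <= ln n%:R.
  have hn' : expR (1 + `|C|) <= n%:R.
    by apply: le_trans (ltW (truncnS_gt _)) _; rewrite ler_nat.
  rewrite -ler_expR lnK// posrE; apply: lt_le_trans hn'; exact: expR_gt0.
rewrite /hls; have := ler_norm C; have := normr_ge0 C.
move: L; move: (ln _) `|C| => L c; nra.
Qed.

(** The increment is [delta ln n + delta^2 / 2] with [1 / (n + 1) <= delta <= 1 / n], both bounds
    from [ln (1 + x) <= x]; the errors are of order [ln n / n^2]. *)
Lemma hls_diff n : (4 <= n)%N -> `|hls n.+1 - hls n - lnr n| <= lnr n * n%:R^-1.
Proof.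
move=> n4; have n0 : 0 < n%:R :> R by rewrite ltr0n; exact: leq_trans n4.
have n1 : 0 < n.+1%:R :> R by [].
have L1 : 1 <= ln n%:R :> R by exact: ln_ge1.
pose delta : R := ln n.+1%:R - ln n%:R.
have dE : delta = ln (n.+1%:R / n%:R) by rewrite /delta ln_div.
have d1 : delta <= n%:R^-1.
  rewrite dE (_ : n.+1%:R / n%:R = 1 + n%:R^-1); last by rewrite -natr1 mulrDl divff ?gt_eqF// mul1r.
  apply: le_ln1Dx; apply: (@lt_trans _ _ 0); first lra.
  by rewrite invr_gt0.
have d2 : n.+1%:R^-1 <= delta.
  rewrite dE -[X in ln X]invrK lnV ?posrE ?invr_gt0 ?divr_gt0// lerNr invf_div.
  rewrite (_ : n%:R / n.+1%:R = 1 + - n.+1%:R^-1); last by rewrite -natr1; field; rewrite gt_eqF// addr_gt0.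
  apply: le_ln1Dx; have n12 : (1 < n.+1)%N by rewrite ltnS; exact: leq_trans n4.
  by rewrite ltrN2 invf_lt1// ltr1n.
have E : hls n.+1 - hls n = delta * ln n%:R + delta ^+ 2 / 2.
  by rewrite /hls /delta; field.
have d3 : n%:R^-1 - n%:R^-1 ^+ 2 <= delta.
  apply: le_trans d2; rewrite -natr1 -subr_ge0.
  rewrite (_ : _ - _ = (n%:R ^+ 2 * (n%:R + 1))^-1); last by field; rewrite !gt_eqF// addr_gt0.
  by rewrite invr_ge0 mulr_ge0 ?exprn_ge0 ?addr_ge0// ltW.
have d0 : 0 <= delta by apply: le_trans d2; rewrite invr_ge0.
rewrite E /lnr; have n00 : 0 <= n%:R^-1 :> R by rewrite invr_ge0 ltW.
move: (n%:R^-1) (ln n%:R) n00 L1 d1 d3 d0 => u L u0 L1 d1 d3 d0; clear E d2 dE; move: delta d1 d3 d0 => D d1 d3 d0.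
rewrite ler_norml; apply/andP; split; nra.
Qed.

(* The Stolz-Cesaro theorem against the increments of [hls]. *)
Lemma sum_asymp (k : nat) (u : nat -> R) : u n / lnr n @[n --> \oo] --> (1 : R) ->
  (\sum_(k <= l < n) u l) / hls n @[n --> \oo] --> (1 : R).
Proof.
move=> cu; apply/cvgrPdistC_le => eps eps0.
(* Each term is within [4 e] of the increment of [hls] in relative error, as [2 e / (1 - e) <= 4 e];
   the initial segment costs another [e], and [5 e <= eps]. *)
pose e := Num.min (eps / 8) 2^-1.
have e0 : 0 < e by rewrite lt_min invr_gt0 divr_gt0//=.
have e1 : e <= 2^-1 by rewrite ge_min lexx orbT.
have e8 : e * 8 <= eps by rewrite -ler_pdivlMr// ge_min lexx.
have [N1 _ HN1] : \forall l \near \oo, `|u l / lnr l - 1| <= e :> R by exact: (cvgrPdistC_le _ _).1 cu _ e0.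
have [N2 _ HN2] : \forall l \near \oo, `|l%:R^-1 - 0| <= e :> R.
  by exact: (cvgrPdistC_le _ _).1 (@cvg_natV R) _ e0.
pose N := maxn (maxn N1 N2) (maxn 4 k).
have key l : (N <= l)%N -> `|u l - (hls l.+1 - hls l)| <= 4 * e * (hls l.+1 - hls l).
  rewrite !geq_max => /andP[/andP[l1 l2] /andP[l4 lk]].
  have L0 := @lnr_gt0 R l l4.
  have h1 : `|u l - lnr l| <= e * lnr l.
    have := HN1 l l1; rewrite /= -(ler_pM2r L0) -[X in _ * X](gtr0_norm L0) -normrM.
    by rewrite mulrBl mul1r divfK ?gt_eqF.
  have h2 : `|hls l.+1 - hls l - lnr l| <= lnr l * e.
    apply: le_trans (hls_diff l4) _; rewrite ler_wpM2l ?(ltW L0)//.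
    by have := HN2 l l2; rewrite /= subr0 ger0_norm// invr_ge0.
  move: h1 h2 L0; move: (hls l.+1 - hls l) (lnr l) (u l) => g L U.
  rewrite !ler_norml => /andP[a1 a2] /andP[b1 b2] L0; apply/andP; split; nra.
pose C := `|\sum_(k <= l < N) u l - hls N|.
near=> n.
have Nn : (N <= n)%N by near: n; exact: nbhs_infty_ge.
have n4 : (4 <= n)%N by apply: leq_trans Nn; rewrite /N !leq_max leqnn !orbT.
have kN : (k <= N)%N by rewrite /N !leq_max leqnn !orbT.
have H0 := hls_gt0 n4.
have CH : C / e <= hls n by near: n; exact: hls_large.
rewrite -(ler_pM2r H0) -[X in _ * X](gtr0_norm H0) -normrM mulrBl mul1r divfK ?gt_eqF//.
have S : `|\sum_(N <= l < n) u l - (hls n - hls N)| <= 4 * e * (hls n - hls N).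
  rewrite -(telescope_sumr hls Nn) -sumrB mulr_sumr.
  apply: le_trans (ler_norm_sum _ _ _) _.
  by rewrite big_nat [leRHS]big_nat; apply: ler_sum => l /andP[+ _]; exact: key.
rewrite (big_cat_nat kN Nn)/=.
have C1 : C <= e * hls n by rewrite mulrC -ler_pdivrMr.
have := hls_ge0 N; move: S C1 e8 H0; rewrite /C.
move: (\sum_(k <= l < N) _) (\sum_(N <= l < n) _) (hls n) (hls N) => a b h g.
move=> S C1 e8 H0 g0.
have -> : a + b - h = (b - (h - g)) + (a - g) by ring.
apply: le_trans (ler_normD _ _) _; apply: le_trans (lerD S C1) _; nra.
Unshelve. all: by end_near. Qed.

Lemma hls_pow2 j : hls (2 ^ j) = 2^-1 * ln 2 ^+ 2 * j%:R ^+ 2.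
Proof. by rewrite /hls natrX lnXn// -[X in X ^+ 2]mulr_natl exprMn; ring. Qed.

(** [hls (2 ^ j)] is quadratic in [j], so its consecutive ratios tend to 1 although [n] doubles;
    monotonicity then fills the gaps. *)
Lemma dyadic_asymp (a : nat -> R) : {homo a : m n / (m <= n)%N >-> m <= n} ->
  a (2 ^ j.+1)%N / hls (2 ^ j.+1) @[j --> \oo] --> (1 : R) ->
  a n / hls n @[n --> \oo] --> (1 : R).
Proof.
move=> ha ca; apply/cvgrPdistC_le => eps eps0.
pose e := Num.min (eps / 8) 2^-1.
have e0 : 0 < e by rewrite lt_min invr_gt0 divr_gt0//=.
have e1 : e <= 2^-1 by rewrite ge_min lexx orbT.
have e8 : e * 8 <= eps by rewrite -ler_pdivlMr// ge_min lexx.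
have [N1 _ HN1] : \forall j \near \oo, `|a (2 ^ j.+1)%N / hls (2 ^ j.+1) - 1| <= e.
  exact: (cvgrPdistC_le _ _).1 ca _ e0.
have [N2 HN2] := @power_ratio R 2 e e0.
have ln2 : 0 < ln 2 :> R by rewrite ln_gt0// ltr1n.
have hratio j : (N2 <= j)%N -> hls (2 ^ j.+2) <= (1 + e) * hls (2 ^ j.+1).
  move=> /HN2; rewrite !hls_pow2 !natrX => h; rewrite [leRHS]mulrCA ler_wpM2l//.
  by rewrite mulr_ge0// sqr_ge0.
exists (2 ^ (maxn N1 N2).+3)%N => // n /= hn.
have n0 : (0 < n)%N by apply: leq_trans hn; rewrite expn_gt0.
have /andP[t1 t2] := @trunc_log_bounds 2 n isT n0.
have jt : ((maxn N1 N2).+3 <= trunc_log 2 n)%N by rewrite trunc_log_max.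
case: (trunc_log 2 n) jt t1 t2 => // j; rewrite ltnS => jj t1 t2.
have [j1 j2] : (N1 <= j)%N /\ (N2 <= j)%N.
  by split; apply: leq_trans (ltnW (ltnW jj)); rewrite leq_max leqnn ?orbT.
have hpos i : 0 < hls (2 ^ i.+1).
  by rewrite hls_pow2 !mulr_gt0 ?exprn_gt0.
have hn0 : 0 < hls n := lt_le_trans (hpos j) (le_hls t1).
have b1 : `|a (2 ^ j.+1)%N - hls (2 ^ j.+1)| <= e * hls (2 ^ j.+1).
  have := HN1 j j1; rewrite /= -(ler_pM2r (hpos j)) -[X in _ * X](gtr0_norm (hpos j)) -normrM.
  by rewrite mulrBl mul1r divfK ?gt_eqF.
have b2 : `|a (2 ^ j.+2)%N - hls (2 ^ j.+2)| <= e * hls (2 ^ j.+2).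
  have := HN1 j.+1 (leqW j1); rewrite /= -(ler_pM2r (hpos j.+1)) -[X in _ * X](gtr0_norm (hpos j.+1)) -normrM.
  by rewrite mulrBl mul1r divfK ?gt_eqF.
rewrite -(ler_pM2r hn0) -[X in _ * X](gtr0_norm hn0) -normrM mulrBl mul1r divfK ?gt_eqF//.
have := hratio j j2; have := ha _ _ t1; have := ha _ _ (ltnW t2).
have := le_hls t1; have := le_hls (ltnW t2); have := hpos j.
move: b1 b2 hn0; rewrite !ler_norml.
move: (a n) (a _) (a _) (hls n) (hls _) (hls _) => x p q h v u.
move=> /andP[b1 b1'] /andP[b2 b2'] h0 u0 hv uh xq px vu.
have vh : v <= (1 + e) * h by apply: le_trans vu _; rewrite ler_wpM2l// addr_ge0// ltW.
have hu : h <= (1 + e) * u by apply: le_trans hv vu.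
have eh : e * 8 * h <= eps * h by rewrite ler_wpM2r// ltW.
have ee : e * e <= e * 2^-1 by rewrite ler_wpM2l// ltW.
apply/andP; split; nra.
Qed.

Lemma hls_inv_cvg : 1 / hls n @[n --> \oo] --> (0 : R).
Proof.
apply/cvgrPdistC_le => e e0; near=> n.
have n4 : (4 <= n)%N by near: n; exact: nbhs_infty_ge.
have H0 := hls_gt0 n4; rewrite subr0 mul1r gtr0_norm ?invr_gt0// invf_ple ?posrE//.
by near: n; exact: hls_large.
Unshelve. all: by end_near. Qed.

End half_log_square.

(** * Records *)

Section record_times.
Context {R : realType} {d : nat} (A : set 'rV[R]_d) (x : nat -> 'rV[R]_d) (k : nat).
Local Notation N n := (num_records A x k n).

Lemma num_recordsS n : (k <= n)%N -> N n.+1 = (N n + is_record A x k n.+1)%N.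
Proof. by move=> kn; rewrite /num_records big_nat_recr//= addnA. Qed.

Lemma num_records_start n : (n <= k)%N -> N n = 1%N.
Proof. by move=> nk; rewrite /num_records big_geq. Qed.

Lemma num_records_homo : {homo (fun n => N n) : m n / (m <= n)%N >-> (m <= n)%N}.
Proof.
apply: homo_leq => [//|m n p|n]; first exact: leq_trans.
have [nk|kn] := leqP n.+1 k; first by rewrite !num_records_start// ltnW.
by rewrite num_recordsS// leq_addr.
Qed.

Lemma num_records_le n : (N n <= n.+1)%N.
Proof.
elim: n => [|n IH]; first by rewrite num_records_start.
have [nk|kn] := leqP n.+1 k; first by rewrite num_records_start.
rewrite num_recordsS//; apply: leq_trans (leq_add IH (leq_b1 _)) _.
by rewrite addn1.
Qed.

(** The infimum is a minimum once a later record exists, which the unboundedness of the count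
    guarantees. The count is constant between records, whence its value at [t]. *)
Lemma record_timeP : (forall C, exists n, (C <= N n)%N) -> forall m, exists t,
  [/\ record_time A x k m.+1 = t%:R%:E, N t = m.+1 & (k <= t)%N].
Proof.
move=> Nlarge; elim=> [|m [t [tE Nt kt]]].
  by exists k; split => //; exact: num_records_start.
have ex : exists n, (t < n)%N && is_record A x k n.
  have [n Nn] := Nlarge m.+2; apply: contrapT => H.
  have stuck i : (t <= i)%N -> N i = N t.
    move=> ti; rewrite -(subnKC ti); elim: (i - t)%N => [|j IH]; first by rewrite addn0.
    rewrite addnS num_recordsS ?(leq_trans kt (leq_addr _ _))// IH.
    have [r|] := boolP (is_record A x k (t + j).+1); last by rewrite addn0.
    by exfalso; apply: H; exists (t + j).+1; rewrite ltnS leq_addr r.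
  have [nt|tn] := leqP n t.
    by move: Nn; rewrite ltnNge -Nt => /negP; apply; exact: num_records_homo.
  by move: Nn; rewrite (stuck _ (ltnW tn)) Nt ltnn.
have [n /andP[tn rn] nmin] := ex_minnP ex; exists n; split.
- rewrite /= in tE *; rewrite tE; apply/eqP; rewrite eq_le; apply/andP; split.
    by apply: ereal_inf_lbound; exists n => //=; rewrite lte_fin ltr_nat.
  apply: le_ereal_inf_tmp => _ [i /= [ti ri] <-]; rewrite lee_fin ler_nat; apply: nmin.
  by rewrite ri andbT; move: ti; rewrite lte_fin ltr_nat.
- have stuck i : (t + i < n)%N -> N (t + i) = N t.
    elim: i => [|i IH]; first by rewrite addn0.
    rewrite addnS => ti; have {}IH := IH (ltnW ti).
    rewrite num_recordsS ?(leq_trans kt (leq_addr _ _))// IH.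
    have [r|] := boolP (is_record A x k (t + i).+1); last by rewrite addn0.
    have := nmin (t + i).+1; rewrite ltnS leq_addr r => /(_ isT).
    by rewrite leqNgt ti.
  case: n tn rn nmin stuck => // n; rewrite ltnS => tn rn nmin stuck.
  rewrite num_recordsS; last exact: leq_trans tn.
  by rewrite rn addn1 -(subnKC tn) stuck ?subnKC// Nt.
- exact: leq_trans kt (ltnW tn).
Qed.

(** The count at the [m]-th record time [t] is [m], so [(ln t)^2 / 2] is asymptotic to [m]; the
    times tend to infinity because the count at [n] is at most [n + 1]. *)
Lemma record_time_cvg : (N n)%:R / hls n @[n --> \oo] --> (1 : R) ->
  poweR (record_time A x k n) (Num.sqrt n%:R)^-1 @[n --> \oo] --> (expR (Num.sqrt 2))%:E.
Proof.
move=> cN; have Nlarge C : exists n, (C <= N n)%N.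
  have h : 2^-1 < 1 :> R by rewrite invf_lt1// ltr1n.
  have [n0 _ Hn0] := cvgr_ge 1 cN _ h; have [n1 _ Hn1] := @hls_large R (2 * C%:R).
  pose n := maxn (maxn n0 n1) 4; exists n; rewrite -(ler_nat R).
  have n4 : (4 <= n)%N by rewrite /n leq_max leqnn orbT.
  have := Hn0 n; rewrite /= /n !leq_max leqnn /= => /(_ isT).
  rewrite ler_pdivlMr ?hls_gt0//; apply: le_trans.
  rewrite mulrC ler_pdivlMr// mulrC; apply: Hn1; by rewrite /= /n !leq_max leqnn !orbT.
have [t tP] := choice (record_timeP Nlarge).
have tm m : (m <= t m)%N by have [_ E _] := tP m; rewrite -ltnS -E; exact: num_records_le.
have ct : t m @[m --> \oo] --> \oo.
  move=> U [n0 _ HU]; exists n0 => // m /= h; apply: HU; exact: leq_trans (tm m).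
have c1 : (m.+1)%:R / hls (t m) @[m --> \oo] --> (1 : R).
  have := cvg_comp _ _ ct cN; apply: cvg_trans; apply: near_eq_cvg; apply: nearW => m /=.
  by have [_ -> _] := tP m.
have c2 : hls (t m) / (m.+1)%:R @[m --> \oo] --> (1 : R).
  rewrite -[X in _ --> X]invr1; under eq_fun do rewrite -invf_div.
  by apply: cvgV c1; exact: oner_neq0.
have c3 : ln (t m)%:R / Num.sqrt m.+1%:R @[m --> \oo] --> Num.sqrt (2 : R).
  have c2' : 2 * (hls (t m) / m.+1%:R) @[m --> \oo] --> (2 * 1 : R) by apply: cvgMr.
  have : Num.sqrt (2 * (hls (t m) / m.+1%:R)) @[m --> \oo] --> Num.sqrt (2 * 1 : R).
    exact: (@continuous_cvg _ _ _ _ _ _ Num.sqrt _ (@sqrt_continuous R (2 * 1)) c2').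
  rewrite mulr1; apply: cvg_trans; apply: near_eq_cvg; apply: nearW => m /=.
  rewrite /hls mulrA mulrA divff ?pnatr_eq0// mul1r sqrtrM ?sqr_ge0// sqrtr_sqr.
  by rewrite ger0_norm ?ln_ge0n// sqrtrV.
have c4 : expR (ln (t m)%:R / Num.sqrt m.+1%:R) @[m --> \oo] --> expR (Num.sqrt (2 : R)).
  exact: (@continuous_cvg _ _ _ _ _ _ expR _ (@continuous_expR R _) c3).
have c5 : poweR (record_time A x k m.+1) (Num.sqrt m.+1%:R)^-1 @[m --> \oo] --> (expR (Num.sqrt 2))%:E.
  apply/fine_cvgP; split; first by apply: nearW => m; have [-> _ _] := tP m.
  (* For [m > 0] the time [t m] is positive, so that the power is the exponential of a logarithm. *)
  have E m : (0 < m)%N -> fine (poweR (record_time A x k m.+1) (Num.sqrt m.+1%:R)^-1) =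
      expR (ln (t m)%:R / Num.sqrt m.+1%:R).
    move=> m1; have [-> _ _] := tP m.
    rewrite poweR_EFin /= /powR pnatr_eq0 gtn_eqF; last exact: leq_trans (tm m).
    by rewrite mulrC.
  by apply: cvg_trans c4; apply: near_eq_cvg; exists 1%N => // m m1; apply/esym; exact: E.
by rewrite -cvg_shiftS.
Qed.

End record_times.

(** * The number of records, in mean and almost surely *)

Section main.
Context {disp} {T : measurableType disp} {R : realType} (P : probability T R).
Context {d : nat} (X : nat -> {RV P >-> borel_rV R d.+1}) (f : 'rV[R]_d.+1 -> R) (k : nat).
Context (A : set 'rV[R]_d.+1).
Hypotheses (X_indep : mutually_independent X) (X_density : forall i, has_density (X i) f).
Hypotheses (A_compact : compact A) (A_interior : A° !=set0) (A_regular : closure A° = A).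
Hypotheses (f_support : closure [set x | f x != 0] = A) (f_cont : {within A, continuous f}).
Hypotheses (f_inf : 0 < inf (f @` A)) (A_thin : thin_boundary A) (k_gt0 : (0 < k)%N).
Local Notation samp w := (fun i => X i w).
Local Notation gp := (@gain_prob _ T R P d X k A).
Local Notation N w n := (num_records A (samp w) k n).
Local Notation S w n := (@discrepancy _ T R P d X k A (samp w) n).
Local Notation Egp l := (fine (\int[P]_w (gp (samp w) l)%:E)).

Lemma num_recordsE w n : (N w n)%:R = 1 + \sum_(k <= l < n) (is_rec k A (samp w) l)%:R :> R.
Proof. by rewrite /num_records natrD big_add1 /= natr_sum. Qed.

Lemma num_records_discrepancy w n :
  (N w n)%:R = 1 + S w n + \sum_(k <= l < n) gp (samp w) l.
Proof. by rewrite num_recordsE /discrepancy -addrA -big_split/=; congr (1 + _); apply: eq_bigr => l _; rewrite subrK. Qed.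

Lemma expectation_num_records n :
  ('E_P[fun w => (N w n)%:R] = (1 + \sum_(k <= l < n) Egp l)%:E)%E.
Proof.
rewrite unlock; under eq_integral do rewrite num_recordsE EFinD -sumEFin.
have mr l : measurable_fun setT (fun w => ((is_rec k A (samp w) l)%:R : R)%:E).
  by apply/measurable_EFinP; apply: measurable_is_recR => //; exact: measurable_samp.
rewrite ge0_integralD//; last 2 first.
- by move=> w _; apply: sume_ge0 => l _; rewrite lee_fin.
- exact: emeasurable_sum.
rewrite [X in (X + _)%E](_ : _ = 1%E); last by rewrite integral_cst//= probability_setT mule1.
rewrite ge0_integral_sum//.
rewrite EFinD -sumEFin; congr (_ + _)%E; apply: eq_bigr => l _.
by rewrite -(@integral_gp_fin _ _ _ P _ X f k A X_density A_compact); exact: (@integral_gain_prob _ _ _ P _ X f).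
Qed.

Lemma expectation_asymp :
  ('E_P[fun w => (N w n)%:R] / (2^-1 * ln n%:R ^+ 2)%:E)%E @[n --> \oo] --> 1%E.
Proof.
have cE : (\sum_(k <= l < n) Egp l) / hls n @[n --> \oo] --> (1 : R).
  by apply: sum_asymp; exact: (integral_gain_prob_cvg X_indep X_density).
have cE' : (1 + \sum_(k <= l < n) Egp l) / hls n @[n --> \oo] --> (1 : R).
  rewrite -[X in _ --> X]add0r; under eq_fun do rewrite mulrDl.
  by apply: cvgD cE; exact: hls_inv_cvg.
have : ((1 + \sum_(k <= l < n) Egp l) / hls n)%:E @[n --> \oo] --> 1%E.
  by apply/fine_cvgP; split => //; exact: nearW.
apply: cvg_trans; apply: near_eq_cvg; exists 4%N => // n /= n4.
by rewrite expectation_num_records -/(hls n) inver gt_eqF ?hls_gt0// EFinM.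
Qed.

(** Chebyshev at the level [hls / (m+1)]: the mean square is at most [2 hls], so the probability is
    at most [2 (m+1)^2 / hls], and [hls (2 ^ j.+1) = (ln 2)^2 (j+1)^2 / 2] makes this summable in
    [j]. *)
Lemma discrepancy_small : {ae P, forall w,
  S w (2 ^ j.+1)%N / hls (2 ^ j.+1) @[j --> \oo] --> (0 : R)}.
Proof.
have h12 : 1 < 2 :> R by rewrite ltr1n.
have cE : (\sum_(k <= l < n) Egp l) / hls n @[n --> \oo] --> (1 : R).
  by apply: sum_asymp; exact: (integral_gain_prob_cvg X_indep X_density).
have [n0 _ Hn0] := cvgr_le 1 cE _ h12.
have ln2 : 0 < ln 2 :> R by rewrite ln_gt0.
have hpos j : 0 < hls (2 ^ j.+1) :> R by rewrite hls_pow2 !mulr_gt0 ?exprn_gt0.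
have mS n : measurable_fun setT (fun w => S w n).
  by apply: measurable_discrepancy => //; exact: measurable_samp.
pose V (m j : nat) := [set w | (m.+1%:R^-1 * hls (2 ^ j.+1)) ^+ 2 < S w (2 ^ j.+1) ^+ 2].
have mV m j : measurable (V m j).
  by apply: measurable_lt_set; [exact: measurable_cst|exact: measurable_funX].
have jn j : (j <= 2 ^ j.+1)%N by apply: ltnW; apply: ltn_trans (ltn_expl _ _).
have PV m j : (maxn n0 (maxn 4 k) <= j)%N ->
    (P (V m j) <= (4 * m.+1%:R ^+ 2 / ln 2 ^+ 2 * (j.+1%:R ^+ 2)^-1)%:E)%E.
  rewrite !geq_max => /andP[nj /andP[j4 kj]]; set n := (2 ^ j.+1)%N.
  have kn : (k <= n)%N by apply: leq_trans kj _.
  have h0 : 0 < hls n :> R := hpos j.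
  pose c : R := (m.+1%:R^-1 * hls n) ^+ 2.
  have c0 : 0 < c by rewrite exprn_gt0// mulr_gt0// invr_gt0.
  have h1 : (c%:E * P (V m j) <= (2 * hls n)%:E)%E.
    apply: (@le_trans _ _ (\int[P]_w (S w n ^+ 2)%:E)%E).
      rewrite -[V m j]setIT -integral_indic// -ge0_integralZl ?lee_fin ?(ltW c0)//; last first.
        by apply/measurable_EFinP; exact: measurable_indic.
      apply: ge0_le_integral => //.
      - by move=> w _; rewrite -EFinM lee_fin mulr_ge0// ltW.
      - by apply: emeasurable_funM => //; apply/measurable_EFinP; exact: measurable_indic.
      - by apply/measurable_EFinP; exact: measurable_funX.
      move=> w _; rewrite -EFinM lee_fin indicE.
      have [Vw|Vw] := pselect (V m j w); last by rewrite memNset//= mulr0 sqr_ge0.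
      by rewrite mem_set//= mulr1 ltW.
    apply: le_trans (discrepancy_sqr X_indep X_density _ _ kn) _ => //.
    under eq_bigr do rewrite (@integral_gp_fin _ _ _ P _ X f k A X_density A_compact).
    rewrite sumEFin lee_fin -ler_pdivrMr//.
    by apply: Hn0; exact: leq_trans (jn j).
  rewrite -[P _]fineK ?fin_num_measure// lee_fin.
  move: h1; rewrite -[P _]fineK ?fin_num_measure// -EFinM lee_fin -ler_pdivlMl//.
  move=> /le_trans; apply; rewrite le_eqVlt; apply/orP; left; apply/eqP.
  rewrite /c /n hls_pow2; field; rewrite !gt_eqF//.
have : {ae P, forall w, forall m, \forall j \near \oo, ~ V m j w}.
  apply: ae_forall_count => m; apply: (@borel_cantelli_ae _ _ _ P (V m) _ _ (mV m) _ (PV m)).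
  by rewrite divr_ge0 ?sqr_ge0// mulr_ge0// sqr_ge0.
apply: filterS => w Hw; apply/cvgrPdistC_le => eps eps0.
have [m me] : exists m, m.+1%:R^-1 <= eps.
  exists (Num.trunc eps^-1); rewrite invf_ple ?posrE//.
  by rewrite ltW// truncnS_gt.
have := Hw m; apply: filterS => j /negP; rewrite -leNgt => h.
rewrite subr0 normrM normfV (gtr0_norm (hpos j)) ler_pdivrMr//.
apply: (@le_trans _ _ (m.+1%:R^-1 * hls (2 ^ j.+1))); last by rewrite ler_wpM2r// ltW.
have u0 : 0 <= m.+1%:R^-1 * hls (2 ^ j.+1) :> R.
  by apply: mulr_ge0; [rewrite invr_ge0|exact: ltW].
rewrite -(@ler_pXn2r _ 2) ?nnegrE//.
by rewrite real_normK// num_real.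
Qed.

Lemma num_records_asymp : {ae P, forall w, (N w n)%:R / hls n @[n --> \oo] --> (1 : R)}.
Proof.
have cg := gain_prob_cvg X_indep X_density A_compact A_interior A_regular f_cont f_inf A_thin k_gt0.
have cS := discrepancy_small; move: cg cS; apply: filterS2 => w gw Sw.
apply: (@dyadic_asymp R (fun n => (N w n)%:R)).
  by move=> m n mn; rewrite ler_nat; exact: num_records_homo.
have c2 : (2 ^ j.+1)%N @[j --> \oo] --> \oo.
  move=> U [n0 _ HU]; exists n0 => // j /= h; apply: HU => /=.
  by apply: leq_trans h _; apply: ltnW; apply: ltn_trans (ltn_expl _ _).
have cs := cvg_comp _ _ c2 (sum_asymp k gw).
have ci := cvg_comp _ _ c2 (@hls_inv_cvg R).
rewrite -[X in _ --> X]add0r -[X in X + _]addr0.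
under eq_fun do rewrite num_records_discrepancy !mulrDl.
by apply: cvgD cs; apply: cvgD ci Sw.
Qed.

End main.

Theorem theorem2 (R : realType) (disp : measure_display)
  (T : measurableType disp) (P : probability T R)
  (d : nat) (A : set 'rV[R]_d.+1) (f : 'rV[R]_d.+1 -> R)
  (X : nat -> {RV P >-> borel_rV R d.+1}) (k : nat)
  (A_compact : compact A) (A_interior : A° !=set0) (A_regular : closure A° = A)
  (X_indep : mutually_independent X)
  (X_density : forall i, has_density (X i) f)
  (f_support : closure [set x | f x != 0] = A)
  (f_cont : {within A, continuous f})
  (f_inf : 0 < inf (f @` A))
  (A_shape : C11_boundary A \/ convex_set A)
  (k_gt0 : (0 < k)%N) :
  [/\ ('E_P[fun w => (num_records A (fun i => X i w) k n)%:R] /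
        (2^-1 * ln n%:R ^+ 2)%:E)%E @[n --> \oo] --> 1%E,
      {ae P, forall w,
        (num_records A (fun i => X i w) k n)%:R / (2^-1 * ln n%:R ^+ 2)
          @[n --> \oo] --> (1 : R)} &
      {ae P, forall w,
        poweR (record_time A (fun i => X i w) k n) (Num.sqrt n%:R)^-1
          @[n --> \oo] --> (expR (Num.sqrt 2))%:E}].
Proof.
have A_thin : thin_boundary A.
  by case: A_shape => [/(C11_thin_boundary A_compact)|/(convex_thin_boundary A_compact A_interior)].
have N_ae := num_records_asymp X_indep X_density A_compact A_interior A_regular
  f_support f_cont f_inf A_thin k_gt0.
split.
- exact: (expectation_asymp X_indep X_density A_compact A_interior A_regular
    f_support f_cont f_inf A_thin k_gt0).
- exact: N_ae.
- by apply: filterS N_ae => w; exact: record_time_cvg.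
Qed.
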